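(* Let $d\in\mathbb{N}$, $0<p,q\le\infty$ and $r>\sigma_p$. Then the periodization operator $\mathcal{P}$, $(\mathcal{P}f)(x)=f(|x_1|,\ldots,|x_d|)$ for $x\in[-1,1]^d$, is an isomorphism of (quasi-)normed spaces (a linear bijection bounded in both directions) $$\mathcal{P}:\; S^{r}_{p,q}B_{\mathrm{hpc}}([0,1]^d)\;\cong\; S^{r}_{p,q}B(\mathbb{T}^d)_{\mathrm{even}}.$$
   Context: $\sigma_p:=\max\{0,\tfrac1p-1\}$; $\mathbb{N}_0=\mathbb{N}\cup\{0\}$; $|\bar j|_1$ is the $\ell_1$-norm of a multi-index. The torus $\mathbb{T}^d$ is identified with $[-1,1]^d$ (antipodal boundary points identified); functions on $\mathbb{T}^d$ are also viewed as functions on $\mathbb{R}^d$ that are $2$-periodic in each variable. Dyadic decomposition of unity on $\mathbb{R}$: a family $\{\varphi_j\}_{j\in\mathbb{N}_0}$ of non-negative Schwartz functions such that (i) for some $c>0$, $\operatorname{supp}\varphi_0\subset\{|cx|\le2\}$ and $\operatorname{supp}\varphi_j\subset\{2^{j-1}\le|cx|\le2^{j+1}\}$ for $j\ge1$; (ii) for every $m\in\mathbb{N}_0$, $\sup_{x,j}2^{mj}|\partial^m\varphi_j(x)|<\infty$; (iii) $\sum_j\varphi_j\equiv1$. $\Phi_{\mathrm{hyp}}(\mathbb{R}^d)$ is the class of families $\{\varphi_{\bar j}\}_{\bar j\in\mathbb{N}_0^d}$, $\varphi_{\bar j}(x)=\varphi^{(1)}_{j_1}(x_1)\cdots\varphi^{(d)}_{j_d}(x_d)$,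 where each $\{\varphi^{(i)}_j\}_j$ is a dyadic decomposition of unity on $\mathbb{R}$. Associated kernels $\Phi_{\bar j}\in\mathcal{S}(\mathbb{R}^d)$ satisfy $\varphi_{\bar j}=\widehat{\Phi}_{\bar j}$, with $\widehat f(x)=\int_{\mathbb{R}^d} f(\xi)e^{-2\pi i x\cdot\xi}\,d\xi$. $S^r_{p,q}B(\mathbb{T}^d)$ ($r>\sigma_p$): all $f\in L_1(\mathbb{T}^d)$ with finite (quasi-)norm $\big(\sum_{\bar j\in\mathbb{N}_0^d}2^{rq|\bar j|_1}\|\Phi_{\bar j}*f\|^q_{L_p(\mathbb{T}^d)}\big)^{1/q}$ (supremum over $\bar j$ if $q=\infty$), where $f$ is viewed as a periodic function on $\mathbb{R}^d$; different families in $\Phi_{\mathrm{hyp}}(\mathbb{R}^d)$ give equivalent (quasi-)norms. $S^r_{p,q}B(\mathbb{T}^d)_{\mathrm{even}}$ is its subspace of $d$-fold even functions, i.e. $f(x_1,\ldots,x_d)=f(\pm x_1,\ldots,\pm x_d)$ for all choices of signs. Half-period cosine functions on $[0,1]^d$: $c_0:=1$, $c_k(t):=\sqrt2\cos(\pi k t)$ for $k\in\mathbb{N}$, and $c_{\bar k}(x):=c_{k_1}(x_1)\cdots c_{k_d}(x_d)$ for $\bar k\in\mathbb{N}_0^d$. $S^r_{p,q}B_{\mathrm{hpc}}([0,1]^d)$ ($r>\sigma_p$): all $f\in L_1([0,1]^d)$ with finite (quasi-)norm $\big(\sum_{\bar j\in\mathbb{N}_0^d}2^{rq|\bar j|_1}\|f^{\mathrm{hpc}}_{\bar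 j}\|^q_{L_p([0,1]^d)}\big)^{1/q}$ (supremum if $q=\infty$), where $f^{\mathrm{hpc}}_{\bar j}:=\sum_{\bar k\in\mathbb{N}_0^d}\varphi_{\bar j}(\bar k)\Big(\int_{[0,1]^d}f\,c_{\bar k}\,dx\Big)c_{\bar k}$ for a fixed $\{\varphi_{\bar j}\}_{\bar j}\in\Phi_{\mathrm{hyp}}(\mathbb{R}^d)$. *)

(* Defs.v *)
From HB Require Import structures.
From mathcomp Require Import all_boot all_order all_algebra.
From mathcomp Require Import all_classical all_reals all_analysis.
From mathcomp Require Import complex.

Set Implicit Arguments.
Unset Strict Implicit.
Unset Printing Implicit Defensive.

Import Order.TTheory GRing.Theory Num.Theory.
Import numFieldNormedType.Exports.

Local Open Scope classical_set_scope.
Local Open Scope ring_scope.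
Local Open Scope complex_scope.

(* R^d carries the product sigma-algebra of the Borel sigma-algebras. *)
Notation Rd d R := (d.-tuple (measurableTypeR R)).

Section cons_measure.
Variables (R : realType) (n : nat).

Definition consRd (x : measurableTypeR R * Rd n R) : Rd n.+1 R :=
  [the n.+1.-tuple (measurableTypeR R) of x.1 :: x.2].

Lemma measurable_consRd : measurable_fun [set: _] consRd.
Proof. exact: measurable_cons. Qed.

Variable mu : {sigma_finite_measure set (Rd n R) -> \bar R}.

Definition cons_measure : set (Rd n.+1 R) -> \bar R :=
  pushforward (@lebesgue_measure R \x mu)%E consRd.

Let pm : {measure set (Rd n.+1 R) -> \bar R} :=
  measure_function_pushforward__canonical__measure_function_Measure
    (@lebesgue_measure R \x mu)%E measurable_consRd.

Let cons_measure0 : cons_measure set0 = 0%E.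
Proof. exact: (measure0 pm). Qed.

Let cons_measure_ge0 A : (0 <= cons_measure A)%E.
Proof. exact: (measure_ge0 pm). Qed.

Let cons_measure_sigma_additive : semi_sigma_additive cons_measure.
Proof. exact: (@measure_semi_sigma_additive _ _ _ pm). Qed.

HB.instance Definition _ := isMeasure.Build _ _ _ cons_measure
  cons_measure0 cons_measure_ge0 cons_measure_sigma_additive.

Let cons_measure_sigma_finite : sigma_finite [set: Rd n.+1 R] cons_measure.
Proof.
have /sigma_finiteP[A [TA ndA Aoo]] : sigma_finite setT (@lebesgue_measure R).
  exact: (sigma_finiteT (@lebesgue_measure R :
    {sigma_finite_measure set (measurableTypeR R) -> \bar R})).
have /sigma_finiteP[B [TB ndB Boo]] := sigma_finiteT mu.
pose F k := A k `*` B k.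
have TF : setT = \bigcup_k F k.
  rewrite -setXTT TA TB predeqE => -[x y]; split; last first.
    by move=> [n' _ []/= ? ?]; split; exists n'.
  move=> [/= [i _ Aix] [k _ Bky]]; exists (maxn i k) => //; split.
    by move: x Aix; exact/subsetPset/ndA/leq_maxl.
  by move: y Bky; exact/subsetPset/ndB/leq_maxr.
have mF k : measurable (F k) /\ ((@lebesgue_measure R \x mu)%E (F k) < +oo)%E.
  have [? ?] := Aoo k; have [? ?] := Boo k.
  split; first exact: measurableX.
  by rewrite product_measure1E// lte_mul_pinfty// ge0_fin_numE.
pose g (t : Rd n.+1 R) : measurableTypeR R * Rd n R :=
  (tnth t ord0, [tuple of behead t]).
have mg : measurable_fun [set: Rd n.+1 R] g.
  apply: measurable_fun_pair; first exact: measurable_tnth.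
  exact: measurable_behead.
have gK x : g (consRd x) = x.
  by case: x => a t; rewrite /g /consRd; congr pair; apply: val_inj.
exists (fun k => g @^-1` F k).
  by rewrite -preimage_bigcup -TF preimage_setT.
move=> k; have [mFk Fk] := mF k; split.
  by rewrite -[X in measurable X]setTI; exact: mg.
rewrite /cons_measure /pushforward -comp_preimage.
by rewrite (_ : g \o consRd = id) ?preimage_id//; apply/funext => x /=; exact: gK.
Qed.

HB.instance Definition _ := Measure_isSigmaFinite.Build _ _ _ cons_measure
  cons_measure_sigma_finite.

End cons_measure.

Fixpoint lebesgue_Rd (R : realType) (d : nat) :
    {sigma_finite_measure set (Rd d R) -> \bar R} :=
  match d with
  | 0%N => \d_ ([tuple] : Rd 0 R)
  | n.+1 => cons_measure (lebesgue_Rd R n)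
  end.

Lemma lebesgue_Rd_box (R : realType) (d : nat)
    (A : 'I_d -> set (measurableTypeR R)) :
  (forall i, measurable (A i)) ->
  lebesgue_Rd R d [set x | forall i, A i (tnth x i)] =
  (\prod_(i < d) lebesgue_measure (A i))%E.
Proof.
elim: d A => [|n IHn] A mA.
  rewrite big_ord0 /= diracE mem_set//= => -[].
  by case.
rewrite big_ord_recl /= /cons_measure /pushforward.
rewrite (_ : _ @^-1` _ = A ord0 `*`
  [set x : Rd n R | forall i, A (lift ord0 i) (tnth x i)]); last first.
  apply/seteqP; split => -[a t] /=.
    move=> H; split; first exact: (H ord0).
    by move=> i; have := H (lift ord0 i); rewrite tnthS.
  move=> [H0 H] i; case: (unliftP ord0 i) => [k ->|->]; last exact: H0.
  by rewrite tnthS; exact: H.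
rewrite product_measure1E//;
  first by congr (_ * _)%E; exact: (IHn (fun i => A (lift ord0 i))).
rewrite (_ : [set _ | _] = \bigcap_(i in [set: 'I_n])
    ((fun x : Rd n R => tnth x i) @^-1` (A (lift ord0 i)))).
  apply: fin_bigcap_measurable => // i _.
  by rewrite -[X in measurable X]setTI; apply: measurable_tnth.
apply/seteqP; split => x /= H i; first by move=> _; exact: H.
exact: (H i I).
Qed.

Section complex_functions.
Variables (R : realType) (d : nat).
Implicit Types (D : set (Rd d R)) (f g : Rd d R -> R[i]) (x y : Rd d R).

Definition xcoord x (i : 'I_d) : R := tnth x i.

Definition unit_cube : set (Rd d R) :=
  [set x | forall i, 0 <= xcoord x i <= 1].

Definition torus_cube : set (Rd d R) :=
  [set x | forall i, -1 <= xcoord x i <= 1].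

Definition cintegral D f : R[i] :=
  (\int[lebesgue_Rd R d]_(x in D) complex.Re (f x)) +i*
  (\int[lebesgue_Rd R d]_(x in D) complex.Im (f x)).

Definition L1 D : set (Rd d R -> R[i]) :=
  [set f | (lebesgue_Rd R d).-integrable D (fun x => (complex.Re (f x))%:E) /\
           (lebesgue_Rd R d).-integrable D (fun x => (complex.Im (f x))%:E)].

(* For 0 < p <= +oo, the L_p (quasi-)norm on D: 'N is defined for functions on
   the whole space, hence the extension by 0 outside D. *)
Definition Lpnorm (p : \bar R) D f : \bar R :=
  ('N[lebesgue_Rd R d]_p [(fun x => (Normc.normc (f x))%:E) \_ D])%E.

Definition expi (t : R) : R[i] := cos t +i* sin t.

Definition fourier f x : R[i] :=
  cintegral setT
    (fun xi => f xi * expi (- (2 * pi * \sum_(i < d) xcoord x i * xcoord xi i))).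

Definition convolution f g x : R[i] :=
  cintegral setT (fun y =>
    f y * g [tuple (xcoord x i - xcoord y i : measurableTypeR R) | i < d]).

End complex_functions.

Arguments unit_cube : clear implicits.
Arguments torus_cube : clear implicits.

Section schwartz.
Variable R : realType.

Definition schwartz1 : set (R -> R) :=
  [set f | (forall n x, derivable (derive1n n f) x 1) /\
           (forall k n : nat, exists C, forall x, `|x ^+ k * derive1n n f x| <= C)].

Variable d : nat.
Implicit Types (f : Rd d R -> R) (x : Rd d R).

Definition update_coord x (i : 'I_d) (t : R) : Rd d R :=
  [tuple (if k == i then t else xcoord x k : measurableTypeR R) | k < d].

Definition partial (i : 'I_d) f : Rd d R -> R :=
  fun x => derive1 (fun t => f (update_coord x i t)) (xcoord x i).

Definition partials (s : seq 'I_d) f : Rd d R -> R := foldr partial f s.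

(* All iterated partial derivatives, in any order, are required to exist and
   to be bounded; each of them is then Lipschitz, so that f is C^oo. *)
Definition rschwartz : set (Rd d R -> R) :=
  [set f |
    (forall s i x,
       derivable (fun t => partials s f (update_coord x i t)) (xcoord x i) 1) /\
    (forall (k : d.-tuple nat) s, exists C, forall x,
       `|(\prod_(i < d) xcoord x i ^+ tnth k i) * partials s f x| <= C)].

Definition schwartz : set (Rd d R -> R[i]) :=
  [set F | rschwartz (fun x => complex.Re (F x)) /\
           rschwartz (fun x => complex.Im (F x))].

End schwartz.

Section decomposition.
Variable R : realType.

Definition dyadic_decomposition (phi : nat -> R -> R) : Prop :=
  [/\ forall j, schwartz1 (phi j) /\ (forall x, 0 <= phi j x),
      exists2 c : R, 0 < c &
        closure [set x | phi 0%N x != 0] `<=` [set x | `|c * x| <= 2] /\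
        forall j : nat, (0 < j)%N ->
          closure [set x | phi j x != 0] `<=`
            [set x | 2 ^+ j.-1 <= `|c * x| <= 2 ^+ j.+1],
      forall m : nat, exists C, forall j x,
        2 ^+ (m * j) * `|derive1n m (phi j) x| <= C &
      forall x, \sum_(0 <= j < n) phi j x @[n --> \oo] --> (1 : R)].

Variable d : nat.

Definition Phi_hyp : set (d.-tuple nat -> Rd d R -> R) :=
  [set v | exists2 phi : 'I_d -> nat -> R -> R,
     forall i, dyadic_decomposition (phi i) &
     forall j x, v j x = \prod_(i < d) phi i (tnth j i) (xcoord x i)].

Definition kernels_of (v : d.-tuple nat -> Rd d R -> R)
    (Phi : d.-tuple nat -> Rd d R -> R[i]) : Prop :=
  forall j, schwartz (Phi j) /\ forall x, fourier (Phi j) x = (v j x)%:C.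

Definition l1norm (j : d.-tuple nat) : nat := (\sum_(i < d) tnth j i)%N.

(* The norm (sum_j 2^(r q |j|_1) a_j^q)^(1/q), resp. sup_j 2^(r |j|_1) a_j if
   q = +oo (the junk case q = -oo is excluded by 0 < q). *)
Definition besov_lq (r : R) (q : \bar R) (a : d.-tuple nat -> \bar R) : \bar R :=
  match q with
  | s%:E => ((\esum_(j in [set: d.-tuple nat])
                 ((2 `^ (r * s * (l1norm j)%:R))%:E * a j `^ s)) `^ s^-1)%E
  | _ => ereal_sup
           (range (fun j => (2 `^ (r * (l1norm j)%:R))%:E * a j)%E)
  end.

End decomposition.

Definition sigma_p (R : realType) (p : \bar R) : \bar R := maxe 0%E (p^-1 - 1)%E.

(* A (quasi-)normed space of classes of functions on R^d: its elements are the
   functions in [carrier], identified when they are related by [eqv]. *)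
Record qnspace (R : realType) (d : nat) := QNSpace {
  carrier : set (Rd d R -> R[i]);
  eqv : (Rd d R -> R[i]) -> (Rd d R -> R[i]) -> Prop;
  qnorm : (Rd d R -> R[i]) -> \bar R }.

Section spaces.
Variables (R : realType) (d : nat).
Implicit Types (f : Rd d R -> R[i]) (x : Rd d R).

Definition ae_eq_on (D : set (Rd d R)) (f g : Rd d R -> R[i]) : Prop :=
  f = g %[ae lebesgue_Rd R d in D].

Section torus.

(* A function on the torus is a function on [-1,1]^d up to a.e. equality;
   [torus_ext f] is its extension to R^d, 2-periodic in each variable. *)
Definition wrap_torus (t : R) : R := t - 2 * (Num.floor ((t + 1) / 2))%:~R.

Definition torus_ext f : Rd d R -> R[i] :=
  fun x => f [tuple (wrap_torus (xcoord x i) : measurableTypeR R) | i < d].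

Definition flip_signs (e : d.-tuple bool) x : Rd d R :=
  [tuple ((-1) ^+ tnth e i * xcoord x i : measurableTypeR R) | i < d].

Definition even_torus f : Prop :=
  forall e, ae_eq_on (torus_cube R d) (f \o flip_signs e) f.

Variables (r : R) (p q : \bar R) (Phi : d.-tuple nat -> Rd d R -> R[i]).

Definition besov_torus_norm f : \bar R :=
  besov_lq r q (fun j =>
    Lpnorm p (torus_cube R d) (convolution (Phi j) (torus_ext f))).

Definition besov_torus : qnspace R d := {|
  carrier := [set f | L1 (torus_cube R d) f /\ (besov_torus_norm f < +oo)%E];
  eqv := ae_eq_on (torus_cube R d);
  qnorm := besov_torus_norm |}.

Definition besov_torus_even : qnspace R d := {|
  carrier := [set f | carrier besov_torus f /\ even_torus f];
  eqv := eqv besov_torus;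
  qnorm := qnorm besov_torus |}.

End torus.

Section half_period_cosine.

Definition cos1 (k : nat) (t : R) : R :=
  if k is 0%N then 1 else Num.sqrt 2 * cos (pi * k%:R * t).

Definition hpc (k : d.-tuple nat) x : R :=
  \prod_(i < d) cos1 (tnth k i) (xcoord x i).

Definition hpc_coef f (k : d.-tuple nat) : R[i] :=
  cintegral (unit_cube R d) (fun x => f x * (hpc k x)%:C).

Definition nat_point (k : d.-tuple nat) : Rd d R :=
  [tuple ((tnth k i)%:R : measurableTypeR R) | i < d].

Variables (r : R) (p q : \bar R) (v : d.-tuple nat -> Rd d R -> R).

(* For v in Phi_hyp, only finitely many terms of the sum are nonzero. *)
Definition hpc_block f (j : d.-tuple nat) : Rd d R -> R[i] :=
  fun x => \sum_(k \in [set: d.-tuple nat])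
    (v j (nat_point k))%:C * hpc_coef f k * (hpc k x)%:C.

Definition besov_hpc_norm f : \bar R :=
  besov_lq r q (fun j => Lpnorm p (unit_cube R d) (hpc_block f j)).

Definition besov_hpc : qnspace R d := {|
  carrier := [set f | L1 (unit_cube R d) f /\ (besov_hpc_norm f < +oo)%E];
  eqv := ae_eq_on (unit_cube R d);
  qnorm := besov_hpc_norm |}.

End half_period_cosine.

Definition periodization f : Rd d R -> R[i] :=
  fun x => f [tuple (`|xcoord x i| : measurableTypeR R) | i < d].

End spaces.

(* T induces a linear bijection between the classes of X and those of Y that is
   bounded in both directions. *)
Definition qn_isomorphism (R : realType) (d : nat) (X Y : qnspace R d)
    (T : (Rd d R -> R[i]) -> (Rd d R -> R[i])) : Prop :=
  [/\ (forall f, carrier X f -> carrier Y (T f)) /\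
      (forall f g, carrier X f -> carrier X g -> eqv X f g -> eqv Y (T f) (T g)),
      forall (a : R[i]) f g, carrier X f -> carrier X g ->
        eqv Y (T (fun x => a * f x + g x)) (fun x => a * T f x + T g x),
      (forall f g, carrier X f -> carrier X g -> eqv Y (T f) (T g) -> eqv X f g) /\
      (forall g, carrier Y g -> exists2 f, carrier X f & eqv Y (T f) g),
      exists C : R, forall f, carrier X f -> (qnorm Y (T f) <= C%:E * qnorm X f)%E &
      exists C : R, forall f, carrier X f -> (qnorm X f <= C%:E * qnorm Y (T f))%E].

(* Main.v *)
Require Import Defs.
From mathcomp Require Import all_boot all_order all_algebra.
From mathcomp Require Import all_classical all_reals all_analysis.
From mathcomp Require Import measurable_realfun ess_sup_inf complex ring lra zify.

Set Implicit Arguments.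
Unset Strict Implicit.
Unset Printing Implicit Defensive.

Import Order.TTheory GRing.Theory Num.Theory.
Import numFieldNormedType.Exports.

Local Open Scope classical_set_scope.
Local Open Scope ring_scope.
Local Open Scope complex_scope.

(** Why the theorem holds.  Let F be the periodization of f: the even function
    on the torus that folds back to f.  Both norms cut the Fourier series of F
    into dyadic blocks, with two different families of symbols.

    On the cosine side, averaging over the sign flips of the coordinates and
    folding the torus onto the cube shows that the Fourier coefficient of F at
    l is, up to a normalization, the cosine coefficient of f at |l|
    ([fcoef_periodization]); hence the j-th cosine block is the trigonometric
    sum with symbol phi_j(|l|) ([hpc_block_trig]).  On the torus side,
    convolution with Psi_j multiplies the coefficients by psi_j(l/2)
    ([fcoef_convolution]), and uniqueness of the Fourier coefficients of an
    integrable function ([fourier_uniqueness]) identifies the convolution with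
    the corresponding trigonometric sum ([convolution_trig]).

    Both l |-> psi_j(l/2) and l |-> phi_j(|l|) are tensor products of families
    in the class [mult_family]: the j-th symbol lives on integers of size about
    2^j, its differences of order L are O(2^(-jL)), and the symbols add up to 1.
    For two such families u and w, the symbol u_j is the sum of the products
    u_j w_j' over the j' close to j.  On the frequencies in question,
    multiplication by u_j is a finite combination of translations
    g |-> sum_n kap_n g(. - t_n) in which the sum of |kap_n|^s is bounded
    independently of j, for any given s > 0: the weights kap are a discrete
    Fourier transform of the symbol, and its differences make them decay
    ([discrete_kernel], [kernel_sum], [reproducing]).  The L_p quasi-norm on the
    torus is invariant under translations, and its power min(1,p) is
    subadditive.  So each block formed with u is bounded in L_p by a constant
    times a neighbouring block formed with w ([multiplier_comparison]), also
    for p < 1.  Neighbouring indices have comparable weights, and the l_q norms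
    follow ([besov_lq_le]).

    The cosine blocks are even, so that their quasi-norms over the torus and
    over the cube are equivalent ([cosine_norms]).  Surjectivity holds because
    an even class g on the torus is almost everywhere the periodization of its
    own restriction to the cube ([even_periodization]). *)

(** * Chords of the unit circle *)
Section expi.
Variable R : realType.
Implicit Types a b t : R.

Lemma expiD a b : expi (a + b) = expi a * expi b.
Proof.
rewrite /expi cosD sinD; apply/eqP; rewrite eq_complex /=.
by rewrite eqxx /= addrC.
Qed.

Lemma expi0 : expi 0 = 1 :> R[i].
Proof. by rewrite /expi cos0 sin0. Qed.

Lemma expiM_nat a (n : nat) : expi (a * n%:R) = expi a ^+ n.
Proof.
elim: n => [|n IH]; first by rewrite mulr0 expi0 expr0.
by rewrite -natr1 mulrDr mulr1 expiD IH exprSr.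
Qed.

Lemma expi_2pi : expi (2 * pi) = 1 :> R[i].
Proof. by rewrite /expi mulr_natl cos2pi sin2pi. Qed.

Lemma normc_expi a : Normc.normc (expi a) = 1.
Proof. by rewrite /expi /= cos2Dsin2 sqrtr1. Qed.

Lemma expi_sum (I : Type) (s : seq I) (P : pred I) (F : I -> R) :
  expi (\sum_(i <- s | P i) F i) = \prod_(i <- s | P i) expi (F i).
Proof. by apply: (big_morph _ expiD expi0). Qed.

Lemma expi_2pi_int (k : int) : expi (2 * pi * k%:~R) = 1 :> R[i].
Proof.
case: k => n; first by rewrite expiM_nat expi_2pi expr1n.
rewrite NegzE mulrNz mulrN.
have /= := expiD (- (2 * pi * n.+1%:R)) (2 * pi * n.+1%:R).
by rewrite addNr expi0 expiM_nat expi_2pi expr1n mulr1 => <-.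
Qed.

Lemma cos_pi4 : cos (pi / 4) ^+ 2 = 2^-1 :> R.
Proof.
have := @cos_mulr2n R (pi / 4).
have -> : pi / 4 *+ 2 = pi / 2 :> R by lra.
rewrite cos_pihalf mulr2n; lra.
Qed.

(** From sin x = 2 sin (x/2) cos (x/2): on [0, pi/4] both the cosine and, by the
    mean value theorem, the slope of the sine are at least cos (pi/4), whose
    square is 1/2. *)
Lemma sin_ge_half (x : R) : 0 <= x <= pi / 2 -> x / 2 <= sin x.
Proof.
move=> /andP[x0 xpi].
have pi0 := @pi_gt0 R.
have [y yE] : exists y, y = x / 2 by exists (x / 2).
have y0 : 0 <= y by rewrite yE; lra.
have ypi : y <= pi / 4 by rewrite yE; lra.
pose c4 : R := cos (pi / 4).
have c40 : 0 <= c4.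
  apply: cos_ge0_pihalf; apply/andP; split; lra.
have cosle u : 0 <= u <= y -> c4 <= cos u.
  move=> /andP[u0 uy]; rewrite /c4.
  have [->//|une] := eqVneq u (pi / 4).
  apply/ltW; rewrite ltr_cos ?in_itv /=.
  - rewrite lt_neqAle une /=; lra.
  - apply/andP; split; lra.
  - apply/andP; split; lra.
have [y00|yn0] := eqVneq y 0.
  have -> : x = 0 by move: y00; rewrite yE; lra.
  by rewrite sin0 mul0r.
have yp : 0 < y by rewrite lt0r yn0.
have der z : z \in `]0, y[%R -> is_derive z 1 (@sin R) (cos z).
  by move=> _; exact: is_derive_sin.
have cont : {within `[0, y], continuous (@sin R)}.
  by apply: continuous_subspaceT; exact: continuous_sin.
have [c] := MVT yp der cont; rewrite in_itv /= => /andP[c0 cy].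
rewrite sin0 !subr0 => siny.
have e : sin x = (cos y * sin y) *+ 2.
  by rewrite -sin_mulr2n; congr (sin _); rewrite yE; lra.
have h1 : c4 <= cos c by apply: cosle; apply/andP; split; lra.
have h2 : c4 <= cos y by apply: cosle; apply/andP; split; lra.
have h3 : c4 * c4 <= cos y * cos c by apply: ler_pM.
have h4 : c4 * c4 = 2^-1 by rewrite -expr2; exact: cos_pi4.
have h5 : 2^-1 * y <= (cos y * cos c) * y by apply: ler_wpM2r; lra.
rewrite e siny mulrA; lra.
Qed.

Lemma normc_1Bexpi (x : R) : 0 <= x <= pi ->
  Normc.normc (1 - expi (2 * x)) = 2 * sin x.
Proof.
move=> xpi.
have -> : 1 - expi (2 * x) = (1 - cos (2 * x)) +i* (- sin (2 * x)).
  by apply/eqP; rewrite eq_complex /= add0r !eqxx.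
rewrite /=.
have s0 : 0 <= sin x by exact: sin_ge0_pi.
have e1 : cos (2 * x) = 1 - 2 * sin x ^+ 2.
  by rewrite mulr_natl cos_mulr2n cos2sin2 mulr2n; ring.
have e2 : sin (2 * x) ^+ 2 = 1 - cos (2 * x) ^+ 2 by rewrite -sin2cos2.
rewrite sqrrN e2 e1.
rewrite (_ : _ + _ = (2 * sin x) ^+ 2); last by ring.
by rewrite sqrtr_sqr ger0_norm // mulr_ge0.
Qed.

(** The chord has length 2 sin (pi n / M).  Dividing by it is what turns
    smallness of the differences of a symbol into decay of its kernel. *)
Lemma normc_1Broot (n M : nat) : (n <= M)%N -> (0 < M)%N ->
  (minn n (M - n))%:R / M%:R
    <= Normc.normc (1 - expi (2 * pi / M%:R * n%:R) : R[i]).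
Proof.
move=> nM M0.
have pi0 := @pi_gt0 R; have pi2 := @pi_ge2 R.
have M0' : (0 : R) < M%:R by rewrite ltr0n.
have nM' : (n%:R : R) <= M%:R by rewrite ler_nat.
have n0' : (0 : R) <= n%:R by rewrite ler0n.
pose u : R := n%:R / M%:R.
have u0 : 0 <= u by rewrite divr_ge0.
have u1 : u <= 1 by rewrite ler_pdivrMr // mul1r.
have -> : 2 * pi / M%:R * n%:R = 2 * (pi * u) :> R by rewrite /u; ring.
rewrite normc_1Bexpi; last first.
  by apply/andP; split; nra.
have [u2|u2] := lerP u 2^-1.
  have h : pi * u / 2 <= sin (pi * u) by apply: sin_ge_half; apply/andP; split; nra.
  apply: (@le_trans _ _ u).
    by rewrite ler_pM2r ?invr_gt0 // ler_nat geq_minl.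
  nra.
have -> : sin (pi * u) = sin (pi * (1 - u)).
  by rewrite mulrBr mulr1 addrC sinDpi sinN opprK.
have h : pi * (1 - u) / 2 <= sin (pi * (1 - u)).
  by apply: sin_ge_half; apply/andP; split; nra.
apply: (@le_trans _ _ (1 - u)).
  have -> : 1 - u = (M - n)%:R / M%:R.
    by rewrite /u natrB // mulrBl divff // gt_eqF.
  by rewrite ler_pM2r ?invr_gt0 // ler_nat geq_minr.
nra.
Qed.

End expi.

(** * Multipliers as finite combinations of translations *)
Section kernel.
Variable R : realType.
Implicit Types (m : int -> R) (l : int).

Definition nabla m : int -> R := fun l => m l - m (l - 1).

(** Summation by parts in polynomial form: multiplying the generating
    polynomial of [m] by 1 - 'X takes backward differences of its
    coefficients.  The shift by N moves the support of [m] to exponents >= 0. *)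
Lemma coef_1BX_exp (L : nat) m (N : nat) (P : {poly R[i]}) :
  (forall l, l < - N%:Z -> m l = 0) ->
  (forall k : nat, P`_k = (m (k%:Z - N%:Z))%:C) ->
  forall k : nat, (P * (1 - 'X) ^+ L)`_k = (iter L nabla m (k%:Z - N%:Z))%:C.
Proof.
elim: L m P => [|L IH] m P m0 Pm k; first by rewrite expr0 mulr1 Pm.
rewrite exprS mulrA iterSr; apply: IH.
- by move=> l lN; rewrite /nabla !m0 ?subrr //; lia.
move=> {}k; rewrite mulrBr mulr1 coefB coefMX Pm /nabla rmorphB.
case: k => [|k] /=; first by rewrite [m (_ - 1)]m0 //; lia.
by rewrite Pm; congr (_ - (m _)%:C); lia.
Qed.

Lemma normc_horner_le (P : {poly R[i]}) (z : R[i]) (n : nat) (B : R) :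
  Normc.normc z = 1 -> (size P <= n)%N ->
  (forall k, Normc.normc P`_k <= B) -> Normc.normc P.[z] <= n%:R * B.
Proof.
move=> z1 sP PB; rewrite (horner_coef_wide _ sP).
have zk k : Normc.normc (z ^+ k) = 1.
  elim: k => [|k IH]; first by rewrite expr0 Normc.normc1.
  by rewrite exprS Normc.normcM z1 IH mulr1.
apply: (@le_trans _ _ (\sum_(i < n) Normc.normc (P`_i * z ^+ i))).
  elim/big_rec2: _ => [|i y1 y2 _ h]; first by rewrite Normc.normc0.
  by apply: le_trans (le_normcD _ _) _; rewrite lerD2l.
rewrite mulr_natl -[X in _ *+ X]card_ord -sumr_const; apply: ler_sum => i _.
by rewrite Normc.normcM zk mulr1.
Qed.

Lemma sum_root_unity (M : nat) (k : int) : (0 < M)%N -> `|k| < M%:Z ->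
  \sum_(n < M) (expi (2 * pi * k%:~R / M%:R * n%:R) : R[i])
    = if k == 0 then M%:R else 0.
Proof.
move=> M0 kM.
have M0' : (M%:R : R) != 0 by rewrite pnatr_eq0 -lt0n.
case: eqP => [->|/eqP k0].
  under eq_bigr do rewrite mulr0 !mul0r expi0.
  by rewrite sumr_const card_ord.
pose z : R[i] := expi (2 * pi * k%:~R / M%:R).
under eq_bigr do rewrite expiM_nat -/z.
have zM : z ^+ M = 1 by rewrite -expiM_nat mulfVK ?expi_2pi_int.
have := subrX1 z M; rewrite zM subrr => /esym/eqP; rewrite mulf_eq0.
case/orP => [|/eqP //]; rewrite subr_eq0 => /eqP z1; exfalso.
move: z1; rewrite /z; clear z zM => z1.
have [n [nM n0 e]] : exists n : nat, [/\ (n < M)%N, (0 < n)%N &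
    expi (2 * pi / M%:R * n%:R) = 1 :> R[i]].
  case: k k0 kM z1 => n k0 kM z1.
    by exists n; split; [lia|lia|rewrite -z1; congr expi; rewrite -pmulrn; ring].
  exists (M - n.+1)%N; split; [lia|lia|].
  rewrite -[RHS](expi_2pi R) -[RHS]mulr1 -z1 -expiD; congr expi.
  rewrite natrB; last by lia.
  rewrite NegzE mulrNz -pmulrn; field; exact: M0'.
have := @normc_1Broot R n M (ltnW nM) M0.
rewrite e subrr Normc.normc0 leNgt divr_gt0 // ltr0n; lia.
Qed.

(** [kap] is the discrete Fourier transform of [m] on M equidistant nodes of the
    circle, so that [m] is recovered by orthogonality of the roots of unity.
    For the decay, (1 - w_n)^L times the transform of [m] is the transform of
    its L-th difference, and |1 - w_n| is bounded below by [normc_1Broot]; n and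
    M - n are equally far from 0 on the circle, hence the minimum. *)
Lemma discrete_kernel (L N : nat) m (B : R) : (0 < N)%N ->
  (forall l, N%:Z < `|l| -> m l = 0) -> (forall l, `|m l| <= B) ->
  (forall l, `|iter L nabla m l| * N%:R ^+ L <= B) ->
  let M := (N.*2.+1)%N in
  exists kap : nat -> R[i],
    (forall l, `|l| <= N%:Z ->
      \sum_(n < M) kap n * expi (- (2 * pi * l%:~R / M%:R * n%:R)) = (m l)%:C) /\
    (forall n, (n < M)%N -> Normc.normc (kap n) <= B /\
       Normc.normc (kap n) * (minn n (M - n))%:R ^+ L <= 3 ^+ L * L.+1%:R * B).
Proof.
move=> N0 msupp mB mL M.
have M0 : (0 < M)%N by [].
have M0' : (0 : R) < M%:R by rewrite ltr0n.
have N0' : (0 : R) < N%:R by rewrite ltr0n.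
have B0 : 0 <= B by apply: le_trans (mB 0).
pose P : {poly R[i]} := \poly_(k < M) (m (k%:Z - N%:Z))%:C.
have PE (k : nat) : P`_k = (m (k%:Z - N%:Z))%:C.
  rewrite coef_poly; case: ltnP => // kM.
  by rewrite msupp ?rmorph0 //; lia.
have Psize : (size P <= M)%N by exact: size_poly.
pose w (n : nat) : R[i] := expi (2 * pi / M%:R * n%:R).
(* the exponential undoes the shift by N in the exponents of P *)
pose kap (n : nat) : R[i] :=
  M%:R^-1 * (expi (- (2 * pi * N%:R / M%:R * n%:R)) * P.[w n]).
exists kap; split.
- move=> l lN.
  have -> : \sum_(n < M) kap n * expi (- (2 * pi * l%:~R / M%:R * n%:R)) =
    \sum_(k < M) (m (k%:Z - N%:Z))%:C * (M%:R^-1 *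
      \sum_(n < M) expi (2 * pi * (k%:Z - N%:Z - l)%:~R / M%:R * n%:R)).
    under eq_bigr do rewrite /kap (horner_coef_wide _ Psize) !mulr_sumr mulr_suml.
    rewrite exchange_big; apply: eq_bigr => k _ /=.
    rewrite !mulr_sumr; apply: eq_bigr => n _.
    rewrite PE /w -expiM_nat.
    set A := expi _; set D := expi _; set E := expi _; set F := expi _.
    have -> : F = A * D * E.
      rewrite /F /A /D /E -!expiD; congr expi.
      rewrite !rmorphB /= -!pmulrn; ring.
    ring.
  have kl : (absz (l + N%:Z)%R < M)%N by lia.
  rewrite (bigD1 (Ordinal kl)) //= [X in _ + X = _]big1 ?addr0.
    rewrite sum_root_unity //; last by lia.
    have -> : (absz (l + N%:Z))%:Z - N%:Z - l = 0 by lia.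
    rewrite eqxx mulVf ?mulr1.
      by congr (m _)%:C; lia.
    by rewrite pnatr_eq0 -lt0n.
  move=> k kne; rewrite sum_root_unity //.
    rewrite ifN ?mulr0 //; apply: contra kne => /eqP h.
    by apply/eqP/val_inj => /=; lia.
  by have := ltn_ord k; lia.
move=> n nM.
have nC (x : R) : Normc.normc (x%:C) = `|x|.
  by rewrite /= expr0n /= addr0 sqrtr_sqr.
have nV : Normc.normc (M%:R^-1 : R[i]) = M%:R^-1.
  by rewrite Normc.normcV -(rmorph_nat (real_complex R)) nC normr_nat.
have nk : Normc.normc (kap n) = M%:R^-1 * Normc.normc P.[w n].
  by rewrite /kap !Normc.normcM normc_expi mul1r nV.
have w1 : Normc.normc (w n) = 1 by exact: normc_expi.
split.
  rewrite nk mulrC ler_pdivrMr // mulrC.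
  by apply: normc_horner_le => // k; rewrite PE nC.
have H : Normc.normc ((P * (1 - 'X) ^+ L).[w n]) <= (M + L)%:R * (B / N%:R ^+ L).
  apply: normc_horner_le => //.
    apply: leq_trans (size_polyMleq _ _) _.
    have s2 : (size ((1 - 'X : {poly R[i]}) ^+ L) <= L.+1)%N.
      have -> : (1 - 'X : {poly R[i]}) = - ('X - 1%:P) by rewrite opprB.
      by rewrite exprNn -signr_odd size_Msign size_exp_XsubC.
    move: Psize s2; set a := size P; set b := size _ => a1 b1; lia.
  move=> k; rewrite (@coef_1BX_exp L m N P) //; last first.
    by move=> l lN; apply: msupp; lia.
  by rewrite nC ler_pdivlMr ?exprn_gt0.
rewrite hornerM in H.
have e1 : ((1 - 'X : {poly R[i]}) ^+ L).[w n] = (1 - w n) ^+ L.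
  by rewrite horner_exp !hornerE.
rewrite e1 Normc.normcM in H.
have e2 : Normc.normc ((1 - w n) ^+ L) = Normc.normc (1 - w n) ^+ L.
  elim: (L) => [|j IH]; first by rewrite !expr0 Normc.normc1.
  by rewrite !exprS Normc.normcM IH.
rewrite e2 in H.
have q0 : 0 <= (minn n (M - n))%:R / M%:R :> R by rewrite divr_ge0.
have H2 : ((minn n (M - n))%:R / M%:R) ^+ L <= Normc.normc (1 - w n) ^+ L.
  rewrite lerXn2r ?nnegrE //.
    exact: (le_trans q0 (normc_1Broot R (ltnW nM) M0)).
  exact: normc_1Broot (ltnW nM) M0.
set p := Normc.normc P.[w n] in nk H *.
have p0 : 0 <= p by rewrite /p; case: (P.[_]) => a b /=; exact: sqrtr_ge0.
have H3 : p * ((minn n (M - n))%:R / M%:R) ^+ L <= (M + L)%:R * (B / N%:R ^+ L).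
  by apply: le_trans H; rewrite ler_wpM2l.
rewrite nk; set mn := (minn _ _)%:R in H3 *.
rewrite expr_div_n in H3.
have -> : M%:R^-1 * p * mn ^+ L =
    (p * (mn ^+ L / M%:R ^+ L)) * (M%:R ^+ L / M%:R).
  by field; rewrite gt_eqF // expf_neq0 // gt_eqF.
apply: (le_trans (ler_wpM2r _ H3)); first by rewrite divr_ge0 // exprn_ge0 ?ltW.
have -> : (M + L)%:R * (B / N%:R ^+ L) * (M%:R ^+ L / M%:R) =
  ((M%:R / N%:R) ^+ L) * ((M + L)%:R / M%:R) * B.
  by rewrite expr_div_n; field; rewrite !gt_eqF // exprn_gt0.
apply: ler_wpM2r => //; apply: ler_pM.
- by rewrite exprn_ge0 // divr_ge0.
- by rewrite divr_ge0.
- rewrite lerXn2r ?nnegrE ?divr_ge0 // ler_pdivrMr // -natrM ler_nat /M; lia.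
rewrite ler_pdivrMr // -natrM ler_nat; nia.
Qed.

End kernel.

Section kernel_sum.
Variable R : realType.

Lemma sum_inv_sqr (n : nat) :
  \sum_(k < n) (k.+1%:R ^+ 2)^-1 <= 2 :> R.
Proof.
suff H : \sum_(k < n.+1) (k.+1%:R ^+ 2)^-1 <= 2 - n.+1%:R^-1 :> R.
  apply: (@le_trans _ _ (2 - n.+1%:R^-1)); last by rewrite gerBl invr_ge0.
  by apply: le_trans H; rewrite big_ord_recr /= lerDl invr_ge0 exprn_ge0.
elim: n => [|n IH]; first by rewrite big_ord1 expr1n invr1; lra.
rewrite big_ord_recr /=; apply: (le_trans (lerD IH (lexx _))).
have n0 : (0 : R) < n.+1%:R by rewrite ltr0n.
rewrite -[n.+2%:R]natr1; set x := n.+1%:R in n0 *.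
have e : x^-1 - (x + 1)^-1 - ((x + 1) ^+ 2)^-1 = (x * (x + 1) ^+ 2)^-1.
  by field; rewrite !gt_eqF //; lra.
have : 0 < (x * (x + 1) ^+ 2)^-1.
  by rewrite invr_gt0 mulr_gt0 ?exprn_gt0 //; lra.
rewrite -e; move: x^-1 (x + 1)^-1 ((x + 1) ^+ 2)^-1 => a b c; lra.
Qed.

Lemma powR_decay (s : R) (L : nat) (k : nat) (a D : R) :
  0 < s -> 2 <= L%:R * s -> 0 <= a ->
  a * k.+1%:R ^+ L <= D -> a `^ s <= D `^ s * (k.+1%:R ^+ 2)^-1.
Proof.
move=> s0 sL a0 aD.
have k0 : (0 : R) < k.+1%:R by rewrite ltr0n.
have k1 : (1 : R) <= k.+1%:R by rewrite ler1n.
rewrite ler_pdivlMr ?exprn_gt0 //.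
have h : (a * k.+1%:R ^+ L) `^ s <= D `^ s.
  have ak0 : 0 <= a * k.+1%:R ^+ L by rewrite mulr_ge0 // exprn_ge0.
  by apply: ge0_ler_powR; rewrite ?nnegrE ?(ltW s0) // (le_trans ak0).
apply: le_trans h; rewrite powRM ?exprn_ge0 //.
apply: ler_wpM2l; first exact: powR_ge0.
by rewrite -!powR_mulrn // -powRrM ler_powR.
Qed.

(** The n-th weight decays like the L-th inverse power of its distance to 0 on
    the circle, so that its s-th powers are summable, uniformly in N, once
    L s >= 2.  A small s serves the spaces with p < 1. *)
Lemma kernel_sum (s : R) (L : nat) : 0 < s -> 2 <= L%:R * s ->
  exists2 C : R, 0 <= C & forall (N : nat) (m : int -> R) (B : R),
    (0 < N)%N -> (forall l, N%:Z < `|l| -> m l = 0) -> (forall l, `|m l| <= B) ->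
    (forall l, `|iter L (@nabla R) m l| * N%:R ^+ L <= B) ->
    let M := (N.*2.+1)%N in
    exists kap : nat -> R[i],
      [/\ forall l, `|l| <= N%:Z ->
            \sum_(n < M) kap n * expi (- (2 * pi * l%:~R / M%:R * n%:R))
              = (m l)%:C,
          forall n, (M <= n)%N -> kap n = 0 &
          \sum_(n < M) Normc.normc (kap n) `^ s <= C * B `^ s].
Proof.
move=> s0 sL.
pose D0 : R := 3 ^+ L * L.+1%:R.
have D1 : 1 <= D0 by rewrite mulr_ege1 ?ler1n // exprn_ege1 //; lra.
have D00 : 0 <= D0 by exact: le_trans ler01 D1.
exists (5 * D0 `^ s); first by rewrite mulr_ge0 // powR_ge0.
move=> N m B N0 msupp mB mL M.
have B0 : 0 <= B by apply: le_trans (mB 0).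
have [kap0 [kapE kapB]] := discrete_kernel N0 msupp mB mL.
have nn (z : R[i]) : 0 <= Normc.normc z.
  by case: z => a b /=; exact: sqrtr_ge0.
pose kap n := if (n < M)%N then kap0 n else 0.
exists kap; split.
- by move=> l lN; rewrite -kapE //; apply: eq_bigr => n _; rewrite /kap ltn_ord.
- by move=> n Mn; rewrite /kap ltnNge Mn.
rewrite -mulrA -powRM //.
set D := D0 * B; set V := D `^ s.
have V0 : 0 <= V by exact: powR_ge0.
(* the weight at n is dominated by the decay in n plus the decay in M - n *)
pose g (n : nat) : R := (if n is k.+1 then (k.+1%:R ^+ 2)^-1 else 1).
have g0 n : 0 <= g n by case: n => [|n] //=; rewrite invr_ge0 exprn_ge0.
have term (n : 'I_M) : Normc.normc (kap n) `^ s <= V * (g n + g (M - n)%N).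
  rewrite /kap ltn_ord; have [h1 h2] := kapB n (ltn_ord n).
  have [n0|n0] := posnP n.
    apply: (@le_trans _ _ V); last first.
      by rewrite ler_peMr // n0 /= lerDl.
    apply: ge0_ler_powR; rewrite ?nnegrE ?(ltW s0) ?mulr_ge0 //.
    by apply: (le_trans h1); rewrite ler_peMl.
  have mn0 : (0 < minn n (M - n))%N by rewrite leq_min n0 subn_gt0 ltn_ord.
  rewrite -(prednK mn0) in h2.
  apply: (le_trans (powR_decay s0 sL (nn _) h2)).
  rewrite ler_wpM2l //; rewrite prednK //.
  case: leqP => _.
    by case: (nat_of_ord n) n0 => // k _; rewrite /g lerDl; exact: g0.
  have : (0 < M - n)%N by rewrite subn_gt0 ltn_ord.
  by case: (M - n)%N => // k _; rewrite /g lerDr; exact: g0.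
apply: (le_trans (ler_sum _ (fun n _ => term n))).
rewrite -mulr_sumr mulrC; apply: ler_wpM2r => //.
rewrite big_split /=.
have S1 : \sum_(n < M) g n <= 3.
  rewrite big_ord_recl /=.
  have := sum_inv_sqr N.*2; lra.
have S2 : \sum_(n < M) g (M - n)%N <= 2.
  rewrite (reindex_inj rev_ord_inj) /=.
  under eq_bigr => n _ do rewrite subKn ?ltn_ord //.
  exact: sum_inv_sqr.
lra.
Qed.

End kernel_sum.

(** * Dyadic multiplier families *)

Section families.
Variable R : realType.

(** The j-th symbol is localized at integers of size about 2^j and behaves under
    differences like a smooth bump at that scale.  The symbols form a partition
    of unity that is finite at each frequency. *)
Definition mult_family (u : nat -> int -> R) : Prop :=
  exists2 K : nat, (0 < K)%N &
  [/\ forall j l, u j l != 0 ->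
        `|l| <= (K * 2 ^ j)%:Z /\ ((0 < j)%N -> (2 ^ j)%:Z <= K%:Z * `|l|),
      forall L : nat, exists2 B : R, 0 <= B &
        forall j l, 2 ^+ (L * j) * `|iter L (@nabla R) (u j) l| <= B &
      forall l, exists J : nat, forall n, (J <= n)%N -> \sum_(j < n) u j l = 1].

Definition bdiff (h : R) (f : R -> R) : R -> R := fun y => f y - f (y - h).

Definition smooth (f : R -> R) := forall n x, derivable (derive1n n f) x 1.

Lemma derive1_shift (f : R -> R) (h x : R) : (forall y, derivable f y 1) ->
  is_derive x 1 (fun y => f (y - h)) (derive1 f (x - h)).
Proof.
move=> df.
have d1 : is_derive x (1 : R) (fun y : R => y - h) 1.
  by apply: is_derive_eq; rewrite oppr0 addr0.
have d2 : is_derive (x - h) (1 : R) f (derive1 f (x - h)).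
  by rewrite derive1E; apply: DeriveDef => //.
by have := @is_derive1_comp R f (fun y => y - h) x _ _ d2 d1; rewrite mulr1.
Qed.

Lemma derive1_bdiff (f : R -> R) (h x : R) : (forall y, derivable f y 1) ->
  is_derive x 1 (bdiff h f) (bdiff h (derive1 f) x).
Proof.
move=> df; apply: is_deriveB; last exact: derive1_shift.
by rewrite derive1E; apply: DeriveDef.
Qed.

Lemma derive1n_bdiff (f : R -> R) (h : R) n : smooth f ->
  derive1n n (bdiff h f) = bdiff h (derive1n n f).
Proof.
move=> sf; elim: n => [//|n IH].
rewrite !derive1nS IH; apply/funext => x.
rewrite derive1E; have d := derive1_bdiff h x (sf n); exact: derive_val.
Qed.

Lemma smooth_bdiff (f : R -> R) (h : R) : smooth f -> smooth (bdiff h f).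
Proof.
move=> sf n x; rewrite derive1n_bdiff //.
by have [] := derive1_bdiff h x (sf n).
Qed.

Lemma bdiff_le (f : R -> R) (h B : R) : (forall y, derivable f y 1) ->
  (forall y, `|derive1 f y| <= B) -> forall y, `|bdiff h f y| <= `|h| * B.
Proof.
move=> df dB.
have mvt a b : a <= b -> `|f b - f a| <= B * (b - a).
  move=> ab.
  have der x : x \in `]a, b[ -> is_derive x 1 f (derive1 f x).
    by move=> _; rewrite derive1E; apply: DeriveDef.
  have cont : {within `[a, b], continuous f}.
    apply: continuous_subspaceT => y.
    by apply: differentiable_continuous; apply/derivable1_diffP.
  have [x _ ->] := MVT_segment ab der cont.
  rewrite normrM [`|b - a|]ger0_norm ?subr_ge0 //.
  by rewrite ler_wpM2r ?subr_ge0.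
move=> y; rewrite /bdiff; have [h0|h0] := lerP 0 h.
  have := mvt (y - h) y; rewrite (ger0_norm h0) mulrC subKr; apply.
  by rewrite lerBlDr lerDl.
have := mvt y (y - h); rewrite (ltr0_norm h0) distrC mulrC.
rewrite (_ : y - h - y = - h); last by ring.
by apply; rewrite lerDl oppr_ge0 ltW.
Qed.

(** A difference of step h is h times a value of the derivative, by the mean
    value theorem; differences commute with derivatives. *)
Lemma iter_nabla_le (f : R -> R) (h B : R) (L : nat) : smooth f ->
  (forall y, `|derive1n L f y| <= B) ->
  forall l : int, `|iter L (@nabla R) (fun l => f (h * l%:~R)) l| <= `|h| ^+ L * B.
Proof.
elim: L f B => [|L IH] f B sf fB l; first by rewrite expr0 mul1r; exact: fB.
rewrite iterSr.
have -> : nabla (fun l => f (h * l%:~R)) = (fun l => bdiff h f (h * l%:~R)).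
  apply/funext => k; rewrite /nabla /bdiff rmorphB /= mulrBr mulr1 //.
rewrite exprSr -mulrA; apply: IH; first exact: smooth_bdiff.
move=> y; rewrite derive1n_bdiff //; apply: bdiff_le; first exact: sf.
by move=> z; have := fB z; rewrite derive1nS.
Qed.

Lemma eq_iter_nabla (L : nat) (m m' : int -> R) (l : int) :
  (forall k, l - L%:Z <= k <= l -> m k = m' k) ->
  iter L (@nabla R) m l = iter L (@nabla R) m' l.
Proof.
elim: L l => [|L IH] l H; first by apply: H; lia.
rewrite !iterS /nabla; congr (_ - _); apply: IH => k hk; apply: H; lia.
Qed.

Lemma iter_nabla_trivial (L : nat) (m : int -> R) (l : int) (B : R) :
  (forall k, l - L%:Z <= k <= l -> `|m k| <= B) ->
  `|iter L (@nabla R) m l| <= 2 ^+ L * B.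
Proof.
elim: L l => [|L IH] l H; first by rewrite expr0 mul1r; apply: H; lia.
rewrite iterS /nabla; apply: (le_trans (ler_normB _ _)).
rewrite exprS -mulrA mulr_natl mulr2n; apply: lerD; apply: IH => k hk; apply: H; lia.
Qed.

Section from_dyadic.
Variables (phi : nat -> R -> R) (c : R).
Hypothesis c0 : 0 < c.
Hypothesis phi_smooth : forall j, smooth (phi j).
Hypothesis supp0 : forall x, phi 0%N x != 0 -> `|c * x| <= 2.
Hypothesis suppj : forall j x, (0 < j)%N -> phi j x != 0 ->
  2 ^+ j.-1 <= `|c * x| <= 2 ^+ j.+1.
Hypothesis phi_bound : forall m : nat, exists C, forall j x,
        2 ^+ (m * j) * `|derive1n m (phi j) x| <= C.
Hypothesis phi_sum : forall x, \sum_(0 <= j < n) phi j x @[n --> \oo] --> (1 : R).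

(** Only finitely many bumps are nonzero at a given point, so the limit 1 is
    reached by the partial sums. *)
Lemma dyadic_sum1 x : exists J : nat, forall n, (J <= n)%N ->
  \sum_(j < n) phi j x = 1.
Proof.
have [J HJ] : exists J : nat, forall j, (J <= j)%N -> phi j x = 0.
  exists (Num.bound `|c * x|).+1 => j Jj.
  apply/eqP/negP => /negP nz.
  have /andP[h _] := suppj (leq_trans (ltn0Sn _) Jj) nz.
  have := archi_boundP (normr_ge0 (c * x)).
  rewrite ltNge => /negP; apply; apply: le_trans h.
  apply: (@le_trans _ _ (2 ^+ (Num.bound `|c * x|))); last first.
    by apply: ler_weXn2l; [lra|lia].
  by rewrite -natrX ler_nat ltnW // ltn_expl.
exists J => n Jn.
have E (k : nat) : (J <= k)%N -> \sum_(j < k) phi j x = \sum_(j < J) phi j x.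
  move=> Jk; rewrite -(subnKC Jk) big_split_ord /= [X in _ + X]big1 ?addr0 //.
  by move=> i _; rewrite HJ // leq_addr.
rewrite E //; apply/esym; apply: (cvg_unique _ (@phi_sum x)) => //.
apply: cvg_near_cst; near=> k; rewrite big_mkord; apply: E.
by near: k; exact: nbhs_infty_ge.
Unshelve. all: by end_near. Qed.

Lemma dyadic_support_int (h : R) : 0 < h -> exists2 K : nat, (0 < K)%N &
  forall j (l : int), phi j (h * l%:~R) != 0 ->
    `|l| <= (K * 2 ^ j)%:Z /\ ((0 < j)%N -> (2 ^ j)%:Z <= K%:Z * `|l|).
Proof.
move=> h0; have ch0 : 0 < c * h by rewrite mulr_gt0.
pose X := 2 / (c * h) + 2 * (c * h).
have X0 : 0 <= X by rewrite addr_ge0 // ?divr_ge0 // ?mulr_ge0 // ltW.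
exists (Num.bound X).+1 => // j l nz.
have XK : X <= (Num.bound X).+1%:R :> R.
  by apply: le_trans (ltW (archi_boundP X0)) _; rewrite ler_nat.
set K := (Num.bound X).+1 in XK *.
have nl : `|l|%:~R = `|l%:~R| :> R by rewrite intr_norm.
have nch : `|c * (h * l%:~R)| = c * h * `|l%:~R| :> R.
  by rewrite mulrA normrM ger0_norm // ltW.
have up : `|c * (h * l%:~R)| <= 2 ^+ j.+1.
  case: j nz => [|j] nz; first by rewrite expr1; exact: supp0.
  by have /andP[] := suppj (ltn0Sn j) nz.
split.
  rewrite -(ler_int R) nl -pmulrn natrM natrX.
  rewrite nch exprS mulrC -ler_pdivlMr // mulrAC in up.
  apply: (le_trans up); rewrite ler_wpM2r ?exprn_ge0 //.
  by apply: le_trans XK; rewrite /X lerDl mulr_ge0 // ltW.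
move=> j0; have /andP[lo _] := suppj j0 nz.
rewrite -(ler_int R) rmorphM /= nl -!pmulrn natrX.
rewrite -{1}(prednK j0) exprS.
apply: (@le_trans _ _ (2 * (c * h * `|l%:~R|))).
  by rewrite ler_wpM2l // -nch.
rewrite mulrA ler_wpM2r //; apply: le_trans XK.
by rewrite /X lerDr divr_ge0 // ltW.
Qed.

Lemma mult_family_scale (h : R) : 0 < h ->
  mult_family (fun j l => phi j (h * l%:~R)).
Proof.
move=> h0; have [K K0 suppK] := dyadic_support_int h0.
exists K => //; split => //; last by move=> l; exact: dyadic_sum1.
move=> L; have [C HC] := phi_bound L.
have C0 : 0 <= C by apply: le_trans (HC 0%N 0); rewrite mulr_ge0 // exprn_ge0.
exists (h ^+ L * C) => [|j l]; first by rewrite mulr_ge0 // exprn_ge0 // ltW.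
have p2 : 0 < (2 : R) ^+ (L * j) by rewrite exprn_gt0.
rewrite mulrC -ler_pdivlMr // -mulrA -{2}(ger0_norm (ltW h0)).
apply: iter_nabla_le => // y.
by rewrite ler_pdivlMr // mulrC.
Qed.

(** If the L + 1 integers that enter an L-th difference have constant sign, then
    phi_j(|l|) is phi_j(l) or phi_j(-l) on all of them.  Otherwise they are all
    smaller than L in absolute value; there phi_j vanishes for large j, and for
    the finitely many other j the bound on phi_j itself suffices. *)
Lemma mult_family_abs : mult_family (fun j l => phi j `|l|%:~R).
Proof.
have [K K0 suppK] := dyadic_support_int ltr01.
exists K => //; split => //; last by move=> l; exact: dyadic_sum1.
  by move=> j l; rewrite -[_%:~R]mul1r => /suppK; rewrite normr_id.
move=> L; have [C HC] := phi_bound L; have [C' HC'] := phi_bound 0%N.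
have C0 : 0 <= C by apply: le_trans (HC 0%N 0); rewrite mulr_ge0 // exprn_ge0.
have C'0 : 0 <= C' by apply: le_trans (HC' 0%N 0); rewrite mulr_ge0 // exprn_ge0.
(* if 2^j > Q, then phi_j vanishes at all integers of absolute value below L *)
pose Q := maxn 1 (K * L).
exists (C + (Q%:R ^+ L) * (2 ^+ L * C')) => [|j l].
  by rewrite addr_ge0 // ?mulr_ge0 // exprn_ge0.
have p2 : 0 < (2 : R) ^+ (L * j) by rewrite exprn_gt0.
have mvt (e : R) : `|e| = 1 -> (forall k : int, l - L%:Z <= k <= l ->
    `|k|%:~R = e * k%:~R) ->
    2 ^+ (L * j) * `|iter L (@nabla R) (fun l : int => phi j `|l|%:~R) l| <= C.
  move=> e1 He.
  rewrite (@eq_iter_nabla _ _ (fun l => phi j (e * l%:~R))); last first.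
    by move=> k hk; rewrite He.
  rewrite mulrC -ler_pdivlMr //.
  have dB y : `|derive1n L (phi j) y| <= C / 2 ^+ (L * j).
    by rewrite ler_pdivlMr // mulrC.
  by have := iter_nabla_le e (@phi_smooth j) dB l; rewrite e1 expr1n mul1r.
have D0 : 0 <= Q%:R ^+ L * (2 ^+ L * C') by rewrite !mulr_ge0 // exprn_ge0.
have [l1|l1] := lerP L%:Z l.
  apply: (@le_trans _ _ C); last by rewrite lerDl.
  apply: (mvt 1); first by rewrite normr1.
  by move=> k hk; rewrite mul1r ger0_norm //; lia.
have [l2|l2] := lerP l 0.
  apply: (@le_trans _ _ C); last by rewrite lerDl.
  apply: (mvt (-1)); first by rewrite normrN1.
  by move=> k hk; rewrite mulN1r -rmorphN /= ler0_norm //; lia.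
apply: (@le_trans _ _ (Q%:R ^+ L * (2 ^+ L * C'))); last by rewrite lerDr.
have [jQ|jQ] := leqP (2 ^ j) Q.
  apply: ler_pM; rewrite ?exprn_ge0 //.
    by rewrite mulnC exprM lerXn2r ?nnegrE ?exprn_ge0 // -natrX ler_nat.
  apply: iter_nabla_trivial => k _.
  by have := HC' j `|k|%:~R; rewrite mul0n expr0 mul1r.
rewrite (@eq_iter_nabla _ _ (fun=> 0)); last first.
  move=> k hk; apply/eqP/negP => /negP.
  rewrite -[_%:~R]mul1r => /suppK; rewrite normr_id => -[_ h].
  have j0 : (0 < j)%N.
    rewrite lt0n; apply/negP => /eqP je; move: jQ.
    by rewrite je expn0 /Q; lia.
  have h' := h j0.
  have : (K * `|k|%N <= K * L)%N by rewrite leq_mul2l; apply/orP; right; lia.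
  move: jQ h'; rewrite /Q; move: (2 ^ j)%N => p; nia.
have -> : iter L (@nabla R) (fun=> 0) l = 0.
  elim: (L) l {mvt l1 l2 p2} => [//|j' IH] l; rewrite iterS /nabla !IH subrr //.
by rewrite normr0 mulr0.
Qed.

End from_dyadic.

(** The two samplings that occur: at l/2 for the kernels on the torus, because
    exp(i pi l x) has frequency l/2 in the normalization of [fourier], and at
    |l| for the cosine blocks. *)
Lemma dyadic_mult_family (phi : nat -> R -> R) : dyadic_decomposition phi ->
  mult_family (fun j l => phi j (2^-1 * l%:~R)) /\
  mult_family (fun j l => phi j `|l|%:~R).
Proof.
case=> sm [c c0 [h0 hj]] bnd sum1.
have s0 x : phi 0%N x != 0 -> `|c * x| <= 2.
  by move=> nz; apply: h0; exact: subset_closure.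
have sj j x : (0 < j)%N -> phi j x != 0 -> 2 ^+ j.-1 <= `|c * x| <= 2 ^+ j.+1.
  by move=> j0 nz; apply: (hj j j0); exact: subset_closure.
have smo j : smooth (phi j) by have [[]] := sm j.
split; first by apply: (mult_family_scale c0) => //; rewrite invr_gt0.
exact: (mult_family_abs c0).
Qed.

End families.

(** * The reproducing formula *)
Section one_dim.
Variable R : realType.

Lemma family_neighbours (u w : nat -> int -> R) :
  mult_family u -> mult_family w -> exists A : nat, forall j j' l,
    u j l != 0 -> w j' l != 0 -> (j <= j' + A)%N /\ (j' <= j + A)%N.
Proof.
move=> [Ku Ku0 [su _ _]] [Kw Kw0 [sw _ _]].
have half (K K' : nat) (j j' : nat) (l : int) :
    ((0 < j)%N -> (2 ^ j)%:Z <= K%:Z * `|l|) -> `|l| <= (K' * 2 ^ j')%:Z ->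
    (j <= j' + K * K')%N.
  have [->//|j0] := posnP j.
  move=> /(_ isT) h1 h2.
  have h3 : (2 ^ j <= K * K' * 2 ^ j')%N.
    rewrite -mulnA; apply: (@leq_trans (K * `|l|%N)); first by lia.
    by rewrite leq_mul2l; apply/orP; right; lia.
  rewrite -(leq_exp2l (m:=2)) //; apply: (leq_trans h3).
  by rewrite expnD mulnC leq_mul2l; apply/orP; right; apply: ltnW; exact: ltn_expl.
exists (Ku * Kw + Kw * Ku)%N => j j' l /su[lu ju] /sw[lw jw]; split.
  by apply: (leq_trans (half _ _ _ _ _ ju lw)); rewrite leq_add2l leq_addr.
by apply: (leq_trans (half _ _ _ _ _ jw lu)); rewrite leq_add2l leq_addl.
Qed.

Lemma partition_box (u w : nat -> int -> R) (A : nat) : mult_family w ->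
  (forall j j' l, u j l != 0 -> w j' l != 0 -> (j <= j' + A)%N /\ (j' <= j + A)%N) ->
  forall j J l, (j + A < J)%N -> \sum_(j' < J) u j l * w j' l = u j l.
Proof.
move=> [K K0 [_ _ part]] nbr j J l AJ.
have [n hn] := part l.
have [->|u0] := eqVneq (u j l) 0.
  by rewrite big1 // => i _; rewrite mul0r.
rewrite -mulr_sumr.
suff -> : \sum_(j' < J) w j' l = 1 by rewrite mulr1.
rewrite -(hn _ (leq_addl J n)) big_split_ord /= [X in _ = _ + X]big1 ?addr0 //.
move=> i _; apply/eqP/negP => /negP wn.
have [_] := nbr _ _ _ u0 wn; lia.
Qed.

(** [kernel_sum] with N = K' 2^j: the bounds in [mult_family] are scaled so that
    the constant does not depend on j.  The factor K' may be larger than the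
    support of the symbol requires, which makes the formula valid on the
    frequencies of the neighbouring blocks as well. *)
Lemma family_kernel (u : nat -> int -> R) (s : R) : 0 < s -> mult_family u ->
  exists K : nat, forall K' : nat, (K <= K')%N -> exists2 C : R, 0 <= C &
    forall j : nat, exists (M : nat) (kap : nat -> R[i]),
      [/\ (0 < M)%N,
          forall l, `|l| <= (K' * 2 ^ j)%:Z ->
            \sum_(n < M) kap n * expi (- (2 * pi * l%:~R / M%:R * n%:R))
              = (u j l)%:C,
          forall n, (M <= n)%N -> kap n = 0 &
          \sum_(n < M) Normc.normc (kap n) `^ s <= C].
Proof.
move=> s0 [K K0 [su bu _]]; exists K => K' KK'.
(* the order of the differences that makes the s-th powers summable *)
pose L := Num.bound (2 / s).
have sL : 2 <= L%:R * s.
  rewrite -ler_pdivrMr //; apply/ltW/archi_boundP.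
  by rewrite divr_ge0 // ltW.
have [C0 C00 HC] := kernel_sum s0 sL.
have [B0 B00 HB0] := bu 0%N; have [BL BL0 HBL] := bu L.
pose B := B0 + K'%:R ^+ L * BL.
have B_ge0 : 0 <= B by rewrite addr_ge0 // mulr_ge0 // exprn_ge0.
exists (C0 * B `^ s) => [|j]; first by rewrite mulr_ge0 // powR_ge0.
have [||||kap [h1 h2 h3]] := HC (K' * 2 ^ j)%N (u j) B.
- by rewrite muln_gt0 expn_gt0 (leq_trans K0 KK').
- move=> l; rewrite ltNge => /negP hl; apply/eqP/negP => /negP /su[lu _].
  apply: hl; apply: (le_trans lu); rewrite lez_nat leq_mul2r KK' orbT //.
- move=> l; have := HB0 j l; rewrite mul0n expr0 mul1r /= => h.
  by apply: (le_trans h); rewrite lerDl mulr_ge0 // exprn_ge0.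
- move=> l; apply: (@le_trans _ _ (K'%:R ^+ L * BL)); last by rewrite lerDr.
  rewrite natrM exprMn mulrCA ler_wpM2l ?exprn_ge0 // natrX -exprM mulrC mulnC.
  exact: HBL.
by exists ((K' * 2 ^ j).*2.+1)%N, kap; split.
Qed.

End one_dim.

Section trig_sums.
Variables (R : realType) (d : nat).
Implicit Types (l : 'I_d -> int) (x : Rd d R) (t : 'I_d -> R).

Definition mode l x : R[i] := \prod_(i < d) expi (pi * (l i)%:~R * xcoord x i).

Definition box_idx (N : nat) (f : {ffun 'I_d -> 'I_(N.*2.+1)}) : 'I_d -> int :=
  fun i => (f i)%:Z - N%:Z.

Definition trig_sum (N : nat) (b : ('I_d -> int) -> R[i]) x : R[i] :=
  \sum_(f : {ffun 'I_d -> 'I_(N.*2.+1)}) b (box_idx f) * mode (box_idx f) x.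

Definition tensor_mult (u : 'I_d -> nat -> int -> R) (j : 'I_d -> nat) l : R :=
  \prod_(i < d) u i (j i) (l i).

Definition translate t x : Rd d R :=
  [tuple (xcoord x i - t i : measurableTypeR R) | i < d].

Lemma xcoord_mk (F : 'I_d -> R) i :
  xcoord [tuple (F k : measurableTypeR R) | k < d] i = F i.
Proof. by rewrite /xcoord tnth_mktuple. Qed.

Lemma mode_translate l t x :
  mode l (translate t x) = (\prod_(i < d) expi (- (pi * (l i)%:~R * t i))) * mode l x.
Proof.
rewrite /mode -big_split; apply: eq_bigr => i _ /=.
by rewrite xcoord_mk -expiD; congr expi; ring.
Qed.

Definition close_to (j : 'I_d -> nat) (A J : nat) (f : {ffun 'I_d -> 'I_J}) :=
  [forall i, (j i <= f i + A)%N && (f i <= j i + A)%N].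

Lemma card_close_to j A J :
  (#|[pred f : {ffun 'I_d -> 'I_J} | close_to j A f]| <= A.*2.+1 ^ d)%N.
Proof.
have <- : #|{ffun 'I_d -> 'I_(A.*2.+1)}| = (A.*2.+1 ^ d)%N.
  by rewrite card_ffun !card_ord.
pose g (f : {ffun 'I_d -> 'I_J}) : {ffun 'I_d -> 'I_(A.*2.+1)} :=
  [ffun i => inord (f i + A - j i)].
apply: (@leq_card_in _ _ g) => f1 f2 /forallP h1 /forallP h2 /ffunP e.
apply/ffunP => i; apply/val_inj => /=.
have /andP[a1 a2] := h1 i; have /andP[b1 b2] := h2 i.
have := e i; rewrite !ffunE => /(congr1 val) /=; rewrite !inordK; lia.
Qed.

Lemma normc_prod (I : Type) (r : seq I) (F : I -> R[i]) (s : R) :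
  Normc.normc (\prod_(i <- r) F i) `^ s = \prod_(i <- r) Normc.normc (F i) `^ s.
Proof.
have nn (z : R[i]) : 0 <= Normc.normc z.
  by case: z => a b /=; exact: sqrtr_ge0.
elim/big_rec2: _ => [|i y1 y2 _ <-]; first by rewrite Normc.normc1 powR1.
by rewrite Normc.normcM powRM.
Qed.

(** Only the w_j' with j' close to j meet the support of u_j, and they add up to
    1 there.  On the support of such a w_j' the symbol u_j is carried out by
    translations, with the tensor products of the one-dimensional weights. *)
Theorem reproducing (u w : 'I_d -> nat -> int -> R) (s : R) : 0 < s ->
  (forall i, mult_family (u i)) -> (forall i, mult_family (w i)) ->
  exists (A : nat) (C : R), 0 <= C /\ forall j : 'I_d -> nat,
  exists (M J : nat) (kap : {ffun 'I_d -> 'I_M} -> R[i])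
     (t : {ffun 'I_d -> 'I_M} -> 'I_d -> R),
  [/\ \sum_n Normc.normc (kap n) `^ s <= C,
      forall i, (j i < J)%N &
      forall N a x, trig_sum N (fun l => (tensor_mult u j l)%:C * a l) x =
      \sum_(f : {ffun 'I_d -> 'I_J} | close_to j A f)
        \sum_n kap n * trig_sum N (fun l => (tensor_mult w (fun i => f i) l)%:C * a l)
            (translate (t n) x)].
Proof.
move=> s0 mu mw.
have /fin_all_exists[A0 HA0] := fun i => family_neighbours (mu i) (mw i).
pose A := (\sum_i A0 i)%N.
have HA i j j' (l : int) : u i j l != 0 -> w i j' l != 0 ->
    (j <= j' + A)%N /\ (j' <= j + A)%N.
  have le : (A0 i <= A)%N by rewrite /A (bigD1 i) //= leq_addr.
  by move=> h1 h2; have [] := HA0 i _ _ _ h1 h2; lia.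
have /fin_all_exists[Kw HKw] : forall i, exists K : nat, forall j (l : int),
    w i j l != 0 -> `|l| <= (K * 2 ^ j)%:Z.
  by move=> i; have [K _ [h _ _]] := mw i; exists K => j l /h[].
have /fin_all_exists[Ku HKu] := fun i => family_kernel s0 (mu i).
pose K' i := (Ku i + Kw i * 2 ^ A)%N.
have /fin_all_exists[C HC] : forall i, exists C : R, 0 <= C /\
    forall j : nat, exists (M : nat) (kap : nat -> R[i]),
      [/\ (0 < M)%N,
          forall l : int, `|l| <= (K' i * 2 ^ j)%:Z ->
            \sum_(n < M) kap n * expi (- (2 * pi * l%:~R / M%:R * n%:R))
              = (u i j l)%:C,
          forall n, (M <= n)%N -> kap n = 0 &
          \sum_(n < M) Normc.normc (kap n) `^ s <= C].
  by move=> i; have [C C0 h] := HKu i (K' i) (leq_addr _ _); exists C.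
exists A, (\prod_i C i); split.
  by apply: prodr_ge0 => i _; have [] := HC i.
move=> j.
have /fin_all_exists2[Mi H1 H2] : forall i, exists2 M : nat, (0 < M)%N &
  exists kap : nat -> R[i],
      [/\ forall l : int, `|l| <= (K' i * 2 ^ (j i))%:Z ->
            \sum_(n < M) kap n * expi (- (2 * pi * l%:~R / M%:R * n%:R))
              = (u i (j i) l)%:C,
          forall n, (M <= n)%N -> kap n = 0 &
          \sum_(n < M) Normc.normc (kap n) `^ s <= C i].
  by move=> i; have [_ h] := HC i; have [M [kap []]] := h (j i); exists M => //; exists kap.
have /fin_all_exists[kapi Hk] := H2.
(* a common number of nodes; the weights of coordinate i vanish beyond Mi i *)
pose M := (\max_i Mi i)%N.
pose J := (\sum_i (j i + A)).+1%N.
have jJ i : (j i + A < J)%N by rewrite ltnS (bigD1 i) //= leq_addr.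
pose kap (n : {ffun 'I_d -> 'I_M}) : R[i] := \prod_i kapi i (n i).
pose t (n : {ffun 'I_d -> 'I_M}) i : R := 2 * (n i)%:R / (Mi i)%:R.
have pad (V : nmodType) i (g : nat -> V) : (forall n, (Mi i <= n)%N -> g n = 0) ->
    \sum_(n < M) g n = \sum_(n < Mi i) g n.
  move=> g0; have MM : (Mi i <= M)%N by exact: leq_bigmax.
  rewrite -(subnKC MM) big_split_ord /= [X in _ + X]big1 ?addr0 //.
  by move=> k _; rewrite g0 // leq_addr.
exists M, J, kap, t; split.
- have -> : \sum_n Normc.normc (kap n) `^ s =
      \prod_i \sum_(n < M) Normc.normc (kapi i n) `^ s.
    by rewrite bigA_distr_bigA /=; apply: eq_bigr => n _; rewrite normc_prod.
  apply: ler_prod => i _; have [_ k0 ks] := Hk i; apply/andP; split.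
    by apply: sumr_ge0 => n _; exact: powR_ge0.
  rewrite (pad _ i (fun n => Normc.normc (kapi i n) `^ s)) // => n Mn.
  by rewrite k0 // Normc.normc0 powR0 // gt_eqF.
- by move=> i; apply: leq_trans (jJ i); rewrite ltnS leq_addr.
move=> N a x.
pose T l : R[i] := \sum_n kap n * \prod_(i < d) expi (- (pi * (l i)%:~R * t n i)).
have TE l : (forall i, `|l i| <= (K' i * 2 ^ (j i))%:Z) ->
    T l = (tensor_mult u j l)%:C.
  move=> lb; rewrite /T /tensor_mult rmorph_prod /=.
  under eq_bigr do rewrite -big_split /=.
  rewrite -(bigA_distr_bigA (fun i (n : 'I_M) =>
    kapi i n * expi (- (pi * (l i)%:~R * (2 * n%:R / (Mi i)%:R))))) /=.
  apply: eq_bigr => i _; have [kE k0 _] := Hk i; rewrite -kE //.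
  rewrite (pad _ i (fun n : nat =>
    kapi i n * expi (- (pi * (l i)%:~R * (2 * n%:R / (Mi i)%:R))))).
    by apply: eq_bigr => n _; congr (_ * expi _); ring.
  by move=> n Mn; rewrite k0 // mul0r.
have WT l (f : {ffun 'I_d -> 'I_J}) : close_to j A f ->
    (tensor_mult w (fun i => f i) l)%:C * T l =
    (tensor_mult w (fun i => f i) l)%:C * (tensor_mult u j l)%:C.
  move=> /forallP fj.
  have [->|w0] := eqVneq (tensor_mult w (fun i => f i) l) 0.
    by rewrite rmorph0 !mul0r.
  rewrite TE // => i.
  have wi : w i (f i) (l i) != 0.
    by apply: contraNneq w0 => h; rewrite /tensor_mult (bigD1 i) //= h mul0r.
  apply: (le_trans (HKw _ _ _ wi)); rewrite lez_nat /K' mulnDl.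
  apply: (@leq_trans (Kw i * 2 ^ A * 2 ^ j i)); last exact: leq_addl.
  rewrite -mulnA leq_mul2l -expnD leq_exp2l //.
  by have /andP[_ h] := fj i; rewrite addnC h orbT.
have part l : \sum_(f : {ffun 'I_d -> 'I_J} | close_to j A f)
    (tensor_mult w (fun i => f i) l)%:C * (tensor_mult u j l)%:C
    = (tensor_mult u j l)%:C :> R[i].
  under eq_bigr do rewrite -rmorphM.
  rewrite -rmorph_sum /=; congr (_%:C).
  transitivity (\sum_(f : {ffun 'I_d -> 'I_J})
      tensor_mult w (fun i => f i) l * tensor_mult u j l).
    rewrite [RHS](bigID (@close_to j A J)) /= [X in _ = _ + X]big1 ?addr0 //.
    move=> f; rewrite /close_to negb_forall => /existsP[i hi].
    have [-> |wi] := eqVneq (tensor_mult w (fun i => f i) l) 0.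
      by rewrite mul0r.
    have [-> |ui] := eqVneq (tensor_mult u j l) 0.
      by rewrite mulr0.
    exfalso; move/negP: hi; apply; apply/andP; apply: (HA i _ _ (l i)).
      by apply: contraNneq ui => h; rewrite /tensor_mult (bigD1 i) //= h mul0r.
    by apply: contraNneq wi => h; rewrite /tensor_mult (bigD1 i) //= h mul0r.
  rewrite /tensor_mult; under eq_bigr do rewrite -big_split /=.
  rewrite -(bigA_distr_bigA (fun i (n : 'I_J) => w i n (l i) * u i (j i) (l i))) /=.
  apply: eq_bigr => i _; under eq_bigr do rewrite mulrC.
  by apply: (partition_box (mw i) (HA i)); exact: jJ.
rewrite /trig_sum.
have E (f : {ffun 'I_d -> 'I_J}) : close_to j A f ->
   \sum_n kap n * (\sum_(b : {ffun 'I_d -> 'I_(N.*2.+1)})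
     (tensor_mult w (fun i => f i) (box_idx b))%:C * a (box_idx b) *
         mode (box_idx b) (translate (t n) x)) =
   \sum_(b : {ffun 'I_d -> 'I_(N.*2.+1)})
     ((tensor_mult w (fun i => f i) (box_idx b))%:C *
      (tensor_mult u j (box_idx b))%:C) * (a (box_idx b) * mode (box_idx b) x).
  move=> fj; under eq_bigr do rewrite mulr_sumr.
  rewrite exchange_big /=; apply: eq_bigr => b _.
  rewrite -(WT _ _ fj) /T -mulrA !mulr_suml mulr_sumr; apply: eq_bigr => n _.
  by rewrite mode_translate; ring.
rewrite (eq_bigr _ E) exchange_big /=; apply: eq_bigr => b _.
by rewrite -mulr_suml part mulrA.
Qed.

End trig_sums.

(** * Sequence norms under bounded shifts of the index *)
Section sequence_space.
Variables (R : realType) (d : nat).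
Implicit Types (j : d.-tuple nat).

Definition near_index (A : nat) j j' :=
  forall i, (tnth j i <= tnth j' i + A)%N /\ (tnth j' i <= tnth j i + A)%N.

Lemma esum_ge0_mulr (T : choiceType) (c : \bar R) (x : T -> \bar R) :
  (0 <= c)%E -> (forall j : T, 0 <= x j)%E ->
  (\esum_(j in [set: T]) (c * x j) <= c * \esum_(j in [set: T]) x j)%E.
Proof.
move=> c0 x0; rewrite {1}/esum ge_ereal_sup // => _ [X [finX _]] <-.
rewrite -ge0_mule_fsumr //; apply: lee_wpmul2l => //.
by apply: esum_ge; exists X.
Qed.

(** [sg] is injective on the set of indices with a prescribed displacement, and
    there are at most (2 A + 1)^d displacements. *)
Lemma esum_near_index (A : nat) (sg : d.-tuple nat -> d.-tuple nat)
    (x : d.-tuple nat -> \bar R) :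
  (forall j, 0 <= x j)%E -> (forall j, near_index A j (sg j)) ->
  (\esum_(j in [set: d.-tuple nat]) x (sg j) <=
     (A.*2.+1 ^ d)%:R%:E * \esum_(j in [set: d.-tuple nat]) x j)%E.
Proof.
move=> x0 sgA.
pose del j : {ffun 'I_d -> 'I_(A.*2.+1)} :=
  [ffun i => inord (tnth j i + A - tnth (sg j) i)].
have -> : (\esum_(j in [set: d.-tuple nat]) x (sg j) =
    \sum_(e : {ffun 'I_d -> 'I_(A.*2.+1)})
      \esum_(j in [set j | del j = e]) x (sg j))%E.
  transitivity (\sum_(e : {ffun 'I_d -> 'I_(A.*2.+1)})
      \esum_(j in [set: d.-tuple nat]) if j \in [set j | del j = e] then x (sg j) else 0)%E.
    rewrite -esum_sum; last by move=> j e _ _; case: ifP.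
    apply: eq_esum => j _; rewrite (bigD1 (del j)) //= big1 ?adde0; last first.
      by move=> e ne; rewrite ifN //; apply/negP; rewrite inE /= => h; rewrite h eqxx in ne.
    by rewrite ifT // inE.
  by apply: eq_bigr => e _; rewrite -esum_mkcond.
have cardE : #|{ffun 'I_d -> 'I_(A.*2.+1)}| = (A.*2.+1 ^ d)%N.
  by rewrite card_ffun !card_ord.
set S := (\esum_(j in [set: d.-tuple nat]) x j)%E.
have -> : ((A.*2.+1 ^ d)%:R%:E * S = \sum_(e : {ffun 'I_d -> 'I_(A.*2.+1)}) S)%E.
  by rewrite -cardE -sum1_card natr_sum -sumEFin ge0_sume_distrl //;
     under [RHS]eq_bigr do rewrite -[S]mul1e.
apply: lee_sum => e _.
have inj : set_inj [set j | del j = e] sg.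
  move=> j1 j2; rewrite !inE /= => h1 h2 sE.
  apply: eq_from_tnth => i.
  have := congr1 (fun f : {ffun 'I_d -> 'I_(A.*2.+1)} => f i) (etrans h1 (esym h2)).
  rewrite !ffunE => /(congr1 val) /=.
  have [a1 a2] := sgA j1 i; have [b1 b2] := sgA j2 i; rewrite sE in a1 a2 *.
  by rewrite !inordK; lia.
rewrite -(esum_image _ _ _ inj) esum_mkcond; apply: le_esum => j _.
by case: ifP.
Qed.

Lemma l1norm_near (A : nat) j j' : near_index A j j' ->
  (l1norm j <= l1norm j' + d * A)%N.
Proof.
move=> h; rewrite /l1norm -[X in (_ + X * A)%N]card_ord -sum_nat_const.
rewrite -big_split /=; apply: leq_sum => i _.
by have [] := h i.
Qed.

Lemma near_index_sym (A : nat) j j' : near_index A j j' -> near_index A j' j.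
Proof. by move=> h i; have [] := h i. Qed.

Lemma weight_near (A : nat) (r : R) j j' : near_index A j j' ->
  2 `^ (r * (l1norm j)%:R) <= 2 `^ (`|r| * (d * A)%:R) * 2 `^ (r * (l1norm j')%:R).
Proof.
move=> h; rewrite -powRD; last by rewrite pnatr_eq0 implybT.
rewrite ler_powR ?ler1n //.
rewrite -lerBlDr -mulrBr; apply: (le_trans (ler_norm _)).
rewrite normrM ler_wpM2l //.
have h1 := l1norm_near h; have h2 := l1norm_near (near_index_sym h).
rewrite ler_norml; apply/andP; split.
  by rewrite lerNl opprB lerBlDr addrC -natrD ler_nat.
by rewrite lerBlDr addrC -natrD ler_nat.
Qed.

(** Passing from j to a near j' costs a bounded factor in the weight; each j'
    is used by at most (2 A + 1)^d indices j. *)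
Lemma besov_lq_le (r : R) (q : \bar R) (A : nat) (C : R) : (0 < q)%E -> 0 <= C ->
  exists2 C' : R, 0 <= C' & forall a b : d.-tuple nat -> \bar R,
    (forall j, 0 <= a j)%E -> (forall j, 0 <= b j)%E ->
    (forall j, exists2 j', near_index A j j' & (a j <= C%:E * b j')%E) ->
    (besov_lq r q a <= C'%:E * besov_lq r q b)%E.
Proof.
case: q => [s s0|_|//] C0; last first.
  exists (2 `^ (`|r| * (d * A)%:R) * C); first by rewrite mulr_ge0 // powR_ge0.
  move=> a b a0 b0 ab; rewrite /besov_lq ge_ereal_sup // => _ [j _ <-].
  have [j' jj' h] := ab j.
  apply: (@le_trans _ _ ((2 `^ (`|r| * (d * A)%:R) * C)%:E *
      ((2 `^ (r * (l1norm j')%:R))%:E * b j')))%E; last first.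
    apply: lee_wpmul2l; first by rewrite lee_fin mulr_ge0 // powR_ge0.
    by apply: ereal_sup_ubound; exists j'.
  apply: (@le_trans _ _ ((2 `^ (`|r| * (d * A)%:R) * 2 `^ (r * (l1norm j')%:R))%:E *
     (C%:E * b j')))%E.
    apply: lee_pmul; rewrite ?lee_fin ?powR_ge0 //; exact: weight_near.
  rewrite !EFinM -!muleA; apply: lee_wpmul2l; first by rewrite lee_fin powR_ge0.
  by rewrite muleCA.
rewrite lte_fin in s0.
have s0' : 0 <= s by exact: ltW.
pose W := 2 `^ (`|r * s| * (d * A)%:R) * C `^ s.
have W0 : 0 <= W by rewrite mulr_ge0 // powR_ge0.
pose K : R := (A.*2.+1 ^ d)%:R * W.
have K0 : 0 <= K by rewrite mulr_ge0.
exists (K `^ s^-1); first exact: powR_ge0.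
move=> a b a0 b0 ab.
have /choice[sg sgP] : forall j, exists j', near_index A j j' /\ (a j <= C%:E * b j')%E.
  by move=> j; have [j' ? ?] := ab j; exists j'.
pose x j := ((2 `^ (r * s * (l1norm j)%:R))%:E * b j `^ s)%E.
have x0 j : (0 <= x j)%E by rewrite mule_ge0 // ?lee_fin ?powR_ge0 // poweR_ge0.
have term j : ((2 `^ (r * s * (l1norm j)%:R))%:E * a j `^ s <= W%:E * x (sg j))%E.
  have [nj aj] := sgP j.
  have h1 : (a j `^ s <= (C `^ s)%:E * b (sg j) `^ s)%E.
    rewrite -poweR_EFin -poweRM ?lee_fin //; apply: gt0_ler_poweR => //.
      by rewrite in_itv /= a0 leey.
    by rewrite in_itv /= leey andbT mule_ge0.
  apply: (@le_trans _ _ ((2 `^ (`|r * s| * (d * A)%:R) *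
      2 `^ (r * s * (l1norm (sg j))%:R))%:E * ((C `^ s)%:E * b (sg j) `^ s)))%E.
    apply: lee_pmul; rewrite ?lee_fin ?powR_ge0 ?poweR_ge0 //.
    exact: weight_near.
  rewrite /W /x !EFinM -!muleA; apply: lee_wpmul2l; first by rewrite lee_fin powR_ge0.
  by rewrite muleCA.
have S0 : (0 <= \esum_(j in [set: d.-tuple nat]) x j)%E by exact: esum_ge0.
rewrite /besov_lq -poweR_EFin -poweRM //.
apply: gt0_ler_poweR => //; first by rewrite invr_ge0.
- rewrite in_itv /= leey andbT; apply: esum_ge0 => j _.
  by rewrite mule_ge0 // ?lee_fin ?powR_ge0 // poweR_ge0.
- by rewrite in_itv /= leey andbT mule_ge0.
apply: (@le_trans _ _ (\esum_(j in [set: d.-tuple nat]) (W%:E * x (sg j))))%E.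
  by apply: le_esum => j _; exact: term.
apply: (le_trans (esum_ge0_mulr _ _)) => //.
have -> : K%:E = (W%:E * (A.*2.+1 ^ d)%:R%:E)%E by rewrite -EFinM mulrC.
rewrite -muleA; apply: lee_wpmul2l; first by rewrite lee_fin.
by apply: esum_near_index => // j; have [] := sgP j.
Qed.

End sequence_space.

(** * Coordinatewise changes of variables *)
Section restriction.
Context dsp (T : measurableType dsp) (R : realType).
Variables (mu : {measure set T -> \bar R}) (D : set T) (mD : measurable D).

Lemma ge0_integral_mrestr (f : T -> \bar R) : measurable_fun setT f ->
  (forall x, 0 <= f x)%E ->
  (\int[mrestr mu mD]_x f x = \int[mu]_(x in D) f x)%E.
Proof.
move=> mf f0.
have mDC : measurable (~` D) by exact: measurableC.
rewrite (@ge0_negligible_integral _ _ _ (mrestr mu mD) setT (~` D)) //; last first.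
  by change (mu (~` D `&` D) = 0%E); rewrite setICl measure0.
rewrite setTD setCK; apply: eq_measure_integral => A mA AD.
by change (mu (A `&` D) = mu A); rewrite setIidl.
Qed.

End restriction.

Section boxes.
Variables (R : realType) (d : nat).
Notation mu := (lebesgue_Rd R d).

Definition box (A : 'I_d -> set (measurableTypeR R)) : set (Rd d R) :=
  [set x | forall i, A i (tnth x i)].

Lemma measurable_box A : (forall i, measurable (A i)) -> measurable (box A).
Proof.
move=> mA; rewrite (_ : box A = \bigcap_(i in [set: 'I_d])
    ((fun x : Rd d R => tnth x i) @^-1` (A i))).
  apply: fin_bigcap_measurable => // i _.
  by rewrite -[X in measurable X]setTI; apply: measurable_tnth.
by apply/seteqP; split => x /= H i; [move=> _; exact: H|exact: (H i I)].
Qed.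

Lemma box_measure A : (forall i, measurable (A i)) ->
  mu (box A) = (\prod_(i < d) lebesgue_measure (A i))%E.
Proof. exact: lebesgue_Rd_box. Qed.

Definition boxes : set (set (Rd d R)) :=
  [set B | exists2 A : 'I_d -> set (measurableTypeR R),
     (forall i, measurable (A i)) & B = box A].

Lemma boxes_generate : measurable = <<s boxes >> :> set (set (Rd d R)).
Proof.
apply/seteqP; split; last first.
  apply: smallest_sub; first exact: sigma_algebra_measurable.
  by move=> _ [A mA ->]; exact: measurable_box.
apply: smallest_sub; first exact: smallest_sigma_algebra.
move=> B; rewrite -bigcup_seq /= => -[i _ [A mA <-]]; apply: sub_sigma_algebra.
exists (fun k => if k == i then A else setT).
  by move=> k; case: ifP => // _; exact: measurableT.
rewrite setTI; apply/seteqP; split => x /=.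
  by move=> Ax k; case: eqP => // ->.
by move/(_ i); rewrite eqxx.
Qed.

Lemma Rd_measure_unique (m1 m2 : {measure set (Rd d R) -> \bar R}) :
  (m1 setT < +oo)%E ->
  (forall A, (forall i, measurable (A i)) -> m1 (box A) = m2 (box A)) ->
  forall B, measurable B -> m1 B = m2 B.
Proof.
move=> m1oo m12 B mB.
apply: (measure_unique boxes (fun=> setT)) => //.
- exact: boxes_generate.
- move=> _ _ [A mA ->] [A' mA' ->]; exists (fun i => A i `&` A' i).
    by move=> i; exact: measurableI.
  apply/seteqP; split => x /=; first by move=> [h1 h2] i; split.
  by move=> h; split => i; have [] := h i.
- by move=> _; exists (fun=> setT) => //; apply/seteqP; split.
- by rewrite bigcup_const //; exists 0%N.
- by move=> _ [A mA ->]; exact: m12.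
Qed.

Definition coord_map (T : 'I_d -> R -> R) (x : Rd d R) : Rd d R :=
  [tuple (T i (xcoord x i) : measurableTypeR R) | i < d].

Lemma measurable_xcoord i : measurable_fun [set: Rd d R] (fun x => xcoord x i).
Proof. exact: measurable_tnth. Qed.

Lemma measurable_coord_map T : (forall i, measurable_fun [set: R] (T i)) ->
  measurable_fun [set: Rd d R] (coord_map T).
Proof.
move=> mT; apply/measurable_fun_tnthP => i.
rewrite (_ : _ \o _ = T i \o (fun x => xcoord x i)).
  apply: measurableT_comp; [exact: mT|exact: measurable_xcoord].
by apply/funext => x /=; rewrite tnth_mktuple.
Qed.

Section change.
Variables (D E : 'I_d -> set (measurableTypeR R)) (T : 'I_d -> R -> R) (c : R).
Hypothesis c0 : 0 <= c.
Hypothesis mD : forall i, measurable (D i).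
Hypothesis mE : forall i, measurable (E i).
Hypothesis mT : forall i, measurable_fun [set: R] (T i).
Hypothesis DT : forall i x, D i x -> E i (T i x).
Hypothesis Doo : forall i, (lebesgue_measure (D i) < +oo)%E.
Hypothesis DTE : forall i (A : set (measurableTypeR R)), measurable A ->
  lebesgue_measure (D i `&` T i @^-1` A) = (c%:E * lebesgue_measure (E i `&` A))%E.

Let mbD := measurable_box mD.
Let mbE := measurable_box mE.
Let mTT := measurable_coord_map mT.

Lemma coord_map_box x : box D x -> box E (coord_map T x).
Proof. by move=> Dx i; rewrite /coord_map tnth_mktuple; apply: DT; exact: Dx. Qed.

Lemma lebesgue_box_lty : (mu (box D) < +oo)%E.
Proof.
rewrite box_measure //.
apply: (big_rec (fun x : \bar R => x < +oo)%E) => [|i x _ xoo]; first exact: ltry.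
by rewrite lte_mul_pinfty // ge0_fin_numE.
Qed.

(** Both sides are finite measures in B, and on boxes they agree because they do
    so in each coordinate. *)
Lemma change_measure B : measurable B ->
  mu (box D `&` coord_map T @^-1` B) = ((c ^+ d)%:E * mu (box E `&` B))%E.
Proof.
move=> mB.
pose m1 : {measure set (Rd d R) -> \bar R} :=
  measure_function_pushforward__canonical__measure_function_Measure
    (mrestr mu mbD) mTT.
have cd0 : 0 <= c ^+ d by rewrite exprn_ge0.
pose m2 : {measure set (Rd d R) -> \bar R} := mscale (NngNum cd0) (mrestr mu mbE).
have m1E A : m1 A = mu (box D `&` coord_map T @^-1` A).
  by rewrite /m1 /= /pushforward /mrestr setIC.
have m2E A : m2 A = ((c ^+ d)%:E * mu (box E `&` A))%E.
  by rewrite /m2 /= /mscale /mrestr /= setIC.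
rewrite -m1E -m2E; apply: Rd_measure_unique => //.
  by rewrite m1E preimage_setT setIT; exact: lebesgue_box_lty.
move=> A mA; rewrite m1E m2E.
have -> : box D `&` coord_map T @^-1` box A = box (fun i => D i `&` T i @^-1` A i).
  apply/seteqP; split => x /=.
    move=> [h1 h2] i; split; first exact: h1.
    by have := h2 i; rewrite tnth_mktuple.
  by move=> h; split => i; have [] := h i => //; rewrite tnth_mktuple.
have -> : box E `&` box A = box (fun i => E i `&` A i).
  apply/seteqP; split => x /=; first by move=> [h1 h2] i; split.
  by move=> h; split => i; have [] := h i.
have mTA i : measurable (T i @^-1` A i : set (measurableTypeR R)).
  by have := mT i measurableT (mA i); rewrite setTI.
rewrite !box_measure; last 2 first.
- by move=> i; exact: measurableI.
- by move=> i; exact: measurableI.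
under eq_bigr do rewrite DTE //.
rewrite big_split /=; congr (_ * _)%E.
rewrite -[in RHS](card_ord d) -prodr_const.
by rewrite (big_morph _ (@EFinM _) (erefl _)).
Qed.

Lemma measurable_change d' (Y : measurableType d') (f : Rd d R -> Y) :
  measurable_fun (box E) f -> measurable_fun (box D) (f \o coord_map T).
Proof.
move=> mf; apply: (measurable_comp mbE) => //.
  by move=> _ [x Dx <-]; exact: coord_map_box.
exact: measurable_funTS.
Qed.

Lemma ge0_change (f : Rd d R -> \bar R) :
  measurable_fun (box E) f -> (forall x, box E x -> 0 <= f x)%E ->
  (\int[mu]_(x in box D) f (coord_map T x) =
   (c ^+ d)%:E * \int[mu]_(x in box E) f x)%E.
Proof.
move=> mf f0.
pose g := f \_ (box E).
have mg : measurable_fun setT g.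
  by apply/(measurable_restrict f mbE) => //; rewrite setTI.
have g0 x : (0 <= g x)%E.
  by rewrite /g patchE; case: ifP => // /set_mem; exact: f0.
pose m1 : {measure set (Rd d R) -> \bar R} :=
  measure_function_pushforward__canonical__measure_function_Measure
    (mrestr mu mbD) mTT.
have cd0 : 0 <= c ^+ d by rewrite exprn_ge0.
pose m2 : {measure set (Rd d R) -> \bar R} := mscale (NngNum cd0) (mrestr mu mbE).
transitivity (\int[mrestr mu mbD]_x g (coord_map T x))%E.
  rewrite ge0_integral_mrestr //; last exact: measurableT_comp.
  apply: eq_integral => x /set_mem Dx; rewrite /g patchE ifT //.
  by apply/mem_set/coord_map_box.
transitivity (\int[m1]_x g x)%E.
  by rewrite /m1 /= ge0_integral_pushforward // preimage_setT.
transitivity (\int[m2]_x g x)%E.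
  apply: eq_measure_integral => A mA _.
  change (mu (coord_map T @^-1` A `&` box D) = ((c ^+ d)%:E * mu (A `&` box E))%E).
  by rewrite setIC change_measure // setIC.
rewrite /m2 /= ge0_integral_mscale //; congr (_ * _)%E.
rewrite ge0_integral_mrestr //; apply: eq_integral => x xE.
by rewrite /g patchE xE.
Qed.

Lemma integrable_change (f : Rd d R -> \bar R) :
  mu.-integrable (box E) f -> mu.-integrable (box D) (f \o coord_map T).
Proof.
move=> /integrableP[mf foo]; apply/integrableP; split.
  exact: measurable_change.
rewrite (ge0_change (f := fun x => `|f x|%E)) //; last first.
  by apply: measurableT_comp.
by rewrite lte_mul_pinfty // lee_fin exprn_ge0.
Qed.

Lemma integral_change (f : Rd d R -> \bar R) :
  mu.-integrable (box E) f ->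
  (\int[mu]_(x in box D) f (coord_map T x) =
   (c ^+ d)%:E * \int[mu]_(x in box E) f x)%E.
Proof.
move=> fi; have mf := measurable_int _ fi.
rewrite integralE [in RHS]integralE.
have -> : ((fun x => f (coord_map T x))^\+ = (fun x => f^\+ (coord_map T x)))%E.
  by apply/funext => x; rewrite !funeposE.
have -> : ((fun x => f (coord_map T x))^\- = (fun x => f^\- (coord_map T x)))%E.
  by apply/funext => x; rewrite !funenegE.
rewrite !ge0_change //; last 2 first.
- exact: measurable_funeneg.
- exact: measurable_funepos.
by rewrite [RHS]muleBr //; exact: integrable_add_def.
Qed.

Lemma ae_change (P : Rd d R -> Prop) :
  {ae mu, forall x, box E x -> P x} ->
  {ae mu, forall x, box D x -> P (coord_map T x)}.
Proof.
move=> [N [mN N0 sub]]; exists (box D `&` coord_map T @^-1` N); split.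
- apply: measurableI => //; rewrite -[X in measurable X]setTI; exact: mTT.
- rewrite change_measure // (_ : mu _ = 0%E) ?mule0 //.
  apply/eqP; rewrite eq_le measure_ge0 andbT -N0; apply: le_measure; rewrite ?inE //.
  exact: measurableI.
move=> x /= /not_implyP[Dx nP]; split => //; apply: sub => /= h.
by apply: nP; apply: h; exact: coord_map_box.
Qed.

End change.
End boxes.

(** * Rotation, reflection and folding of the interval *)
Section line.
Variable R : realType.
Notation lam := (@lebesgue_measure R).
Implicit Types A : set (measurableTypeR R).

Lemma lebesgue_shift (t : R) A : measurable A ->
  lam ((fun x : R => x + t) @^-1` A) = lam A.
Proof.
move=> mA.
have mt : measurable_fun [set: measurableTypeR R]
    ((fun x : R => x + t) : measurableTypeR R -> measurableTypeR R).
  by apply: measurable_funD.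
pose m : {measure set (measurableTypeR R) -> \bar R} :=
  measure_function_pushforward__canonical__measure_function_Measure lam mt.
apply/esym; apply: (@lebesgue_measure_unique R m) => // X [[a b] _ <-] /=.
change (lam `]a, b]%classic = lam ((fun x : R => x + t) @^-1` `]a, b]%classic)).
have -> : (fun x : R => x + t) @^-1` `]a, b]%classic = `]a - t, b - t]%classic.
  by apply/seteqP; split => x /=; rewrite !in_itv /= ltrBlDr lerBrDr.
rewrite !lebesgue_measure_itv /= !lte_fin ltrD2r.
by case: ifP => // _; rewrite -!EFinB; congr (_%:E); ring.
Qed.

Lemma lebesgue_opp A : measurable A -> lam ((fun x : R => - x) @^-1` A) = lam A.
Proof. exact: lebesgue_measureN. Qed.

Definition symitv : set (measurableTypeR R) := `[-1, 1]%classic.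
Definition unititv : set (measurableTypeR R) := `[0, 1]%classic.

Lemma measurable_symitv : measurable symitv. Proof. exact: measurable_itv. Qed.
Lemma measurable_unititv : measurable unititv. Proof. exact: measurable_itv. Qed.
#[local] Hint Resolve measurable_symitv measurable_unititv : core.

Lemma lebesgueU (X Y : set (measurableTypeR R)) : measurable X -> measurable Y ->
  X `&` Y = set0 -> lam (X `|` Y) = (lam X + lam Y)%E.
Proof. by move=> mX mY XY; rewrite [LHS]measureU. Qed.

(** Endpoints are null sets, so that intervals may be taken half-open and then
    tile exactly. *)
Lemma lebesgue_setI_itv_bnd (b1 b2 : bool) (b : bool) (x y : R) A : measurable A ->
  lam ([set` Interval (BSide b1 x) (BSide b2 y)] `&` A) =
  lam ([set` Interval (BSide b x) (BSide true y)] `&` A).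
Proof.
move=> mA.
have E (c1 c2 : bool) : lam ([set` Interval (BSide c1 x) (BSide c2 y)] `&` A) =
    lam (`]x, y[%classic `&` A).
  have sub : `]x, y[%classic `&` A `<=` [set` Interval (BSide c1 x) (BSide c2 y)] `&` A.
    move=> z /= [hz Az]; split => //; move: hz; rewrite !in_itv /= => /andP[h1 h2].
    by apply/andP; split; [case: c1; rewrite /= ?ltW|case: c2; rewrite /= ?ltW].
  apply/eqP; rewrite eq_le; apply/andP; split; last first.
    by apply: le_measure => //; rewrite inE; apply: measurableI.
  have sub2 : [set` Interval (BSide c1 x) (BSide c2 y)] `&` A `<=`
      (`]x, y[%classic `&` A) `|` ([set x] `|` [set y]).
    move=> z /= [hz Az]; move: hz; rewrite in_itv /= => /andP[h1 h2].
    have [->|zx] := eqVneq z x; first by right; left.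
    have [->|zy] := eqVneq z y; first by right; right.
    left; split => //; rewrite in_itv /=; apply/andP; split.
      by move: h1; case: (c1) => //= h1; rewrite lt_neqAle eq_sym zx.
    by move: h2; case: (c2) => //= h2; rewrite lt_neqAle zy.
  apply: (@le_trans _ _ (lam ((`]x, y[%classic `&` A) `|` ([set x] `|` [set y])))).
    apply: le_measure => //; rewrite inE; first exact: measurableI.
    by apply: measurableU; [by apply: measurableI|exact: measurableU].
  apply: (le_trans (measureU2 _ _ _)); [by apply: measurableI|exact: measurableU|].
  rewrite [X in (_ + X)%E](_ : _ = 0%E) ?adde0 //.
  apply/eqP; rewrite eq_le measure_ge0 andbT.
  apply: (le_trans (measureU2 _ _ _)) => //.
  change (lam [set x] + lam [set y] <= 0)%E.
  by rewrite !lebesgue_measure_set1 adde0.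
by rewrite !E.
Qed.

Lemma lebesgue_sym_flip (e : R) A : e = 1 \/ e = -1 -> measurable A ->
  lam (symitv `&` (fun x => e * x) @^-1` A) = lam (symitv `&` A).
Proof.
case=> -> mA.
  by congr (lam (_ `&` _)); apply/seteqP; split => x /=; rewrite mul1r.
rewrite -[RHS]lebesgue_opp; last by apply: measurableI.
congr (lam _); apply/seteqP; split => x; rewrite /symitv /= !in_itv /= mulN1r.
  by move=> [h Ax]; split => //; lra.
by move=> [h Ax]; split => //; lra.
Qed.

Lemma lebesgue_abs A : measurable A ->
  lam (symitv `&` (fun x : R => `|x|) @^-1` A) = (2%:E * lam (unititv `&` A))%E.
Proof.
move=> mA.
have m1 : measurable (unititv `&` A) by apply: measurableI.
have m2 : measurable (`]0, 1]%classic `&` A : set (measurableTypeR R)).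
  by apply: measurableI.
have m3 : measurable ((fun x : R => - x) @^-1` (`]0, 1]%classic `&` A) : set (measurableTypeR R)).
  have mo : measurable_fun [set: R] (fun x : R => - x) by exact: oppr_measurable.
  by have := mo measurableT _ m2; rewrite setTI.
have -> : symitv `&` (fun x : R => `|x|) @^-1` A =
    (unititv `&` A) `|` ((fun x : R => - x) @^-1` (`]0, 1]%classic `&` A)).
  apply/seteqP; split => x /=; rewrite /symitv /unititv /= !in_itv /=.
    move=> [h Ax]; have [x0|x0] := lerP 0 x.
      by left; rewrite ger0_norm // in Ax; split => //; lra.
    by right; rewrite ltr0_norm // in Ax; split => //; lra.
  move=> [[h Ax]|[h Ax]].
    by rewrite ger0_norm; [split => //; lra|lra].
  by rewrite ltr0_norm; [split => //; lra|lra].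
rewrite lebesgueU //; last first.
  apply/seteqP; split => x //=; rewrite /unititv /= !in_itv /=; lra.
rewrite lebesgue_opp // (lebesgue_setI_itv_bnd false false true) //.
rewrite /unititv (lebesgue_setI_itv_bnd true false true) //.
by rewrite -[2]/(1 + 1) EFinD ge0_muleDl // mul1e.
Qed.

Lemma wrap_torusE (s : R) (k : int) : -1 <= s - 2 * k%:~R < 1 ->
  wrap_torus s = s - 2 * k%:~R.
Proof.
move=> h; rewrite /wrap_torus; congr (s - 2 * _%:~R).
by apply: floor_def; rewrite rmorphD /=; apply/andP; split; lra.
Qed.

Lemma wrap_torusP (s : R) : exists2 k : int, wrap_torus s = s - 2 * k%:~R &
  -1 <= s - 2 * k%:~R < 1.
Proof.
exists (Num.floor ((s + 1) / 2)) => //.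
have h1 := floor_le ((s + 1) / 2); have h2 := floorD1_gt ((s + 1) / 2).
rewrite rmorphD /= in h2; lra.
Qed.

Lemma wrap_torus_itv (s : R) : symitv (wrap_torus s).
Proof.
by have [k -> h] := wrap_torusP s; rewrite /symitv /= in_itv /=; lra.
Qed.

Lemma wrap_torusD (s : R) (k : int) : wrap_torus (s + 2 * k%:~R) = wrap_torus s.
Proof.
have [n e h] := wrap_torusP s; rewrite e.
rewrite (@wrap_torusE _ (n + k)); rewrite rmorphD /=; lra.
Qed.

Lemma measurable_wrap : measurable_fun [set: R] (@wrap_torus R).
Proof.
apply: measurable_funB => //; apply: measurable_funM => //.
apply: (@measurableT_comp _ _ _ _ _ _ (fun k : R => (Num.floor k)%:~R : R)
  _ (fun t : R => (t + 1) / 2)).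
  apply: nondecreasing_measurable => //.
  by move=> x y xy; rewrite ler_int le_floor.
by apply: measurable_funM => //; apply: measurable_funD.
Qed.

(** Invariance of the measure under rotations of the circle: the part of the
    rotated interval that leaves [-1, 1) is put back by a translation by 2. *)
Lemma lebesgue_wrap (t : R) A : measurable A ->
  lam (symitv `&` (fun x => wrap_torus (x - t)) @^-1` A) = lam (symitv `&` A).
Proof.
move=> mA.
have mw : measurable_fun [set: R] (fun x : R => wrap_torus (x - t)).
  by apply: (measurableT_comp measurable_wrap); apply: measurable_funB.
have mwA : measurable ((fun x => wrap_torus (x - t)) @^-1` A : set (measurableTypeR R)).
  by have := mw measurableT _ mA; rewrite setTI.
rewrite /symitv !(lebesgue_setI_itv_bnd true false true) //.
(* u is -t modulo 2, and the rotation splits the interval at 1 - u *)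
pose k := Num.floor (- t / 2); pose u := - t - 2 * k%:~R.
have [u0 u2] : 0 <= u /\ u < 2.
  have h1 := floor_le (- t / 2); have h2 := floorD1_gt (- t / 2).
  by rewrite rmorphD /= in h2; rewrite /u /k; split; lra.
have wE x : wrap_torus (x - t) = wrap_torus (x + u).
  by rewrite -[RHS](wrap_torusD _ k) /u; congr wrap_torus; ring.
have mS (s : R) B : measurable B -> measurable ((fun x : R => x + s) @^-1` B : set (measurableTypeR R)).
  move=> mB; have ms : measurable_fun [set: R] (fun x : R => x + s).
    by apply: measurable_funD.
  by have := ms measurableT _ mB; rewrite setTI.
pose B1 : set (measurableTypeR R) := `[-1 + u, 1[%classic `&` A.
pose B2 : set (measurableTypeR R) := `[-1, -1 + u[%classic `&` A.
have mB1 : measurable B1 by apply: measurableI.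
have mB2 : measurable B2 by apply: measurableI.
have -> : `[-1, 1[%classic `&` (fun x => wrap_torus (x - t)) @^-1` A =
    ((fun x : R => x + u) @^-1` B1) `|` ((fun x : R => x + (u - 2)) @^-1` B2).
  apply/seteqP; split => x /=; rewrite /B1 /B2 /= !in_itv /= wE.
    move=> [h]; have [xu|xu] := ltrP (x + u) 1.
      rewrite (@wrap_torusE _ 0); rewrite ?mulr0 ?subr0; last by lra.
      by move=> Ax; left; split => //; lra.
    rewrite (@wrap_torusE _ 1) ?mulr1; last by lra.
    by rewrite -addrA => Ax; right; split => //; lra.
  move=> [[h Ax]|[h Ax]].
    rewrite (@wrap_torusE _ 0); rewrite ?mulr0 ?subr0; last by lra.
    by split => //; lra.
  rewrite (@wrap_torusE _ 1) ?mulr1; last by lra.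
  by rewrite -addrA; split => //; lra.
rewrite lebesgueU; [|exact: mS|exact: mS|].
  rewrite !lebesgue_shift // addeC -lebesgueU //.
    rewrite /B1 /B2 -setIUl; congr (lam (_ `&` _)).
    apply/seteqP; split => x /=; rewrite !in_itv /=; first by move=> [|]; lra.
    by move=> h; have [|] := ltrP x (-1 + u) => xu; [left|right]; lra.
  apply/seteqP; split => x //=; rewrite /B1 /B2 /= !in_itv /=; lra.
apply/seteqP; split => x //=; rewrite /B1 /B2 /= !in_itv /=; lra.
Qed.

End line.

(** * Complex-valued functions and the L_p quasi-norm *)
Section complex_measurable.
Context dT (T : measurableType dT) (R : realType).
Implicit Types (D : set T) (f g : T -> R[i]).

Definition cmeas D f : Prop :=
  measurable_fun D (fun x => complex.Re (f x)) /\
  measurable_fun D (fun x => complex.Im (f x)).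

Lemma cReD (a b : R[i]) : complex.Re (a + b) = complex.Re a + complex.Re b.
Proof. by case: a b => ? ? [? ?]. Qed.
Lemma cImD (a b : R[i]) : complex.Im (a + b) = complex.Im a + complex.Im b.
Proof. by case: a b => ? ? [? ?]. Qed.
Lemma cReM (a b : R[i]) : complex.Re (a * b) =
  complex.Re a * complex.Re b - complex.Im a * complex.Im b.
Proof. by case: a b => ? ? [? ?]. Qed.
Lemma cImM (a b : R[i]) : complex.Im (a * b) =
  complex.Re a * complex.Im b + complex.Im a * complex.Re b.
Proof. by case: a b => ? ? [? ?]. Qed.

Lemma complexP (a b : R[i]) :
  complex.Re a = complex.Re b -> complex.Im a = complex.Im b -> a = b.
Proof. by case: a b => ? ? [? ?] /= -> ->. Qed.

Lemma normc_ge0 (a : R[i]) : 0 <= Normc.normc a.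
Proof. by case: a => a b /=; exact: sqrtr_ge0. Qed.

Lemma Re_le_normc (a : R[i]) : `|complex.Re a| <= Normc.normc a.
Proof.
case: a => a b /=; rewrite -[leLHS]sqrtr_sqr ler_wsqrtr //.
by rewrite lerDl sqr_ge0.
Qed.

Lemma Im_le_normc (a : R[i]) : `|complex.Im a| <= Normc.normc a.
Proof.
case: a => a b /=; rewrite -[leLHS]sqrtr_sqr ler_wsqrtr //.
by rewrite lerDr sqr_ge0.
Qed.

Lemma normc_le_ReIm (a : R[i]) :
  Normc.normc a <= `|complex.Re a| + `|complex.Im a|.
Proof.
case: a => a b /=.
have h : 0 <= `|a| + `|b| by rewrite addr_ge0.
rewrite -(ger0_norm h) -sqrtr_sqr ler_wsqrtr // -(real_normK (num_real a)).
rewrite -(real_normK (num_real b)).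
have := normr_ge0 a; have := normr_ge0 b; nra.
Qed.

Lemma normc_real (x : R) : Normc.normc (x%:C) = `|x|.
Proof. by rewrite /= expr0n /= addr0 sqrtr_sqr. Qed.

Lemma cmeas_cst D (a : R[i]) : cmeas D (fun=> a).
Proof. by split; exact: measurable_cst. Qed.

Lemma cmeasD D f g : cmeas D f -> cmeas D g -> cmeas D (fun x => f x + g x).
Proof.
move=> [f1 f2] [g1 g2]; split.
  by under eq_fun do rewrite cReD; exact: measurable_funD.
by under eq_fun do rewrite cImD; exact: measurable_funD.
Qed.

Lemma cmeasM D f g : cmeas D f -> cmeas D g -> cmeas D (fun x => f x * g x).
Proof.
move=> [f1 f2] [g1 g2]; split.
  under eq_fun do rewrite cReM.
  by apply: measurable_funB; exact: measurable_funM.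
under eq_fun do rewrite cImM.
by apply: measurable_funD; exact: measurable_funM.
Qed.

Lemma cmeas_sum D (I : Type) (s : seq I) (P : pred I) (F : I -> T -> R[i]) :
  (forall i, cmeas D (F i)) -> cmeas D (fun x => \sum_(i <- s | P i) F i x).
Proof.
move=> mF; elim: s => [|i s IH].
  by under eq_fun do rewrite big_nil; exact: cmeas_cst.
under eq_fun do rewrite big_cons.
by case: (P i) => //; exact: cmeasD.
Qed.

Lemma cmeas_prod D (I : Type) (s : seq I) (F : I -> T -> R[i]) :
  (forall i, cmeas D (F i)) -> cmeas D (fun x => \prod_(i <- s) F i x).
Proof.
move=> mF; elim: s => [|i s IH].
  by under eq_fun do rewrite big_nil; exact: cmeas_cst.
by under eq_fun do rewrite big_cons; exact: cmeasM.
Qed.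

Lemma cmeas_real D (f : T -> R) : measurable_fun D f -> cmeas D (fun x => (f x)%:C).
Proof. by move=> mf; split => //=; exact: measurable_cst. Qed.

Lemma cmeas_expi D (f : T -> R) : measurable_fun D f -> cmeas D (fun x => expi (f x)).
Proof.
move=> mf; split => /=.
  apply: (measurableT_comp _ mf); apply: continuous_measurable_fun.
  exact: continuous_cos.
apply: (measurableT_comp _ mf); apply: continuous_measurable_fun.
exact: continuous_sin.
Qed.

Lemma measurable_normc D f : cmeas D f ->
  measurable_fun D (fun x => Normc.normc (f x)).
Proof.
move=> [f1 f2].
have -> : (fun x => Normc.normc (f x)) =
    (fun x => Num.sqrt (complex.Re (f x) ^+ 2 + complex.Im (f x) ^+ 2)).
  by apply/funext => x; case: (f x).
have ms : measurable_fun [set: R] (@Num.sqrt R).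
  by apply: continuous_measurable_fun; exact: sqrt_continuous.
apply: (measurableT_comp ms).
by apply: measurable_funD; exact: measurable_funX.
Qed.

Lemma cmeas_restrict D f : measurable D -> cmeas D f ->
  cmeas setT (fun x => if x \in D then f x else 0).
Proof.
move=> mD [f1 f2]; split.
  have -> : (fun x => complex.Re (if x \in D then f x else 0)) =
      (fun x => complex.Re (f x)) \_ D.
    by apply/funext => x; rewrite patchE; case: ifP.
  by apply/(measurable_restrict _ mD) => //; rewrite setTI.
have -> : (fun x => complex.Im (if x \in D then f x else 0)) =
    (fun x => complex.Im (f x)) \_ D.
  by apply/funext => x; rewrite patchE; case: ifP.
by apply/(measurable_restrict _ mD) => //; rewrite setTI.
Qed.

Lemma cmeas_sub D E f : measurable E -> D `<=` E -> cmeas E f -> cmeas D f.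
Proof.
by move=> mE DE [f1 f2]; split; [exact: (measurable_funS mE DE f1)|
  exact: (measurable_funS mE DE f2)].
Qed.

Lemma cmeas_comp dU (U : measurableType dU) (h : T -> U) (f : U -> R[i])
    D (E : set U) : measurable E -> h @` D `<=` E ->
  measurable_fun D h -> (measurable_fun E (fun x => complex.Re (f x)) /\
  measurable_fun E (fun x => complex.Im (f x))) -> cmeas D (fun x => f (h x)).
Proof.
move=> mE DE mh [f1 f2]; split; [exact: (measurable_comp mE DE f1 mh)|
  exact: (measurable_comp mE DE f2 mh)].
Qed.

End complex_measurable.

Section powers.
Variable R : realType.

Lemma powRD_le (s a b : R) : 0 < s -> s <= 1 -> 0 <= a -> 0 <= b ->
  (a + b) `^ s <= a `^ s + b `^ s.
Proof.
move=> s0 s1 a0 b0.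
have [ab0|abn0] := eqVneq (a + b) 0.
  by rewrite ab0 powR0 ?gt_eqF // addr_ge0 // powR_ge0.
have ab : 0 < a + b by rewrite lt0r abn0 addr_ge0.
have key c : 0 <= c -> c <= a + b -> (a + b) `^ s * (c / (a + b)) <= c `^ s.
  move=> c0 cab; rewrite -{2}(mulfVK abn0 c) mulrC.
  have q0 : 0 <= c / (a + b) by rewrite divr_ge0 // ltW.
  have q1 : c / (a + b) <= 1 by rewrite ler_pdivrMr // mul1r.
  rewrite powRM //; last exact: ltW.
  apply: ler_wpM2r; first exact: powR_ge0.
  have [->|qn0] := eqVneq (c / (a + b)) 0; first exact: powR_ge0.
  have qp : 0 < c / (a + b) by rewrite lt0r qn0.
  by apply: ger1_powR => //; rewrite qp.
have ka : a <= a + b by rewrite lerDl.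
have kb : b <= a + b by rewrite lerDr.
have := lerD (key a a0 ka) (key b b0 kb).
by rewrite -mulrDr -mulrDl divff // mulr1.
Qed.

End powers.

Section Lnorm_mono.
Context dT (T : measurableType dT) (R : realType).
Variable mu : {measure set T -> \bar R}.

Lemma Lnorm_mono (p : \bar R) (u v : T -> R) : (0 < p)%E ->
  measurable_fun setT u -> measurable_fun setT v -> (forall x, 0 <= u x) ->
  {ae mu, forall x, u x <= v x} ->
  ('N[mu]_p[EFin \o u] <= 'N[mu]_p[EFin \o v])%E.
Proof.
case: p => [p p0|_|//] mu' mv u0 uv; rewrite unlock.
  rewrite lte_fin in p0.
  apply: gt0_ler_poweR; rewrite ?invr_ge0 ?(ltW p0) //.
  - by rewrite in_itv /= leey andbT; apply: integral_ge0 => x _; rewrite lee_fin powR_ge0.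
  - by rewrite in_itv /= leey andbT; apply: integral_ge0 => x _; rewrite lee_fin powR_ge0.
  have m (w : T -> R) : measurable_fun setT w ->
      measurable_fun setT (fun x => (`|(EFin \o w) x| `^ p)%E).
    move=> mw; apply: (measurableT_comp (measurable_poweR _)).
    by apply: measurableT_comp => //; exact/measurable_EFinP.
  apply: ae_ge0_le_integral => //.
  - by move=> x _; exact: poweR_ge0.
  - exact: m.
  - by move=> x _; exact: poweR_ge0.
  - exact: m.
  apply: filterS uv => x uv _ /=.
  rewrite lee_fin; apply: ge0_ler_powR; rewrite ?nnegrE ?(ltW p0) //.
  by rewrite !ger0_norm // (le_trans _ uv).
case: ifP => // _; apply: le_ess_sup; apply: filterS uv => x uv /=.
by rewrite lee_fin !ger0_norm // (le_trans _ uv).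
Qed.

End Lnorm_mono.

Section Lp_quasinorm.
Variables (R : realType) (d : nat).
Notation mu := (lebesgue_Rd R d).
Implicit Types (D : set (Rd d R)) (f g : Rd d R -> R[i]) (p : \bar R).

Definition nrm D f : Rd d R -> R := (fun x => Normc.normc (f x)) \_ D.

Lemma LpnormE p D f : Lpnorm p D f = 'N[mu]_p[EFin \o nrm D f]%E.
Proof. by rewrite /Lpnorm /nrm -restrict_EFin. Qed.

Lemma nrm_ge0 D f x : 0 <= nrm D f x.
Proof. by rewrite /nrm patchE; case: ifP => // _; exact: normc_ge0. Qed.

Lemma measurable_nrm D f : measurable D -> cmeas D f -> measurable_fun setT (nrm D f).
Proof.
move=> mD mf; apply/(measurable_restrict _ mD) => //.
by rewrite setTI; exact: measurable_normc.
Qed.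

Lemma Lpnorm_ge0 p D f : (0 <= Lpnorm p D f)%E.
Proof. exact: Lnorm_ge0. Qed.

Lemma Lpnorm_mono p D E f g : (0 < p)%E -> measurable D -> measurable E ->
  cmeas D f -> cmeas E g -> {ae mu, forall x, nrm D f x <= nrm E g x} ->
  (Lpnorm p D f <= Lpnorm p E g)%E.
Proof.
move=> p0 mD mE mf mg h; rewrite !LpnormE; apply: Lnorm_mono => //.
- exact: measurable_nrm.
- exact: measurable_nrm.
- by move=> x; exact: nrm_ge0.
Qed.

Lemma Lpnorm_ae p D f g : (0 < p)%E -> measurable D ->
  cmeas D f -> cmeas D g -> ae_eq_on D f g -> Lpnorm p D f = Lpnorm p D g.
Proof.
move=> p0 mD mf mg fg.
have e : {ae mu, forall x, nrm D f x = nrm D g x}.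
  apply: filterS fg => x h; rewrite /nrm !patchE; case: ifP => // /set_mem Dx.
  by rewrite h.
apply/eqP; rewrite eq_le; apply/andP; split; apply: Lpnorm_mono => //;
  by apply: filterS e => x ->.
Qed.

Lemma Lpnorm_subset p D E f : (0 < p)%E -> measurable D -> measurable E ->
  D `<=` E -> cmeas E f -> (Lpnorm p D f <= Lpnorm p E f)%E.
Proof.
move=> p0 mD mE DE mf; apply: Lpnorm_mono => //; first exact: (cmeas_sub mE DE).
apply/nearW => x; rewrite /nrm !patchE; case: ifPn => [/set_mem Dx|_].
  by rewrite ifT //; apply/mem_set/DE.
by case: ifP => // _; exact: normc_ge0.
Qed.

(** The power of the L_p quasi-norm that is subadditive, min(1, p). *)
Definition qexp p : R := if p is s%:E then Num.min 1 s else 1.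

Lemma qexp_gt0 p : (0 < p)%E -> 0 < qexp p.
Proof. by case: p => //= s; rewrite lte_fin => s0; rewrite lt_min ltr01. Qed.

Lemma Lpnorm_powE (s : R) D f : 0 < s -> measurable D -> cmeas D f ->
  (Lpnorm s%:E D f `^ s = \int[mu]_(x in D) (Normc.normc (f x) `^ s)%:E)%E.
Proof.
move=> s0 mD mf; rewrite LpnormE poweR_Lnorm ?gt_eqF //.
rewrite [RHS]integral_mkcond; apply: eq_integral => x _ /=.
rewrite /nrm !patchE; case: ifP => _.
  by rewrite ger0_norm // normc_ge0.
by rewrite normr0 powR0 // gt_eqF.
Qed.

Lemma LpnormZ p D f (c : R[i]) : (0 < p)%E -> measurable D -> cmeas D f ->
  (Lpnorm p D (fun x => (c * f x)%R) = (Normc.normc c)%:E * Lpnorm p D f)%E.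
Proof.
move=> p0 mD mf; rewrite !LpnormE.
have nE x : nrm D (fun x => c * f x) x = Normc.normc c * nrm D f x.
  by rewrite /nrm !patchE; case: ifP => _; rewrite ?mulr0 // Normc.normcM.
have c0 : 0 <= Normc.normc c by exact: normc_ge0.
have mn := measurable_nrm mD mf.
case: p p0 => [s s0|_|//]; rewrite unlock.
  rewrite lte_fin in s0.
  have -> : (\int[mu]_x (`|(EFin \o nrm D (fun x0 => (c * f x0)%R)) x| `^ s) =
      (Normc.normc c `^ s)%:E * \int[mu]_x (`|(EFin \o nrm D f) x| `^ s))%E.
    rewrite -ge0_integralZl //.
    - apply: eq_integral => x _ /=.
      by rewrite nE normrM [`|Normc.normc c|]ger0_norm // powRM.
    - apply: (measurableT_comp (measurable_poweR _)).
      by apply: measurableT_comp => //; exact/measurable_EFinP.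
    - by move=> x _; exact: poweR_ge0.
    - by rewrite lee_fin powR_ge0.
  rewrite poweRM ?lee_fin ?powR_ge0 //; last first.
    by apply: integral_ge0 => x _; exact: poweR_ge0.
  congr (_ * _)%E.
  by rewrite poweR_EFin -powRrM mulfV ?gt_eqF // powRr1.
case: ifP => [mu0|_]; last by rewrite mule0.
have [c00|cn0] := eqVneq (Normc.normc c) 0.
  rewrite c00 mul0e; apply: ess_sup_ae_cst => //; apply/nearW => x /=.
  by rewrite nE c00 mul0r normr0.
rewrite -ess_sup_pZl; last by rewrite lt0r cn0.
apply: eq_ess_sup; apply/nearW => x /=.
by rewrite nE normrM [`|Normc.normc c|]ger0_norm // EFinM.
Qed.

(** Minkowski's inequality for p >= 1; for p < 1 the integral of the inequality
    |a + b|^p <= |a|^p + |b|^p. *)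
Lemma Lpnorm_quasi_triangle p D f g : (0 < p)%E -> measurable D ->
  cmeas D f -> cmeas D g ->
  (Lpnorm p D (fun x => (f x + g x)%R) `^ qexp p <=
   Lpnorm p D f `^ qexp p + Lpnorm p D g `^ qexp p)%E.
Proof.
move=> p0 mD mf mg.
have mfg : cmeas D (fun x => f x + g x) by exact: cmeasD.
have big1 : (1 <= p)%E -> qexp p = 1 -> (Lpnorm p D (fun x => (f x + g x)%R) `^ qexp p <=
   Lpnorm p D f `^ qexp p + Lpnorm p D g `^ qexp p)%E.
  move=> p1 ->; rewrite !poweRe1 ?Lpnorm_ge0 //.
  have m1 := measurable_nrm mD mf; have m2 := measurable_nrm mD mg.
  rewrite !LpnormE; apply: le_trans (eminkowski mu m1 m2 p1).
  apply: Lnorm_mono => //.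
  - exact: measurable_nrm.
  - exact: measurable_funD.
  - by move=> x; exact: nrm_ge0.
  apply/nearW => x; rewrite /nrm /= !patchE; case: ifP => _; last by rewrite addr0.
  exact: le_normcD.
case: p p0 big1 => [s s0|_|//] big1; last by apply: big1 => //; rewrite leey.
rewrite lte_fin in s0.
have [s1|s1] := leP 1 s.
  by apply: big1 => //; rewrite /qexp min_l.
have -> : qexp s%:E = s by rewrite /qexp min_r // ltW.
rewrite !Lpnorm_powE // -ge0_integralD //; last 4 first.
- by move=> x _; rewrite lee_fin powR_ge0.
- apply/measurable_EFinP; apply: (measurableT_comp (measurable_powR _)).
  exact: measurable_normc.
- by move=> x _; rewrite lee_fin powR_ge0.
- apply/measurable_EFinP; apply: (measurableT_comp (measurable_powR _)).
  exact: measurable_normc.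
have mm f' : cmeas D f' -> measurable_fun D (fun x => (Normc.normc (f' x) `^ s)%:E).
  move=> mf'; apply/measurable_EFinP; apply: (measurableT_comp (measurable_powR _)).
  exact: measurable_normc.
apply: ge0_le_integral => //.
- by move=> x _; rewrite lee_fin powR_ge0.
- exact: mm.
- by apply: emeasurable_funD; exact: mm.
move=> x _; rewrite -EFinD lee_fin.
apply: le_trans (powRD_le s0 (ltW s1) (normc_ge0 _) (normc_ge0 _)).
apply: ge0_ler_powR; rewrite ?nnegrE ?normc_ge0 ?addr_ge0 ?normc_ge0 ?(ltW s0) //.
exact: le_normcD.
Qed.

End Lp_quasinorm.

(** * Integrals over the torus and over the cube *)
Section coordinate_changes.
Variables (R : realType) (d : nat).
Notation mu := (lebesgue_Rd R d).
Notation lam := (@lebesgue_measure R).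
Implicit Types (D E : 'I_d -> set (measurableTypeR R)) (f g : Rd d R -> R[i]).

(** In each coordinate, T pushes Lebesgue measure on D forward to c times Lebesgue
    measure on E.  The instances are the rotations of the circle, the
    reflections, and the folding of [-1, 1] onto [0, 1]. *)
Definition coord_change (c : R) D E (T : 'I_d -> R -> R) : Prop :=
  [/\ 0 <= c, forall i, measurable (D i), forall i, measurable (E i),
      forall i, measurable_fun [set: R] (T i) &
   [/\ forall i x, D i x -> E i (T i x),
       forall i, (lam (D i) < +oo)%E &
       forall i (A : set (measurableTypeR R)), measurable A ->
         lam (D i `&` T i @^-1` A) = (c%:E * lam (E i `&` A))%E]].

(** The constant is c^(d/p) for finite p and 1 for p = oo; the clause on c = 1
    records that rotations do not increase the norm. *)
Lemma Lpnorm_change c D E T (p : \bar R) : coord_change c D E T -> (0 < p)%E ->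
  exists2 K : R, 0 <= K & (c = 1 -> K = 1) /\
  forall f, cmeas (box E) f ->
    (Lpnorm p (box D) (f \o coord_map T) <= K%:E * Lpnorm p (box E) f)%E.
Proof.
move=> [c0 mD mE mT [DT Doo DTE]] p0.
have mbD := measurable_box mD; have mbE := measurable_box mE.
have mch f : cmeas (box E) f -> cmeas (box D) (f \o coord_map T).
  by move=> [f1 f2]; split; [exact: (measurable_change mE mT DT f1)
                            |exact: (measurable_change mE mT DT f2)].
case: p p0 => [s s0|_|//].
  rewrite lte_fin in s0.
  exists ((c ^+ d) `^ s^-1); first exact: powR_ge0.
  split=> [->|f mf]; first by rewrite expr1n powR1.
  have e : (Lpnorm s%:E (box D) (f \o coord_map T) `^ s =
      (c ^+ d)%:E * Lpnorm s%:E (box E) f `^ s)%E.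
    rewrite !Lpnorm_powE //; last exact: mch.
    rewrite -(ge0_change c0 mD mE mT DT Doo DTE (f := fun x => (Normc.normc (f x) `^ s)%:E)) //.
      apply/measurable_EFinP; apply: (measurableT_comp (measurable_powR _)).
      exact: measurable_normc.
    by move=> x _; rewrite lee_fin powR_ge0.
  have back (x : \bar R) : (0 <= x)%E -> ((x `^ s) `^ s^-1 = x)%E.
    by move=> x0; rewrite -poweRrM mulfV ?gt_eqF // poweRe1.
  rewrite -(back _ (Lpnorm_ge0 _ _ _)) e poweRM ?lee_fin ?exprn_ge0 ?poweR_ge0 //.
  by rewrite back ?Lpnorm_ge0.
exists 1; first exact: ler01.
split=> // f mf; rewrite mul1e !LpnormE unlock.
case: ifP => // mu0; apply/ess_supP.
have M0 : (0 <= ess_sup mu (abse \o (EFin \o nrm (box E) f)))%E.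
  by apply: ess_sup_gee => //; apply/nearW => x; exact: abse_ge0.
have h : {ae mu, forall x, box E x ->
    ((abse \o (EFin \o nrm (box E) f)) x <= ess_sup mu (abse \o (EFin \o nrm (box E) f)))%E}.
  by apply: filterS (ess_sup_ge mu (abse \o (EFin \o nrm (box E) f))) => x hx _.
have := ae_change c0 mD mE mT DT Doo DTE h.
apply: filterS => x hx /=; rewrite {1}/nrm patchE.
case: ifPn => [/set_mem Dx|_]; last by rewrite normr0.
have := hx Dx; rewrite /= {1}/nrm patchE ifT //.
by apply/mem_set; exact: (coord_map_box DT).
Qed.

Lemma box_mono_sym (x : Rd d R) : box (fun=> @symitv R) x <-> torus_cube R d x.
Proof.
by split => h i; have := h i; rewrite /symitv /= in_itv.
Qed.

Lemma torus_cubeE : torus_cube R d = box (fun=> @symitv R).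
Proof. by apply/seteqP; split => x /box_mono_sym. Qed.

Lemma unit_cubeE : unit_cube R d = box (fun=> @unititv R).
Proof.
by apply/seteqP; split => x h i; have := h i; rewrite /unititv /= in_itv.
Qed.

Lemma measurable_torus_cube : measurable (torus_cube R d).
Proof. by rewrite torus_cubeE; apply: measurable_box => i; exact: measurable_symitv. Qed.

Lemma measurable_unit_cube : measurable (unit_cube R d).
Proof. by rewrite unit_cubeE; apply: measurable_box => i; exact: measurable_unititv. Qed.

Lemma sub_unit_torus : unit_cube R d `<=` torus_cube R d.
Proof. by move=> x h i; have := h i; lra. Qed.

Lemma symitv_lty : (lam (@symitv R) < +oo)%E.
Proof. by rewrite /symitv lebesgue_measure_itv /=; case: ifP => _; rewrite ?ltry. Qed.

Lemma coord_change_wrap (t : 'I_d -> R) :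
  coord_change 1 (fun=> @symitv R) (fun=> @symitv R) (fun i x => wrap_torus (x - t i)).
Proof.
split=> //; try by move=> i; exact: measurable_symitv.
  move=> i; apply: (measurableT_comp (@measurable_wrap R)).
  exact: measurable_funB.
split=> [i x _|i|i A mA].
- exact: wrap_torus_itv.
- exact: symitv_lty.
- by rewrite mul1e lebesgue_wrap.
Qed.

Lemma coord_change_flip (e : 'I_d -> R) : (forall i, e i = 1 \/ e i = -1) ->
  coord_change 1 (fun=> @symitv R) (fun=> @symitv R) (fun i x => e i * x).
Proof.
move=> e1; split=> //; try by move=> i; exact: measurable_symitv.
  by move=> i; exact: measurable_funM.
split=> [i x|i|i A mA].
- by rewrite /symitv /= !in_itv /=; case: (e1 i) => ->; lra.
- exact: symitv_lty.
- by rewrite mul1e lebesgue_sym_flip.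
Qed.

Lemma coord_change_abs :
  coord_change 2 (fun=> @symitv R) (fun=> @unititv R) (fun i (x : R) => `|x|).
Proof.
split=> //; try by move=> i; exact: measurable_symitv.
  by move=> i; exact: measurable_unititv.
split=> [i x|i|i A mA].
- rewrite /symitv /unititv /= !in_itv /= normr_ge0 /= ler_norml //.
- exact: symitv_lty.
- exact: lebesgue_abs.
Qed.

End coordinate_changes.

Section L1_toolkit.
Variables (R : realType) (d : nat).
Notation mu := (lebesgue_Rd R d).
Implicit Types (D : set (Rd d R)) (f g : Rd d R -> R[i]).

Lemma L1_cmeas D f : L1 D f -> cmeas D f.
Proof.
by move=> [/measurable_int/measurable_EFinP h1 /measurable_int/measurable_EFinP h2].
Qed.

Lemma L1_normc D f : measurable D -> L1 D f ->
  mu.-integrable D (fun x => (Normc.normc (f x))%:E).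
Proof.
move=> mD lf; have [f1 f2] := lf.
have mf := L1_cmeas lf.
apply: (@le_integrable _ _ _ mu D mD _
  (fun x => `|(complex.Re (f x))%:E| + `|(complex.Im (f x))%:E|)%E).
- by apply/measurable_EFinP; exact: measurable_normc.
- move=> x _ /=; rewrite lee_fin ger0_norm ?normc_ge0 //.
  by rewrite ger0_norm ?addr_ge0 // normc_le_ReIm.
by apply: integrableD => //; exact: integrable_abse.
Qed.

Lemma L1_normcP D f : measurable D -> cmeas D f ->
  mu.-integrable D (fun x => (Normc.normc (f x))%:E) -> L1 D f.
Proof.
move=> mD [f1 f2] nf; split; apply: (@le_integrable _ _ _ mu D mD _ _ _ _ nf).
- exact/measurable_EFinP.
- by move=> x _ /=; rewrite lee_fin [leRHS]ger0_norm ?normc_ge0 // Re_le_normc.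
- exact/measurable_EFinP.
- by move=> x _ /=; rewrite lee_fin [leRHS]ger0_norm ?normc_ge0 // Im_le_normc.
Qed.

Lemma L1_le D f g (M : R) : measurable D -> cmeas D f -> L1 D g ->
  (forall x, D x -> Normc.normc (f x) <= M * Normc.normc (g x)) -> L1 D f.
Proof.
move=> mD mf lg fg; apply: L1_normcP => //.
apply: (@le_integrable _ _ _ mu D mD _ (fun x => M%:E * (Normc.normc (g x))%:E)%E).
- by apply/measurable_EFinP; exact: measurable_normc.
- move=> x Dx /=; rewrite lee_fin ger0_norm ?normc_ge0 //.
  by apply: (le_trans (fg x Dx)); exact: ler_norm.
by apply: integrableZl => //; exact: L1_normc.
Qed.

Lemma L1_mulb D f h (M : R) : measurable D -> L1 D f -> cmeas D h ->
  (forall x, D x -> Normc.normc (h x) <= M) -> L1 D (fun x => f x * h x).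
Proof.
move=> mD lf mh hM; apply: (@L1_le _ _ f M) => //.
  by apply: cmeasM => //; exact: L1_cmeas.
move=> x Dx; rewrite Normc.normcM mulrC ler_wpM2r ?normc_ge0 //; exact: hM.
Qed.

Lemma L1D D f g : measurable D -> L1 D f -> L1 D g -> L1 D (fun x => f x + g x).
Proof.
move=> mD [f1 f2] [g1 g2]; split.
  rewrite (_ : (fun x => _) = (fun x => (complex.Re (f x))%:E) \+
     (fun x => (complex.Re (g x))%:E))%E; first exact: integrableD.
  by apply/funext => x; rewrite cReD EFinD.
rewrite (_ : (fun x => _) = (fun x => (complex.Im (f x))%:E) \+
     (fun x => (complex.Im (g x))%:E))%E; first exact: integrableD.
by apply/funext => x; rewrite cImD EFinD.
Qed.

Lemma L1Z D (a : R[i]) f : measurable D -> L1 D f -> L1 D (fun x => a * f x).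
Proof.
move=> mD lf; apply: (@L1_le _ _ f (Normc.normc a)) => //.
  by apply: cmeasM; [exact: cmeas_cst|exact: L1_cmeas].
by move=> x _; rewrite Normc.normcM.
Qed.

Lemma L1_subset D E f : measurable D -> measurable E -> D `<=` E -> L1 E f -> L1 D f.
Proof.
by move=> mD mE DE [f1 f2]; split; [exact: (integrableS mE mD DE f1)|
  exact: (integrableS mE mD DE f2)].
Qed.

Lemma eq_cint D f g : (forall x, D x -> f x = g x) -> cintegral D f = cintegral D g.
Proof.
move=> fg; rewrite /cintegral; congr (_ +i* _); apply: eq_Rintegral => x /set_mem Dx;
  by rewrite fg.
Qed.

Lemma cintD D f g : measurable D -> L1 D f -> L1 D g ->
  cintegral D (fun x => f x + g x) = cintegral D f + cintegral D g.
Proof.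
move=> mD [f1 f2] [g1 g2]; rewrite /cintegral; apply: complexP => /=.
  by rewrite -RintegralD //; apply: eq_Rintegral => x _; rewrite cReD.
by rewrite -RintegralD //; apply: eq_Rintegral => x _; rewrite cImD.
Qed.

Lemma integrable_RZ D (k : R) (u : Rd d R -> R) : measurable D ->
  mu.-integrable D (EFin \o u) -> mu.-integrable D (EFin \o (fun x => k * u x)).
Proof.
move=> mD ui; rewrite (_ : EFin \o _ = (fun x => k%:E * (EFin \o u) x)%E).
  exact: integrableZl.
by apply/funext => x /=; rewrite EFinM.
Qed.

Lemma cintZ D (a : R[i]) f : measurable D -> L1 D f ->
  cintegral D (fun x => a * f x) = a * cintegral D f.
Proof.
move=> mD [f1 f2]; rewrite /cintegral; apply: complexP; rewrite ?cReM ?cImM /=.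
  rewrite -!RintegralZl // -RintegralB //; try exact: integrable_RZ.
  by apply: eq_Rintegral => x _; rewrite cReM.
rewrite -!RintegralZl // -RintegralD //; try exact: integrable_RZ.
by apply: eq_Rintegral => x _; rewrite cImM.
Qed.

Lemma L1_0 D : measurable D -> L1 D (fun=> 0 : R[i]).
Proof. by move=> mD; split; exact: integrable0. Qed.

Lemma cint0 D : cintegral D (fun=> 0 : R[i]) = 0.
Proof.
rewrite /cintegral /Rintegral; apply: complexP => /=.
  by rewrite (eq_integral (fun=> 0%E)) ?integral0.
by rewrite (eq_integral (fun=> 0%E)) ?integral0.
Qed.

Lemma L1_sum D (I : Type) (s : seq I) (F : I -> Rd d R -> R[i]) : measurable D ->
  (forall i, L1 D (F i)) -> L1 D (fun x => \sum_(i <- s) F i x).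
Proof.
move=> mD lF; elim: s => [|i s IH].
  by under eq_fun do rewrite big_nil; exact: L1_0.
by under eq_fun do rewrite big_cons; exact: L1D.
Qed.

Lemma cint_sum D (I : Type) (s : seq I) (F : I -> Rd d R -> R[i]) : measurable D ->
  (forall i, L1 D (F i)) ->
  cintegral D (fun x => \sum_(i <- s) F i x) = \sum_(i <- s) cintegral D (F i).
Proof.
move=> mD lF; elim: s => [|i s IH].
  by under eq_fun do rewrite big_nil; rewrite big_nil cint0.
under eq_fun do rewrite big_cons.
by rewrite cintD // ?big_cons ?IH //; exact: L1_sum.
Qed.

Lemma cint_change c (D E : 'I_d -> set (measurableTypeR R)) T f : coord_change c D E T -> L1 (box E) f ->
  L1 (box D) (f \o coord_map T) /\
  cintegral (box D) (f \o coord_map T) = (c ^+ d)%:C * cintegral (box E) f.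
Proof.
move=> [c0 mD mE mT [DT Doo DTE]] [f1 f2]; split.
  by split; [exact: (integrable_change c0 mD mE mT DT Doo DTE f1)|
             exact: (integrable_change c0 mD mE mT DT Doo DTE f2)].
rewrite /cintegral /Rintegral; apply: complexP; rewrite ?cReM ?cImM /=.
  rewrite mul0r subr0.
  rewrite (integral_change c0 mD mE mT DT Doo DTE f1) fineM //.
  by apply: integrable_fin_num => //; exact: measurable_box.
rewrite mul0r addr0.
rewrite (integral_change c0 mD mE mT DT Doo DTE f2) fineM //.
by apply: integrable_fin_num => //; exact: measurable_box.
Qed.

End L1_toolkit.

(** * Uniqueness of Fourier coefficients, real case *)
Section steep_powers.
Variable R : realType.
Implicit Types s t : R.

Lemma bernoulli_le t (n : nat) : -1 <= t -> 1 + n%:R * t <= (1 + t) ^+ n.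
Proof.
move=> t1; elim: n => [|n IH]; first by rewrite mul0r addr0 expr0.
rewrite exprS; apply: (@le_trans _ _ ((1 + t) * (1 + n%:R * t))); last first.
  by apply: ler_wpM2l => //; lra.
rewrite -natr1; have : 0 <= n%:R * t ^+ 2 by rewrite mulr_ge0 ?sqr_ge0.
rewrite expr2; lra.
Qed.

Lemma cvg_natM_expr (a : R) : 0 <= a -> a < 1 -> (n%:R * a ^+ n) @[n --> \oo] --> 0.
Proof.
move=> a0 a1.
pose b := Num.sqrt a.
have bb : b * b = a by rewrite -expr2 sqr_sqrtr.
have b0 : 0 <= b by exact: sqrtr_ge0.
have b1 : b < 1 by nra.
have [b00|bn0] := eqVneq b 0.
  have -> : (fun n : nat => n%:R * a ^+ n) = (fun=> 0).
    by apply/funext => -[|n]; rewrite ?mul0r // -bb b00 mul0r expr0n /= mulr0.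
  exact: cvg_cst.
have bp : 0 < b by rewrite lt0r bn0.
pose C := (b^-1 - 1)^-1.
have C1 : 0 < b^-1 - 1 by rewrite subr_gt0 invf_gt1.
have nb (n : nat) : n%:R * b ^+ n <= C.
  have := @bernoulli_le (b^-1 - 1) n; rewrite subrKC => /(_ _) h.
  have {}h : 1 + n%:R * (b^-1 - 1) <= b^-1 ^+ n by apply: h; lra.
  rewrite exprVn in h; rewrite /C -[leRHS]mul1r ler_pdivlMr //.
  have bn : 0 < b ^+ n by rewrite exprn_gt0.
  rewrite -[leRHS](mulVf (lt0r_neq0 bn)) mulrAC.
  by apply: ler_wpM2r; [exact: ltW|lra].
apply: (@squeeze_cvgr _ _ _ _ (fun=> 0) (fun n => C * b ^+ n)).
- near=> n; apply/andP; split; first by rewrite mulr_ge0 // exprn_ge0.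
  rewrite -bb exprMn mulrA; apply: ler_wpM2r; first exact: exprn_ge0.
  exact: nb.
- exact: cvg_cst.
rewrite -[X in _ --> X](mulr0 C); apply: cvgMr; apply: cvg_expr.
by rewrite ger0_norm.
Unshelve. all: by end_near. Qed.

(** Polynomials in s that tend to a step function at 1/2.  Below 1/2, Bernoulli's
    inequality gives 1 - n (2 s)^n as a lower bound.  Above, it shows that
    (1 + s^n)^(2^n) >= 2, and (1 - s^n)(1 + s^n) <= 1. *)
Lemma steep_cvg s : 0 <= s <= 1 ->
  ((1 - s ^+ n) ^+ (n * 2 ^ n)) @[n --> \oo] --> ((s < 2^-1)%R%:R : R).
Proof.
move=> /andP[s0 s1].
have sn0 n : 0 <= s ^+ n by exact: exprn_ge0.
have sn1 n : s ^+ n <= 1 by exact: exprn_ile1.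
have [s2|s2] := ltrP s 2^-1.
  apply: (@squeeze_cvgr _ _ _ _ (fun n => 1 - n%:R * (2 * s) ^+ n) (fun=> 1)).
  - near=> n; apply/andP; split.
      have := @bernoulli_le (- s ^+ n) (n * 2 ^ n).
      rewrite natrM natrX mulrN -mulrA -exprMn; apply.
      by have := sn1 n; lra.
    by apply: exprn_ile1; have := sn0 n; have := sn1 n; lra.
  - rewrite -[X in _ --> X]subr0; apply: cvgB; first exact: cvg_cst.
    by apply: cvg_natM_expr; lra.
  - exact: cvg_cst.
apply: (@squeeze_cvgr _ _ _ _ (fun=> 0) (fun n => 2^-1 ^+ n)).
- near=> n; apply/andP; split.
    by apply: exprn_ge0; have := sn1 n; lra.
  rewrite mulnC exprM; apply: lerXn2r; rewrite ?nnegrE ?invr_ge0 //.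
    by apply: exprn_ge0; have := sn1 n; lra.
  set t := s ^+ n; have t0 : 0 <= t by exact: sn0.
  have t1 : t <= 1 by exact: sn1.
  have h1 : (1 - t) ^+ (2 ^ n) * (1 + t) ^+ (2 ^ n) <= 1.
    rewrite -exprMn; apply: exprn_ile1; nra.
  have h2 : 2 <= (1 + t) ^+ (2 ^ n).
    apply: le_trans (@bernoulli_le t (2 ^ n) _); last by lra.
    rewrite natrX -exprMn_comm; last exact: mulrC.
    have : 1 <= (2 * s) ^+ n by apply: exprn_ege1; lra.
    lra.
  have h3 : 0 <= (1 - t) ^+ (2 ^ n) by apply: exprn_ge0; lra.
  nra.
- exact: cvg_cst.
by apply: cvg_expr; rewrite ger0_norm ?invr_ge0 //; lra.
Unshelve. all: by end_near. Qed.

End steep_powers.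

Section uniqueness.
Variables (R : realType) (d : nat).
Notation mu := (lebesgue_Rd R d).
Notation D := (torus_cube R d).
Variable g : Rd d R -> R.
Hypothesis gi : mu.-integrable D (EFin \o g).
Implicit Types (l : 'I_d -> int) (x : Rd d R) (u v h : Rd d R -> R).

Let mD : measurable D. Proof. exact: measurable_torus_cube. Qed.

Definition phase l x : R := pi * (\sum_(i < d) (l i)%:~R * xcoord x i).

Definition bdd h := measurable_fun setT h /\ exists M, forall x, `|h x| <= M.

Lemma bddM u v : bdd u -> bdd v -> bdd (fun x => u x * v x).
Proof.
move=> [mu' [M hM]] [mv [N hN]]; split; first exact: measurable_funM.
by exists (M * N) => x; rewrite normrM ler_pM.
Qed.

Lemma bddB u v : bdd u -> bdd v -> bdd (fun x => u x - v x).
Proof.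
move=> [mu' [M hM]] [mv [N hN]]; split; first exact: measurable_funB.
by exists (M + N) => x; apply: (le_trans (ler_normB _ _)); rewrite lerD.
Qed.

Lemma bdd_cst (c : R) : bdd (fun=> c).
Proof. by split; [exact: measurable_cst|exists `|c|]. Qed.

Lemma measurable_phase l : measurable_fun setT (phase l).
Proof.
apply: measurable_funM => //; apply: measurable_sum => i.
by apply: measurable_funM => //; exact: measurable_xcoord.
Qed.

Lemma bdd_cos (f : Rd d R -> R) : measurable_fun setT f -> bdd (fun x => cos (f x)).
Proof.
move=> mf; split; last by exists 1 => x; exact: cos_max.
by apply: (measurableT_comp _ mf); apply: continuous_measurable_fun; exact: continuous_cos.
Qed.

Lemma bdd_sin (f : Rd d R -> R) : measurable_fun setT f -> bdd (fun x => sin (f x)).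
Proof.
move=> mf; split; last by exists 1 => x; exact: sin_max.
by apply: (measurableT_comp _ mf); apply: continuous_measurable_fun; exact: continuous_sin.
Qed.

Definition pair_int h : R := \int[mu]_(x in D) (g x * h x).

Lemma integrable_pair h : bdd h -> mu.-integrable D (EFin \o (fun x => g x * h x)).
Proof.
move=> [mh [M hM]].
rewrite (_ : EFin \o _ = (EFin \o g) \* (EFin \o h))%E; last first.
  by apply/funext => x /=; rewrite EFinM.
apply: integrableMl => //; first exact: measurable_funTS.
exists M; split; first exact: num_real.
by move=> N MN x _ /=; apply: (le_trans (hM x)); exact: ltW.
Qed.

Lemma pair_intB u v : bdd u -> bdd v ->
  pair_int (fun x => u x - v x) = pair_int u - pair_int v.
Proof.
move=> bu bv; rewrite /pair_int -RintegralB //; try exact: integrable_pair.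
by apply: eq_Rintegral => x _; rewrite mulrBr.
Qed.

Lemma pair_intZ (c : R) u : bdd u -> pair_int (fun x => c * u x) = c * pair_int u.
Proof.
move=> bu; rewrite /pair_int -RintegralZl //; try exact: integrable_pair.
by apply: eq_Rintegral => x _; rewrite mulrCA.
Qed.

Lemma pair_intD u v : bdd u -> bdd v ->
  pair_int (fun x => u x + v x) = pair_int u + pair_int v.
Proof.
move=> bu bv; rewrite /pair_int -RintegralD //; try exact: integrable_pair.
by apply: eq_Rintegral => x _; rewrite mulrDr.
Qed.

Lemma pair_int_lim (u_ : nat -> Rd d R -> R) u (M : R) :
  (forall n, bdd (u_ n)) -> (forall n x, `|u_ n x| <= M) ->
  (forall x, u_ n x @[n --> \oo] --> u x) -> bdd u ->
  (forall n, pair_int (u_ n) = 0) -> pair_int u = 0.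
Proof.
move=> bu uM uu bdu u0.
have e0 n : (\int[mu]_(x in D) (g x * u_ n x)%:E = 0)%E.
  have := u0 n; rewrite /pair_int /Rintegral => h.
  by rewrite -[LHS]fineK ?h //; apply: integrable_fin_num => //; exact: integrable_pair.
have [|||||_ _ cv] := @dominated_convergence _ _ R mu D mD
  (fun n x => (g x * u_ n x)%:E) (fun x => (g x * u x)%:E)
  (fun x => (M%:E * `|(g x)%:E|)%E).
- by move=> n; exact: (measurable_int _ (integrable_pair (bu n))).
- exact: (measurable_int _ (integrable_pair bdu)).
- apply/nearW => x _; apply: cvg_EFin; first exact: nearW.
  by apply: cvgMr; exact: uu.
- by apply: integrableZl => //; exact: integrable_abse.
- by apply/nearW => x n _; rewrite /= -EFinM lee_fin normrM mulrC ler_wpM2r.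
have : (\int[mu]_(x in D) (g x * u x)%:E = 0)%E.
  apply: (cvg_unique _ cv) => //.
  by apply: cvg_near_cst; apply: nearW => n; exact: e0.
by rewrite /pair_int /Rintegral => ->.
Qed.

(** The density h g has the same Fourier coefficients as 0. *)
Definition annih h := bdd h /\ forall l,
  pair_int (fun x => h x * cos (phase l x)) = 0 /\
  pair_int (fun x => h x * sin (phase l x)) = 0.

(** Functions whose multiplication preserves the vanishing of all Fourier
    coefficients.  They form an algebra that is closed under bounded pointwise
    limits and contains the trigonometric functions of each coordinate; it will
    turn out to contain the indicators of all periodic Borel sets. *)
Definition annih_mult u := bdd u /\ forall h, annih h -> annih (fun x => u x * h x).

Lemma bdd_cos_phase l : bdd (fun x => cos (phase l x)).
Proof. by apply: bdd_cos; exact: measurable_phase. Qed.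
Lemma bdd_sin_phase l : bdd (fun x => sin (phase l x)).
Proof. by apply: bdd_sin; exact: measurable_phase. Qed.

Lemma annih_multM u v : annih_mult u -> annih_mult v -> annih_mult (fun x => u x * v x).
Proof.
move=> [bu hu] [bv hv]; split; first exact: bddM.
move=> h /hv /hu; rewrite (_ : (fun x => u x * v x * h x) = (fun x => u x * (v x * h x))) //.
by apply/funext => x; rewrite mulrA.
Qed.

Lemma annih_multB u v : annih_mult u -> annih_mult v -> annih_mult (fun x => u x - v x).
Proof.
move=> [bu hu] [bv hv]; split; first exact: bddB.
move=> h ah; have [b1 z1] := hu h ah; have [b2 z2] := hv h ah; split.
  rewrite (_ : (fun x => _) = (fun x => u x * h x - v x * h x)); first exact: bddB.
  by apply/funext => x; rewrite mulrBl.
move=> l; have [c1 s1] := z1 l; have [c2 s2] := z2 l; split.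
  rewrite (_ : (fun x => _) = (fun x => u x * h x * cos (phase l x) - v x * h x * cos (phase l x))).
    by rewrite pair_intB ?c1 ?c2 ?subrr //; apply: bddM => //; exact: bdd_cos_phase.
  by apply/funext => x; rewrite !mulrBl.
rewrite (_ : (fun x => _) = (fun x => u x * h x * sin (phase l x) - v x * h x * sin (phase l x))).
  by rewrite pair_intB ?s1 ?s2 ?subrr //; apply: bddM => //; exact: bdd_sin_phase.
by apply/funext => x; rewrite !mulrBl.
Qed.

Lemma annih_mult_cst (c : R) : annih_mult (fun=> c).
Proof.
split; first exact: bdd_cst.
move=> h [bh zh]; split; first by apply: bddM => //; exact: bdd_cst.
move=> l; have [c1 s1] := zh l; split.
  rewrite (_ : (fun x => _) = (fun x => c * (h x * cos (phase l x)))).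
    by rewrite pair_intZ ?c1 ?mulr0 //; apply: bddM => //; exact: bdd_cos_phase.
  by apply/funext => x; rewrite mulrA.
rewrite (_ : (fun x => _) = (fun x => c * (h x * sin (phase l x)))).
  by rewrite pair_intZ ?s1 ?mulr0 //; apply: bddM => //; exact: bdd_sin_phase.
by apply/funext => x; rewrite mulrA.
Qed.

Lemma annih_multX u n : annih_mult u -> annih_mult (fun x => u x ^+ n).
Proof.
move=> hu; elim: n => [|n IH]; first exact: annih_mult_cst.
by rewrite (_ : (fun x => _) = (fun x => u x * u x ^+ n)); [exact: annih_multM|
  apply/funext => x; rewrite exprS].
Qed.

Lemma annih_mult_lim (u_ : nat -> Rd d R -> R) u (M : R) :
  (forall n, annih_mult (u_ n)) -> (forall n x, `|u_ n x| <= M) ->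
  (forall x, u_ n x @[n --> \oo] --> u x) -> bdd u -> annih_mult u.
Proof.
move=> au uM uu bu; split => // h ah; have [bh zh] := ah; have [_ [N hN]] := bh.
split; first exact: bddM.
have key w : bdd w -> (forall x, `|w x| <= 1) ->
    (forall n, pair_int (fun x => u_ n x * h x * w x) = 0) ->
    pair_int (fun x => u x * h x * w x) = 0.
  move=> bw w1 z; apply: (@pair_int_lim (fun n x => u_ n x * h x * w x) _ (M * N)) => //.
  - by move=> n; have [bn _] := au n; apply: bddM => //; exact: bddM.
  - move=> n x; rewrite !normrM -[M * N]mulr1.
    by rewrite ler_pM ?mulr_ge0 // ler_pM.
  - by move=> x; apply: cvgMl; apply: cvgMl; exact: uu.
  - by apply: bddM => //; exact: bddM.
move=> l; split.
  apply: key; [exact: bdd_cos_phase|by move=> x; exact: cos_max|].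
  by move=> n; have [_ /(_ h ah)[_ /(_ l)[]]] := au n.
apply: key; [exact: bdd_sin_phase|by move=> x; exact: sin_max|].
by move=> n; have [_ /(_ h ah)[_ /(_ l)[]]] := au n.
Qed.

Definition freq_shift l (i : 'I_d) (k : int) : 'I_d -> int :=
  fun j => if j == i then l j + k else l j.

Lemma phase_shift l i k x :
  phase (freq_shift l i k) x = phase l x + k%:~R * (pi * xcoord x i).
Proof.
rewrite /phase (bigD1 i) //= [in RHS](bigD1 i) //= /freq_shift eqxx.
rewrite rmorphD /= (eq_bigr (fun j => (l j)%:~R * xcoord x j)); last first.
  by move=> j /negPf ->.
ring.
Qed.

Lemma measurable_pix i : measurable_fun setT (fun x : Rd d R => pi * xcoord x i).
Proof. by apply: measurable_funM => //; exact: measurable_xcoord. Qed.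

(** Multiplication by a cosine averages two shifts of the frequency. *)
Lemma annih_mult_cos i : annih_mult (fun x => cos (pi * xcoord x i)).
Proof.
split; first by apply: bdd_cos; exact: measurable_pix.
move=> h [bh zh]; split.
  by apply: bddM => //; apply: bdd_cos; exact: measurable_pix.
move=> l; have [cp sp] := zh (freq_shift l i 1).
have [cm sm] := zh (freq_shift l i (-1)).
have b1 k : bdd (fun x => h x * cos (phase (freq_shift l i k) x)).
  by apply: bddM => //; exact: bdd_cos_phase.
have b2 k : bdd (fun x => h x * sin (phase (freq_shift l i k) x)).
  by apply: bddM => //; exact: bdd_sin_phase.
have bb u v : bdd u -> bdd v -> bdd (fun x => u x + v x).
  move=> [mu' [M hM]] [mv [N hN]]; split; first exact: measurable_funD.
  by exists (M + N) => x; apply: (le_trans (ler_normD _ _)); rewrite lerD.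
split.
  rewrite (_ : (fun x => _) = (fun x => 2^-1 * (h x * cos (phase (freq_shift l i 1) x) +
      h x * cos (phase (freq_shift l i (-1)) x)))).
    by rewrite pair_intZ ?pair_intD ?cp ?cm ?addr0 ?mulr0 //; exact: bb.
  apply/funext => x; rewrite !phase_shift mulr1z mulrN1z mul1r mulN1r cosB cosD; lra.
rewrite (_ : (fun x => _) = (fun x => 2^-1 * (h x * sin (phase (freq_shift l i 1) x) +
    h x * sin (phase (freq_shift l i (-1)) x)))).
  by rewrite pair_intZ ?pair_intD ?sp ?sm ?addr0 ?mulr0 //; exact: bb.
apply/funext => x; rewrite !phase_shift mulr1z mulrN1z mul1r mulN1r sinB sinD; lra.
Qed.

Lemma annih_mult_sin i : annih_mult (fun x => sin (pi * xcoord x i)).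
Proof.
split; first by apply: bdd_sin; exact: measurable_pix.
move=> h [bh zh]; split.
  by apply: bddM => //; apply: bdd_sin; exact: measurable_pix.
move=> l; have [cp sp] := zh (freq_shift l i 1).
have [cm sm] := zh (freq_shift l i (-1)).
have b1 k : bdd (fun x => h x * cos (phase (freq_shift l i k) x)).
  by apply: bddM => //; exact: bdd_cos_phase.
have b2 k : bdd (fun x => h x * sin (phase (freq_shift l i k) x)).
  by apply: bddM => //; exact: bdd_sin_phase.
split.
  rewrite (_ : (fun x => _) = (fun x => 2^-1 * (h x * sin (phase (freq_shift l i 1) x) -
      h x * sin (phase (freq_shift l i (-1)) x)))).
    by rewrite pair_intZ ?pair_intB ?sp ?sm ?subr0 ?mulr0 //; exact: bddB.
  apply/funext => x; rewrite !phase_shift mulr1z mulrN1z mul1r mulN1r sinB sinD; lra.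
rewrite (_ : (fun x => _) = (fun x => 2^-1 * (h x * cos (phase (freq_shift l i (-1)) x) -
    h x * cos (phase (freq_shift l i 1) x)))).
  by rewrite pair_intZ ?pair_intB ?cp ?cm ?subr0 ?mulr0 //; exact: bddB.
apply/funext => x; rewrite !phase_shift mulr1z mulrN1z mul1r mulN1r cosB cosD; lra.
Qed.

(** These sets form a sigma-algebra, by the closure properties of
    [annih_mult]. *)
Definition good (B : set (Rd d R)) := measurable B /\ annih_mult (\1_B : Rd d R -> R).

Lemma bdd_indic (B : set (Rd d R)) : measurable B -> bdd (\1_B).
Proof.
move=> mB; split; first exact: measurable_indic.
by exists 1 => x; rewrite indicE; case: (x \in B); rewrite ?normr1 ?normr0.
Qed.

Lemma goodC B : good B -> good (~` B).
Proof.
move=> [mB aB]; split; first exact: measurableC.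
rewrite (_ : \1_(~` B) = (fun x => 1 - \1_B x)).
  by apply: annih_multB => //; exact: annih_mult_cst.
by apply/funext => x; rewrite !indicE in_setC; case: (x \in B); rewrite /= ?subrr ?subr0.
Qed.

Lemma goodI A B : good A -> good B -> good (A `&` B).
Proof.
move=> [mA aA] [mB aB]; split; first exact: measurableI.
rewrite (_ : \1_(A `&` B) = (fun x => \1_A x * \1_B x)); first exact: annih_multM.
by apply/funext => x; rewrite !indicE in_setI; case: (x \in A); case: (x \in B);
  rewrite /= ?mulr1 ?mulr0.
Qed.

Lemma goodU A B : good A -> good B -> good (A `|` B).
Proof.
move=> gA gB; rewrite -(setCK (A `|` B)) setCU; apply: goodC.
by apply: goodI; exact: goodC.
Qed.

Lemma good0 : good set0.
Proof.
split => //; rewrite indic0; exact: annih_mult_cst.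
Qed.

Lemma good_bigcup (F : nat -> set (Rd d R)) : (forall n, good (F n)) ->
  good (\bigcup_n F n).
Proof.
move=> gF.
have mF : measurable (\bigcup_n F n) by apply: bigcupT_measurable => n; have [] := gF n.
split => //.
pose G n := \big[setU/set0]_(k < n) F k.
have gG n : good (G n).
  rewrite /G; elim: n => [|n IH]; first by rewrite big_ord0; exact: good0.
  by rewrite big_ord_recr /=; exact: goodU.
apply: (@annih_mult_lim (fun n => \1_(G n)) _ 1).
- by move=> n; have [] := gG n.
- by move=> n x; rewrite indicE; case: (x \in _); rewrite ?normr1 ?normr0.
- move=> x; apply: cvg_near_cst.
  have [[n _ Fnx]|nF] := pselect ((\bigcup_n F n) x).
    near=> k; rewrite !indicE !mem_set //; first by exists n.
    rewrite /G -bigcup_mkord; exists n => //=.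
    by near: k; exact: nbhs_infty_gt.
  near=> k; rewrite !indicE !memNset // => -; rewrite /G -bigcup_mkord => -[n _ Fnx].
  by apply: nF; exists n.
exact: bdd_indic.
Unshelve. all: by end_near. Qed.

(** Polynomials in u converge boundedly to the indicator, by [steep_cvg]. *)
Lemma good_superlevel u (th : R) : annih_mult u -> (forall x, -1 <= u x <= 1) ->
  -1 <= th <= 1 -> good [set x | th < u x].
Proof.
move=> au u1 th1; have [[mu' _] _] := au.
have mB : measurable [set x | th < u x].
  have := mu' measurableT _ (measurable_itv `]th, +oo[).
  rewrite setTI; congr measurable; apply/seteqP; split => x /=;
    by rewrite in_itv /= andbT.
split => //.
(* affine in u, with values in [0, 1], and below 1/2 exactly where u > th *)
pose s x := 2^-1 + (4^-1 * th - 4^-1 * u x).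
have s01 x : 0 <= s x <= 1 by have := u1 x; rewrite /s; lra.
apply: (@annih_mult_lim (fun n x => (1 - s x ^+ n) ^+ (n * 2 ^ n)) _ 1).
- move=> n; apply: annih_multX; apply: annih_multB; first exact: annih_mult_cst.
  apply: annih_multX.
  have -> : s = (fun x => (2^-1 + 4^-1 * th) - 4^-1 * u x).
    by apply/funext => x; rewrite /s addrA.
  apply: annih_multB; first exact: annih_mult_cst.
  by apply: annih_multM => //; exact: annih_mult_cst.
- move=> n x; have /andP[s0 s1] := s01 x.
  have h1 : 0 <= s x ^+ n by exact: exprn_ge0.
  have h2 : s x ^+ n <= 1 by exact: exprn_ile1.
  by rewrite ger0_norm; [apply: exprn_ile1; lra|apply: exprn_ge0; lra].
- move=> x; rewrite (_ : \1__ x = (s x < 2^-1)%R%:R); first exact: steep_cvg.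
  rewrite indicE; congr (_%:R); congr nat_of_bool; apply/idP/idP.
    by move/set_mem => /= h; rewrite /s; lra.
  by move=> h; apply/mem_set => /=; rewrite /s in h; lra.
exact: bdd_indic.
Qed.

Lemma good_setT : good setT.
Proof. by rewrite -setC0; apply: goodC; exact: good0. Qed.

Lemma cos_int_period (s : R) (k : int) : cos (pi * (s - 2 * k%:~R)) = cos (pi * s).
Proof.
have /eqP := expi_2pi_int R k; rewrite /expi eq_complex /= => /andP[/eqP c1 /eqP s0].
by rewrite mulrBr mulrCA mulrA cosB c1 s0 mulr1 mulr0 addr0.
Qed.

Lemma sin_int_period (s : R) (k : int) : sin (pi * (s - 2 * k%:~R)) = sin (pi * s).
Proof.
have /eqP := expi_2pi_int R k; rewrite /expi eq_complex /= => /andP[/eqP c1 /eqP s0].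
by rewrite mulrBr mulrCA mulrA sinB c1 s0 mulr1 mulr0 subr0.
Qed.

Lemma cos_pi_lt (a b : R) : -1 <= a <= 1 -> -1 <= b <= 1 ->
  (cos (pi * a) < cos (pi * b)) = (`|b| < `|a|).
Proof.
move=> a1 b1; have pi0 := @pi_gt0 R.
rewrite -[cos (pi * a)]cos_norm -[cos (pi * b)]cos_norm !normrM (gtr0_norm pi0).
have n1 (c : R) : -1 <= c <= 1 -> pi * `|c| \in `[0, pi]%R.
  rewrite -ler_norml => c1; rewrite in_itv /=; have := normr_ge0 c; nra.
by rewrite ltr_cos ?n1 // ltr_pM2l.
Qed.

Lemma sin_pi_gt0 (a : R) : -1 <= a < 1 -> (0 < sin (pi * a)) = (0 < a).
Proof.
move=> a1; have pi0 := @pi_gt0 R.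
have [a0|a0] := ltrP 0 a; first by rewrite sin_gt0_pi //; nra.
apply/negP/negP; rewrite -leNgt -oppr_ge0 -sinN -mulrN.
by apply: sin_ge0_pi; nra.
Qed.

(** On [-1, 1) the sign of sin (pi t) is that of t, and cos (pi t) is decreasing
    in |t|.  Hence a ray t > c is an intersection (c >= 0) or a union (c < 0) of
    superlevel sets of trigonometric functions. *)
Lemma good_wrap_ray i (c : R) : good [set x | c < wrap_torus (xcoord x i)].
Proof.
have W x := wrap_torusP (xcoord x i).
have cosW x : cos (pi * wrap_torus (xcoord x i)) = cos (pi * xcoord x i).
  by have [k -> _] := W x; exact: cos_int_period.
have sinW x : sin (pi * wrap_torus (xcoord x i)) = sin (pi * xcoord x i).
  by have [k -> _] := W x; exact: sin_int_period.
have W1 x : -1 <= wrap_torus (xcoord x i) < 1 by have [k -> h] := W x.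
have W2 x : -1 <= wrap_torus (xcoord x i) <= 1 by have := W1 x; lra.
have [c1|c1] := lerP 1 c.
  rewrite (_ : [set x | _] = set0); first exact: good0.
  by apply/seteqP; split => x //= h; have := W1 x; lra.
have [c2|c2] := ltrP c (-1).
  rewrite (_ : [set x | _] = setT); first exact: good_setT.
  by apply/seteqP; split => x //= _; have := W1 x; lra.
have cc : -1 <= c <= 1 by lra.
have cos_itv (t : R) : -1 <= cos t <= 1 by rewrite cos_geN1 cos_le1.
have sin_itv (t : R) : -1 <= sin t <= 1 by rewrite sin_geN1 sin_le1.
have gsin : good [set x | 0 < sin (pi * xcoord x i)].
  by apply: good_superlevel; [exact: annih_mult_sin|move=> x; exact: sin_itv|lra].
have [c0|c0] := lerP 0 c.
  have gcos : good [set x | - cos (pi * c) < 0 - cos (pi * xcoord x i)].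
    apply: good_superlevel; last by have := cos_itv (pi * c); lra.
      by apply: annih_multB; [exact: annih_mult_cst|exact: annih_mult_cos].
    by move=> x; have := cos_itv (pi * xcoord x i); lra.
  rewrite (_ : [set x | _] = [set x | 0 < sin (pi * xcoord x i)] `&`
     [set x | - cos (pi * c) < 0 - cos (pi * xcoord x i)]); first exact: goodI.
  apply/seteqP; split => x /=; rewrite -cosW -sinW sin_pi_gt0 // sub0r ltrN2 cos_pi_lt //.
    by rewrite (ger0_norm c0) => h; rewrite ger0_norm; [split => //|]; lra.
  by rewrite (ger0_norm c0) => -[h1]; rewrite gtr0_norm.
have gcos : good [set x | cos (pi * c) < cos (pi * xcoord x i)].
  by apply: good_superlevel => //; exact: annih_mult_cos.
rewrite (_ : [set x | _] = [set x | 0 < sin (pi * xcoord x i)] `|`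
   [set x | cos (pi * c) < cos (pi * xcoord x i)]); first exact: goodU.
apply/seteqP; split => x /=; rewrite -cosW -sinW sin_pi_gt0 // cos_pi_lt //.
  rewrite (ltr0_norm c0) => h; have [w0|w0] := ltrP 0 (wrap_torus (xcoord x i)).
    by left.
  by right; rewrite ler0_norm //; lra.
rewrite (ltr0_norm c0) => -[h|]; first lra.
by rewrite ltr_norml => /andP[]; lra.
Qed.

Lemma good_sigma (C : set (set (Rd d R))) (f : Rd d R -> Rd d R) :
  (forall B, C B -> good (f @^-1` B)) -> forall B, <<s C >> B -> good (f @^-1` B).
Proof.
move=> hC; apply: smallest_sub => //; split.
- by rewrite /= preimage_set0; exact: good0.
- by move=> A /= gA; rewrite setTD preimage_setC; exact: goodC.
- by move=> F /= gF; rewrite preimage_bigcup; exact: good_bigcup.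
Qed.

Definition wrapd : Rd d R -> Rd d R := coord_map (fun=> @wrap_torus R).

Lemma good_wrap_coord i (A : set (measurableTypeR R)) : measurable A ->
  good [set x | A (wrap_torus (xcoord x i))].
Proof.
have -> : (measurable : set (set (measurableTypeR R))) =
    (@RGenOInfty.G R).-sigma.-measurable by exact: RGenOInfty.measurableE.
move: A; apply: smallest_sub => //; first split.
- exact: good0.
- move=> A gA; have := goodC gA; congr good; apply/seteqP; split => x /=.
    by move=> nA; split.
  by case.
- by move=> F gF; have := good_bigcup gF; congr good; apply/seteqP; split.
move=> _ [c ->] /=; have := good_wrap_ray i c; congr good.
by apply/seteqP; split => x /=; rewrite in_itv /= andbT.
Qed.

Lemma good_wrap (B : set (Rd d R)) : measurable B -> good (wrapd @^-1` B).
Proof.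
apply: good_sigma => {}B; rewrite -bigcup_seq /= => -[i _ [A mA <-]].
rewrite setTI; have := good_wrap_coord i mA; congr good.
by apply/seteqP; split => x /=; rewrite /wrapd /coord_map tnth_mktuple.
Qed.

Hypothesis mg : measurable_fun setT g.
Hypothesis gper : forall x, g (wrapd x) = g x.
Hypothesis gcoef : forall l, pair_int (fun x => cos (phase l x)) = 0 /\ pair_int (fun x => sin (phase l x)) = 0.

(** The set where g > 0 and its complement are periodic, so g has integral 0
    against both indicators; hence |g| has integral 0. *)
Lemma real_uniqueness : {ae mu, forall x, D x -> g x = 0}.
Proof.
have a1 : annih (fun=> 1).
  split; first exact: bdd_cst.
  move=> l; have [c1 s1] := gcoef l; split.
    by under eq_fun do rewrite mul1r.
  by under eq_fun do rewrite mul1r.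
have int0 B : measurable B -> (wrapd @^-1` B) = B -> pair_int (\1_B) = 0.
  move=> mB BE; have [_ [_ am]] := good_wrap mB; rewrite BE in am.
  have [_ /(_ (fun=> 0))[h _]] := am _ a1.
  rewrite -[RHS]h; congr pair_int; apply/funext => x.
  rewrite /phase big1 ?mulr0 ?cos0 ?mulr1 //.
  by move=> i _; rewrite mul0r.
pose P := [set x | 0 < g x].
have mP : measurable P.
  have := mg measurableT (measurable_itv `]0, +oo[).
  by rewrite setTI; congr measurable; apply/seteqP; split => x /=;
    rewrite in_itv /= andbT.
have PE : (wrapd @^-1` P) = P by apply/seteqP; split => x; rewrite /P /= gper.
have i1 := int0 P mP PE.
have bP := bdd_indic mP.
have i2 : pair_int (\1_(~` P)) = 0.
  apply: int0; first exact: measurableC.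
  by rewrite -[in RHS]PE preimage_setC.
have e : pair_int (fun x => \1_P x - \1_(~` P) x) = 0.
  by rewrite pair_intB ?i1 ?i2 ?subrr //; apply: bdd_indic; exact: measurableC.
have ge x : g x * (\1_P x - \1_(~` P) x) = `|g x|.
  rewrite !indicE in_setC; case: (boolP (x \in P)) => [/set_mem xP|xP] /=.
    by rewrite subr0 mulr1 ger0_norm // ltW.
  rewrite sub0r mulrN1 ler0_norm // leNgt; apply/negP => h.
  by move/negP: xP; apply; apply/mem_set.
have ia : (\int[mu]_(x in D) `|(EFin \o g) x| = 0)%E.
  have fin : (\int[mu]_(x in D) `|(EFin \o g) x|)%E \is a fin_num.
    by apply: integrable_fin_num => //; exact: integrable_abse.
  rewrite -[LHS]fineK //; congr EFin; rewrite -[RHS]e /pair_int /Rintegral.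
  by congr fine; apply: eq_integral => x _ /=; rewrite ge.
have := ae_eq_integral_abs mu mD (measurable_int _ gi).
move=> [/(_ ia) h _]; apply: filterS h => x hx Dx.
by have := hx Dx => /= -[].
Qed.

End uniqueness.

(** * Fourier coefficients on the torus *)
Section modes.
Variables (R : realType) (d : nat).
Notation mu := (lebesgue_Rd R d).
Notation D := (torus_cube R d).
Implicit Types (l k : 'I_d -> int) (x y : Rd d R) (f g : Rd d R -> R[i]).

Let mD : measurable D. Proof. exact: measurable_torus_cube. Qed.

Lemma mode_phase l x : mode l x = expi (phase l x).
Proof.
rewrite /mode /phase mulr_sumr expi_sum; apply: eq_bigr => i _.
by rewrite mulrA.
Qed.

Definition negfreq l : 'I_d -> int := fun i => - l i.

Lemma phase_opp l x : phase (negfreq l) x = - phase l x.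
Proof.
rewrite /phase -mulrN -sumrN; congr (_ * _); apply: eq_bigr => i _.
by rewrite /negfreq rmorphN mulNr.
Qed.

Lemma modeD l k x : mode l x * mode k x = mode (fun i => l i + k i) x.
Proof.
rewrite /mode -big_split; apply: eq_bigr => i _ /=.
by rewrite -expiD; congr expi; rewrite rmorphD /=; ring.
Qed.

Lemma mode0 x : mode (fun=> 0) x = 1.
Proof. by rewrite /mode big1 // => i _; rewrite mulr0z mulr0 mul0r expi0. Qed.

Lemma normc_mode l x : Normc.normc (mode l x) = 1.
Proof. by rewrite mode_phase normc_expi. Qed.

Lemma cmeas_mode (E : set (Rd d R)) l : cmeas E (mode l).
Proof.
apply: cmeas_prod => i; apply: cmeas_expi; apply: measurable_funTS.
by apply: measurable_funM => //; exact: measurable_xcoord.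
Qed.

Lemma xcoord_wrapd x i : xcoord (wrapd x) i = wrap_torus (xcoord x i).
Proof. by rewrite /wrapd /coord_map xcoord_mk. Qed.

Lemma xcoord_translate (t : 'I_d -> R) x i : xcoord (translate t x) i = xcoord x i - t i.
Proof. by rewrite /translate xcoord_mk. Qed.

Lemma eq_xcoord x y : (forall i, xcoord x i = xcoord y i) -> x = y.
Proof. by move=> h; apply: eq_from_tnth => i; exact: h. Qed.

Lemma mode_wrapd l x : mode l (wrapd x) = mode l x.
Proof.
rewrite /mode; apply: eq_bigr => i _; rewrite xcoord_wrapd.
have [k -> _] := wrap_torusP (xcoord x i).
rewrite mulrBr.
have -> : pi * (l i)%:~R * xcoord x i - pi * (l i)%:~R * (2 * k%:~R) =
  pi * (l i)%:~R * xcoord x i + 2 * pi * (- (l i * k))%:~R.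
  by rewrite rmorphN rmorphM /=; ring.
by rewrite expiD expi_2pi_int mulr1.
Qed.

Lemma torus_extE f x : torus_ext f x = f (wrapd x).
Proof. by []. Qed.

Lemma wrapd_torus x : D (wrapd x).
Proof.
move=> i; rewrite xcoord_wrapd; have := wrap_torus_itv (xcoord x i).
by rewrite /symitv /= in_itv.
Qed.

Lemma measurable_wrapd : measurable_fun setT (@wrapd R d).
Proof. by apply: measurable_coord_map => i; exact: measurable_wrap. Qed.

Lemma cmeas_wrapd f : cmeas D f -> cmeas setT (fun x => f (wrapd x)).
Proof.
move=> mf; apply: (cmeas_comp (h := @wrapd R d) (E := D)) => //.
  by move=> _ [x _ <-]; exact: wrapd_torus.
exact: measurable_wrapd.
Qed.

Lemma wrapd_translate (t : 'I_d -> R) x :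
  coord_map (fun i (s : R) => wrap_torus (s - t i)) x = wrapd (translate t x).
Proof.
by apply: eq_xcoord => i; rewrite xcoord_wrapd xcoord_translate /coord_map xcoord_mk.
Qed.

Lemma wrapd_idem_translate (t : 'I_d -> R) x :
  wrapd (translate t (wrapd x)) = wrapd (translate t x).
Proof.
apply: eq_xcoord => i; rewrite !(xcoord_wrapd, xcoord_translate).
have [k -> _] := wrap_torusP (xcoord x i).
rewrite -[RHS](wrap_torusD _ (- k)); congr wrap_torus; rewrite rmorphN /=; ring.
Qed.

Lemma cint_translate (t : 'I_d -> R) f : L1 D f ->
  L1 D (fun x => f (wrapd (translate t x))) /\
  cintegral D (fun x => f (wrapd (translate t x))) = cintegral D f.
Proof.
rewrite torus_cubeE => lf.
have [l1 e] := cint_change (coord_change_wrap t) lf.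
have E : f \o coord_map (fun i (s : R) => wrap_torus (s - t i)) =
    (fun x => f (wrapd (translate t x))).
  by apply/funext => x /=; rewrite wrapd_translate.
by rewrite E in l1 e; split => //; rewrite e expr1n mul1r.
Qed.

Lemma torus_measure : mu D = (2 ^+ d)%:E.
Proof.
rewrite torus_cubeE box_measure; last by move=> i; exact: measurable_symitv.
have e : (lebesgue_measure (@symitv R) = 2%:E)%E.
  rewrite /symitv lebesgue_measure_itv /= lte_fin ifT; last by lra.
  by rewrite -EFinB; congr EFin; ring.
rewrite (eq_bigr (fun=> 2%:E)); last by move=> i _; exact: e.
rewrite -[X in _ ^+ X](card_ord d) -prodr_const.
by rewrite (big_morph _ (@EFinM _) (erefl _)).
Qed.

Lemma L1_bounded f (M : R) : cmeas D f -> (forall x, D x -> Normc.normc (f x) <= M) ->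
  L1 D f.
Proof.
move=> mf fM; apply: L1_normcP => //.
apply: (@le_integrable _ _ _ mu D mD _ (fun=> M%:E)).
- by apply/measurable_EFinP; exact: measurable_normc.
- move=> x Dx /=; rewrite lee_fin ger0_norm ?normc_ge0 //.
  by apply: (le_trans (fM x Dx)); exact: ler_norm.
apply/integrableP; split => //.
rewrite (eq_integral (cst (`|M|%:E))) // integral_cst //.
by rewrite [X in (_ * X)%E](_ : _ = (2 ^+ d)%:E) -?EFinM ?ltry //; exact: torus_measure.
Qed.

Lemma L1_mode l : L1 D (mode l).
Proof.
by apply: (@L1_bounded _ 1); [exact: cmeas_mode|move=> x _; rewrite normc_mode].
Qed.

Lemma L1_mul_mode (E : set (Rd d R)) f l : measurable E -> L1 E f ->
  L1 E (fun x => f x * mode l x).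
Proof.
move=> mE lf; apply: (@L1_mulb _ _ _ _ _ 1) => //; first exact: cmeas_mode.
by move=> x _; rewrite normc_mode.
Qed.

(** Translation by 1 / l_i in a coordinate with l_i != 0 changes the sign of the
    mode. *)
Lemma cint_mode l : cintegral D (mode l) =
  if [forall i, l i == 0] then (2 ^+ d)%:C else 0.
Proof.
case: forallP => [l0|nl].
  rewrite (@eq_cint _ _ _ _ (fun=> 1)); last first.
    by move=> x _; rewrite -(mode0 x); congr (mode _ x); apply/funext => i; exact/eqP.
  rewrite /cintegral /Rintegral; apply: complexP => /=.
    rewrite integral_cst // mul1e [X in fine X](_ : _ = (2 ^+ d)%:E) //.
    exact: torus_measure.
  by rewrite integral0.
have [i li] : exists i, l i != 0.
  by apply/existsP; rewrite -negb_forall; apply/negP => /forallP h; apply: nl.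
pose t j : R := if j == i then (l i)%:~R^-1 else 0.
have [_ e] := cint_translate t (L1_mode l).
have lR : (l i)%:~R != 0 :> R by rewrite intr_eq0.
have E : (fun x => mode l (wrapd (translate t x))) = (fun x => -1 * mode l x).
  apply/funext => x; rewrite mode_wrapd mode_translate; congr (_ * _).
  rewrite (bigD1 i) //= big1 ?mulr1; last first.
    by move=> j /negPf ji; rewrite /t ji mulr0 oppr0 expi0.
  rewrite /t eqxx mulfK // /expi cosN cospi sinN sinpi oppr0.
  by apply: complexP => //=; rewrite oppr0.
rewrite E cintZ // in e; last exact: L1_mode.
have : cintegral D (mode l) *+ 2 = 0 by rewrite mulr2n -{1}e mulN1r addNr.
by move/eqP; rewrite mulrn_eq0 /= => /eqP.
Qed.

(** Not normalized: 2^d times the usual Fourier coefficient. *)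
Definition fcoef f l : R[i] := cintegral D (fun x => f x * mode (negfreq l) x).

Lemma box_idx_surj (N : nat) l : (forall i, `|l i| <= N%:Z) ->
  exists b : {ffun 'I_d -> 'I_(N.*2.+1)}, box_idx b = l.
Proof.
move=> lN; exists [ffun i => inord (absz (l i + N%:Z)%R)].
apply/funext => i; rewrite /box_idx ffunE.
by have := lN i => h; rewrite inordK; lia.
Qed.

Lemma box_idx_inj (N : nat) : injective (@box_idx d N).
Proof.
move=> b c e; apply/ffunP => i; apply/val_inj => /=.
have := congr1 (fun l => l i) e; rewrite /box_idx; lia.
Qed.

Lemma cmeas_trig_sum (E : set (Rd d R)) N b : cmeas E (@trig_sum R d N b).
Proof.
apply: cmeas_sum => c; apply: cmeasM; [exact: cmeas_cst|exact: cmeas_mode].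
Qed.

Lemma L1_trig_sum N b : L1 D (@trig_sum R d N b).
Proof. by apply: L1_sum => // c; apply: L1Z => //; exact: L1_mode. Qed.

Lemma fcoef_trig_sum N b l : (forall k, b k != 0 -> forall i, `|k i| <= N%:Z) ->
  fcoef (trig_sum N b) l = (2 ^+ d)%:C * b l.
Proof.
move=> bN; rewrite /fcoef /trig_sum.
rewrite (@eq_cint _ _ _ _ (fun x => \sum_(c : {ffun 'I_d -> 'I_(N.*2.+1)})
   b (box_idx c) * mode (fun i => box_idx c i + negfreq l i) x)); last first.
  by move=> x _; rewrite mulr_suml; apply: eq_bigr => c _; rewrite -mulrA modeD.
rewrite cint_sum //; last by move=> c; apply: L1Z => //; exact: L1_mode.
have E (c : {ffun 'I_d -> 'I_(N.*2.+1)}) : cintegral D (fun x => b (@box_idx d N c) * mode (fun i => box_idx c i + negfreq l i) x)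
    = b (box_idx c) * (if [forall i, box_idx c i + negfreq l i == 0] then (2 ^+ d)%:C else 0).
  by rewrite cintZ //; [rewrite cint_mode|exact: L1_mode].
rewrite (eq_bigr _ (fun c _ => E c)).
have eqE (c : {ffun 'I_d -> 'I_(N.*2.+1)}) : [forall i, @box_idx d N c i + negfreq l i == 0] -> box_idx c = l.
  by move=> /forallP h; apply/funext => i; apply/eqP; rewrite -subr_eq0; exact: h.
have [bl|bl] := eqVneq (b l) 0.
  rewrite bl mulr0 big1 // => c _; case: ifP => [/eqE ->|_]; last by rewrite mulr0.
  by rewrite bl mul0r.
have [c fl] := box_idx_surj (bN l bl).
rewrite (bigD1 c) //= big1 ?addr0; last first.
  move=> c2 ne; case: ifP => [/eqE h|_]; last by rewrite mulr0.
  by move/eqP: ne; case; apply: box_idx_inj; rewrite h fl.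
rewrite fl; have -> : [forall i, l i + negfreq l i == 0] = true.
  by apply/forallP => i; rewrite /negfreq subrr.
by rewrite [RHS]mulrC.
Qed.

Lemma expi_addN (t : R) : expi t + expi (- t) = 2 * (cos t)%:C.
Proof.
rewrite /expi cosN sinN mulr_natl mulr2n; apply: complexP => /=; first by [].
by rewrite subrr addr0.
Qed.

Lemma expi_subN (t : R) : expi t - expi (- t) = 2 * 'i * (sin t)%:C.
Proof.
rewrite /expi cosN sinN -mulrA mulr_natl mulr2n; apply: complexP => /=.
  by rewrite subrr mul0r mulr0 subr0 addr0.
by rewrite opprK mul0r mul1r add0r.
Qed.

Lemma fourier_uniqueness f : L1 D f -> (forall x, f (wrapd x) = f x) ->
  (forall l, fcoef f l = 0) -> {ae mu, forall x, D x -> f x = 0}.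
Proof.
move=> lf fper f0; have [f1 f2] := lf.
have mf : cmeas setT f.
  rewrite (_ : f = fun x => f (wrapd x)); last by apply/funext => x; rewrite fper.
  by apply: cmeas_wrapd; exact: L1_cmeas.
have z l : cintegral D (fun x => f x * mode l x) = 0.
  by have := f0 (negfreq l); rewrite /fcoef (_ : negfreq (negfreq l) = l) //;
    apply/funext => i; rewrite /negfreq opprK.
have c0 l : cintegral D (fun x => f x * (cos (phase l x))%:C) = 0.
  have h : cintegral D (fun x => f x * mode l x + f x * mode (negfreq l) x) = 0.
    by rewrite cintD ?z ?addr0 //; exact: L1_mul_mode.
  have := congr1 (fun w => 2^-1 * w) h; rewrite /= mulr0 -cintZ //; last first.
    by apply: L1D => //; exact: L1_mul_mode.
  move=> <-; apply: eq_cint => x _.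
  rewrite !mode_phase phase_opp -mulrDr mulrCA; congr (_ * _).
  by rewrite expi_addN mulrA mulVf ?mul1r ?pnatr_eq0.
have s0 l : cintegral D (fun x => f x * (sin (phase l x))%:C) = 0.
  have h : cintegral D (fun x => f x * mode l x + -1 * (f x * mode (negfreq l) x)) = 0.
    by rewrite cintD ?cintZ ?z ?mulr0 ?addr0 //; try apply: L1Z => //; exact: L1_mul_mode.
  have := congr1 (fun w => (2 * 'i)^-1 * w) h; rewrite /= mulr0 -cintZ //; last first.
    by apply: L1D => //; [|apply: L1Z => //]; exact: L1_mul_mode.
  move=> <-; apply: eq_cint => x _.
  rewrite !mode_phase phase_opp mulN1r -mulrBr mulrCA; congr (_ * _).
  have i0 : 2 * 'i != 0 :> R[i].
    by rewrite mulf_neq0 ?pnatr_eq0 // eq_complex /= negb_and oner_eq0 orbT.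
  by rewrite expi_subN mulrA mulVf ?mul1r.
have pr : {ae mu, forall x, D x -> complex.Re (f x) = 0}.
  apply: real_uniqueness => //; [exact: mf.1|by move=> x; rewrite fper|].
  move=> l; split.
    have := congr1 (@complex.Re R) (c0 l); rewrite /= /pair_int => <-.
    by apply: eq_Rintegral => x _; rewrite cReM /= mulr0 subr0.
  have := congr1 (@complex.Re R) (s0 l); rewrite /= /pair_int => <-.
  by apply: eq_Rintegral => x _; rewrite cReM /= mulr0 subr0.
have pi' : {ae mu, forall x, D x -> complex.Im (f x) = 0}.
  apply: real_uniqueness => //; [exact: mf.2|by move=> x; rewrite fper|].
  move=> l; split.
    have := congr1 (@complex.Im R) (c0 l); rewrite /= /pair_int => <-.
    by apply: eq_Rintegral => x _; rewrite cImM /= mulr0 add0r.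
  have := congr1 (@complex.Im R) (s0 l); rewrite /= /pair_int => <-.
  by apply: eq_Rintegral => x _; rewrite cImM /= mulr0 add0r.
by apply: filterS2 pr pi' => x h1 h2 Dx; apply: complexP; [exact: h1|exact: h2].
Qed.

End modes.

(** * Convolution with an integrable kernel *)
Section complex_fubini.
Variables (R : realType) (d : nat).
Notation mu := (lebesgue_Rd R d).
Notation RR := (Rd d R * Rd d R)%type.

Section real.
Variable k : RR -> R.
Hypothesis ki : (mu \x mu)%E.-integrable setT (EFin \o k).

Let F x : \bar R := (\int[mu]_y (k (x, y))%:E)%E.
Let G y : \bar R := (\int[mu]_x (k (x, y))%:E)%E.

Let Fi : mu.-integrable setT F.
Proof. exact: (integrable_fubini_F ki). Qed.

Let mF : measurable_fun setT F. Proof. exact: measurable_int Fi. Qed.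
Let mG : measurable_fun setT G.
Proof. exact: (measurable_fubini_G ki). Qed.

Lemma fine_section_integrable : mu.-integrable setT (fun x => (\int[mu]_y k (x, y))%:E).
Proof.
apply: (@le_integrable _ _ _ mu setT measurableT _ F) => //.
  apply/measurable_EFinP; exact: measurableT_comp.
move=> x _; rewrite /F /Rintegral.
by case: (integral _ _ _) => [r| |] //=; rewrite ?normr0 ?leey.
Qed.

(** The inner integrals are finite for almost all values of the outer variable
    only, and are given a default value at the others; the equality is
    therefore derived from its extended-real form. *)
Lemma real_fubini : \int[mu]_x (\int[mu]_y k (x, y)) = \int[mu]_y (\int[mu]_x k (x, y)).
Proof.
have e1 : (\int[mu]_x (\int[mu]_y k (x, y))%:E = \int[mu]_x F x)%E.
  apply: ae_eq_integral => //.
    apply/measurable_EFinP; exact: measurableT_comp.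
  have := integrable_ae measurableT Fi; apply: filterS => x h _.
  by rewrite /Rintegral fineK //; exact: h.
have Gi : mu.-integrable setT G.
  apply/integrableP; split => //.
  have /integrableP[mk koo] := ki.
  apply: (@le_lt_trans _ _ (\int[mu]_y \int[mu]_x `|(k (x, y))%:E|)%E).
    apply: ge0_le_integral => //.
    - exact: measurableT_comp.
    - apply: (measurable_fun_fubini_tonelli_G (abse \o (EFin \o k))) => //=.
      exact: measurableT_comp.
    - move=> y _; apply: le_abse_integral => //.
      by apply: (measurableT_comp mk); exact: measurable_fun_pair.
  exact: ((@integrable21ltyP _ _ _ _ R mu mu _ mk).1 ki).
have e2 : (\int[mu]_y (\int[mu]_x k (x, y))%:E = \int[mu]_y G y)%E.
  apply: ae_eq_integral => //.
    apply/measurable_EFinP; exact: measurableT_comp.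
  have := integrable_ae measurableT Gi; apply: filterS => x h _.
  by rewrite /Rintegral fineK //; exact: h.
rewrite {1}/Rintegral e1 [RHS]/Rintegral e2; congr fine.
exact: (Fubini ki).
Qed.

End real.

Variable K : RR -> R[i].
Hypothesis mK : cmeas setT K.
Hypothesis Koo : (\int[mu]_y \int[mu]_x (Normc.normc (K (x, y)))%:E < +oo)%E.

Let Kn : (mu \x mu)%E.-integrable setT (fun z => (Normc.normc (K z))%:E).
Proof.
apply/integrable21ltyP.
  by apply/measurable_EFinP; exact: measurable_normc.
apply: le_lt_trans Koo; rewrite le_eqVlt; apply/orP; left; apply/eqP.
apply: eq_integral => y _; apply: eq_integral => x _ /=.
by rewrite ger0_norm // normc_ge0.
Qed.

Let KRe : (mu \x mu)%E.-integrable setT (EFin \o (fun z => complex.Re (K z))).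
Proof.
apply: le_integrable Kn => //; first by apply/measurable_EFinP; exact: mK.1.
by move=> z _ /=; rewrite lee_fin [leRHS]ger0_norm ?normc_ge0 // Re_le_normc.
Qed.

Let KIm : (mu \x mu)%E.-integrable setT (EFin \o (fun z => complex.Im (K z))).
Proof.
apply: le_integrable Kn => //; first by apply/measurable_EFinP; exact: mK.2.
by move=> z _ /=; rewrite lee_fin [leRHS]ger0_norm ?normc_ge0 // Im_le_normc.
Qed.

Lemma fubini_L1 : L1 setT (fun x => cintegral setT (fun y => K (x, y))).
Proof.
split.
  exact: (fine_section_integrable KRe).
exact: (fine_section_integrable KIm).
Qed.

Lemma fubini_ae_L1 : {ae mu, forall x, L1 setT (fun y => K (x, y))}.
Proof.
have h1 := ae_integrable1 KRe; have h2 := ae_integrable1 KIm.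
by apply: filterS2 h1 h2 => x h1 h2; split.
Qed.

Lemma complex_fubini :
  cintegral setT (fun x => cintegral setT (fun y => K (x, y))) =
  cintegral setT (fun y => cintegral setT (fun x => K (x, y))).
Proof.
rewrite /cintegral; apply: complexP => /=.
  exact: (real_fubini KRe).
exact: (real_fubini KIm).
Qed.

End complex_fubini.

Section cint_ae.
Variables (R : realType) (d : nat).

Lemma cint_ae (D : set (Rd d R)) (f g : Rd d R -> R[i]) : measurable D ->
  L1 D f -> L1 D g -> ae_eq_on D f g -> cintegral D f = cintegral D g.
Proof.
move=> mD [f1 f2] [g1 g2] fg; rewrite /cintegral /Rintegral; congr (fine _ +i* fine _).
  apply: ae_eq_integral => //; [exact: measurable_int f1|exact: measurable_int g1|].
  by apply: filterS fg => x h Dx; rewrite h.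
apply: ae_eq_integral => //; [exact: measurable_int f2|exact: measurable_int g2|].
by apply: filterS fg => x h Dx; rewrite h.
Qed.

End cint_ae.

Section convolution.
Variables (R : realType) (d : nat).
Notation mu := (lebesgue_Rd R d).
Notation D := (torus_cube R d).
Variables (Psi f : Rd d R -> R[i]).
Hypothesis PsiL : L1 setT Psi.
Hypothesis fL : L1 D f.

Let mD : measurable D. Proof. exact: measurable_torus_cube. Qed.
Let mPsi : cmeas setT Psi. Proof. exact: L1_cmeas. Qed.
Let mf : cmeas D f. Proof. exact: L1_cmeas. Qed.
Let F := torus_ext f.
Let G := convolution Psi F.

Let mF : cmeas setT F. Proof. exact: cmeas_wrapd. Qed.

Let sub (x y : Rd d R) : Rd d R := translate (xcoord y) x.

Lemma convolutionE x : G x = cintegral setT (fun y => Psi y * F (sub x y)).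
Proof. by []. Qed.

Lemma measurable_sub : measurable_fun [set: Rd d R * Rd d R] (fun z => sub z.1 z.2).
Proof.
apply/measurable_fun_tnthP => i.
rewrite (_ : _ \o _ = (fun z : Rd d R * Rd d R => xcoord z.1 i - xcoord z.2 i)).
  apply: measurable_funB; apply: (measurableT_comp (measurable_xcoord i)) => //.
by apply/funext => z /=; rewrite /sub /translate tnth_mktuple.
Qed.

Lemma convolution_wrapd x : G (wrapd x) = G x.
Proof.
rewrite !convolutionE; apply: eq_cint => y _; congr (_ * _).
by rewrite /F !torus_extE /sub wrapd_idem_translate.
Qed.

Section double_integral.
Variable l : 'I_d -> int.

(** Integrand of the Fourier coefficient of the convolution as a double integral,
    set to 0 for x outside the torus so that both variables range over R^d. *)
Let K (z : Rd d R * Rd d R) : R[i] :=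
  if z.1 \in D then Psi z.2 * F (sub z.1 z.2) * mode l z.1 else 0.

Let KE x : x \in D -> forall y, K (x, y) = Psi y * F (sub x y) * mode l x.
Proof. by move=> xD y; rewrite /K /= xD. Qed.

Let K0 x : x \notin D -> forall y, K (x, y) = 0.
Proof. by move=> /negPf xD y; rewrite /K /= xD. Qed.

Let mK : cmeas setT K.
Proof.
have m1 : cmeas setT (fun z : Rd d R * Rd d R => Psi z.2 * F (sub z.1 z.2) * mode l z.1).
  apply: cmeasM; first apply: cmeasM.
  - by apply: (cmeas_comp (E := setT)) => //; exact: mPsi.
  - apply: (cmeas_comp (E := setT) (h := fun z => sub z.1 z.2)) => //.
    exact: measurable_sub.
  - apply: (cmeas_comp (E := setT)) => //; exact: cmeas_mode.
have mD2 : measurable (D `*` [set: Rd d R]) by exact: measurableX.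
have := cmeas_restrict mD2 (cmeas_sub measurableT (@subsetT _ _) m1).
congr (cmeas _ _); apply/funext => -[x y]; rewrite /K /=.
congr (if _ then _ else _); apply/idP/idP => /set_mem; last by move=> Dx; apply/mem_set.
by case=> Dx _; exact/mem_set.
Qed.

Let inner y : (\int[mu]_x (Normc.normc (K (x, y)))%:E =
   (Normc.normc (Psi y))%:E * \int[mu]_(x in D) (Normc.normc (f x))%:E)%E.
Proof.
have mfn : measurable_fun D (fun x => (Normc.normc (f x))%:E).
  by apply/measurable_EFinP; exact: measurable_normc.
have -> : (\int[mu]_(x in D) (Normc.normc (f x))%:E =
   \int[mu]_(x in D) (Normc.normc (F (sub x y)))%:E)%E.
  rewrite torus_cubeE in mfn *.
  have [c0 mD' mE mT [DT Doo DTE]] := coord_change_wrap (xcoord y).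
  have := ge0_change c0 mD' mE mT DT Doo DTE (f := fun x => (Normc.normc (f x))%:E) mfn.
  rewrite expr1n mul1e => <-.
    by apply: eq_integral => x _; rewrite wrapd_translate.
  by move=> x _; rewrite lee_fin normc_ge0.
rewrite -ge0_integralZl //; last first.
- by rewrite lee_fin normc_ge0.
- by move=> x _; rewrite lee_fin normc_ge0.
- apply/measurable_EFinP; apply: measurable_normc.
  apply: (cmeas_comp (E := setT) (h := fun x => sub x y)) => //.
  apply: measurable_funTS.
  apply: (@measurable_coord_map R d (fun i s => s - xcoord y i)) => i.
  exact: measurable_funB.
rewrite [RHS]integral_mkcond; apply: eq_integral => x _.
rewrite patchE; case: ifPn => xD.
  by rewrite KE // !Normc.normcM normc_mode mulr1 EFinM.
by rewrite K0 // Normc.normc0.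
Qed.

Let Koo : (\int[mu]_y \int[mu]_x (Normc.normc (K (x, y)))%:E < +oo)%E.
Proof.
under eq_integral do rewrite inner.
have /integrableP[mP Poo] := L1_normc measurableT PsiL.
have /integrableP[mfn foo] := L1_normc mD fL.
rewrite ge0_integralZr //; last 2 first.
- by move=> x _; rewrite lee_fin normc_ge0.
- by apply: integral_ge0 => x _; rewrite lee_fin normc_ge0.
have e1 : (\int[mu]_x (Normc.normc (Psi x))%:E < +oo)%E.
  apply: le_lt_trans Poo; apply: ge0_le_integral => //.
  - by move=> x _; rewrite lee_fin normc_ge0.
  - exact: measurableT_comp.
  - by move=> x _ /=; rewrite lee_fin ler_norm.
have e2 : (\int[mu]_(x in D) (Normc.normc (f x))%:E < +oo)%E.
  apply: le_lt_trans foo; apply: ge0_le_integral => //.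
  - by move=> x _; rewrite lee_fin normc_ge0.
  - exact: measurableT_comp.
  - by move=> x _ /=; rewrite lee_fin ler_norm.
apply: lte_mul_pinfty => //.
  by apply: integral_ge0 => x _; rewrite lee_fin normc_ge0.
rewrite ge0_fin_numE //.
by apply: integral_ge0 => x _; rewrite lee_fin normc_ge0.
Qed.

Let Gl x := cintegral setT (fun y => K (x, y)).

Let GlE : {ae mu, forall x, Gl x = if x \in D then G x * mode l x else 0}.
Proof.
have := fubini_ae_L1 mK Koo; apply: filterS => x lx; rewrite /Gl.
case: ifPn => xD; last first.
  by rewrite (@eq_cint _ _ _ _ (fun=> 0)) ?cint0 // => y _; rewrite K0.
have m1 : mode l x != 0.
  apply/eqP => h; have := @normc_mode R d l x; rewrite h Normc.normc0 => /eqP.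
  by rewrite eq_sym oner_eq0.
rewrite convolutionE mulrC -cintZ //.
  by apply: eq_cint => y _; rewrite KE // mulrC.
have := L1Z (mode l x)^-1 measurableT lx; congr (L1 _ _).
by apply/funext => y; rewrite KE // mulrC mulfK.
Qed.

Let GlL : L1 setT Gl. Proof. exact: (fubini_L1 mK Koo). Qed.

Let cint_Gl : cintegral D Gl = cintegral setT (fun y => Psi y * mode l y) *
                  cintegral D (fun x => f x * mode l x).
Proof.
have -> : cintegral D Gl = cintegral setT Gl.
  rewrite /cintegral; congr (_ +i* _); rewrite Rintegral_mkcond;
    apply: eq_Rintegral => x _; rewrite patchE; case: ifPn => // xD;
    by rewrite /Gl (@eq_cint _ _ _ _ (fun=> 0)) ?cint0 // => y _; rewrite K0.
rewrite /Gl (complex_fubini mK Koo).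
set c := cintegral D (fun x => f x * mode l x).
rewrite [RHS]mulrC -cintZ //; last exact: L1_mul_mode.
apply: eq_cint => y _.
have lfl := L1_mul_mode l mD fL.
have [lt et] := cint_translate (xcoord y) lfl.
have E x : K (x, y) = if x \in D then (Psi y * mode l y) *
    (f (wrapd (sub x y)) * mode l (wrapd (sub x y))) else 0.
  rewrite /K /=; case: ifP => // _.
  rewrite mode_wrapd /sub mode_translate /F torus_extE.
  have e1 : mode l y * (\prod_(i < d) expi (- (pi * (l i)%:~R * xcoord y i))) = 1.
    rewrite /mode -big_split big1 // => i _ /=.
    by rewrite -expiD subrr expi0.
  set a := f _; set P := \prod_(i < d) _ in e1 *; set m := mode l x.
  by transitivity (mode l y * P * (Psi y * a * m)); [rewrite e1 mul1r|ring].
have -> : cintegral setT (fun x => K (x, y)) = cintegral D (fun x => (Psi y * mode l y) *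
    (f (wrapd (sub x y)) * mode l (wrapd (sub x y)))).
  rewrite /cintegral; congr (_ +i* _); rewrite [RHS]Rintegral_mkcond;
    apply: eq_Rintegral => x _; rewrite patchE E; by case: ifP.
by rewrite cintZ // -[c]et mulrC.
Qed.

(** The integral of the kernel over x is translation invariant, which gives
    integrability by Tonelli's theorem and the product formula by Fubini's.
    [H] agrees with [G] times the mode only where the inner integral exists;
    for the constant mode it agrees everywhere, so that [G] is measurable. *)
Lemma convolution_mode_L1 : exists2 H, L1 D H &
  [/\ ae_eq_on D H (fun x => G x * mode l x),
    cintegral D H = cintegral setT (fun y => Psi y * mode l y) *
                  cintegral D (fun x => f x * mode l x) &
    (forall x : Rd d R, mode l x = 1) -> forall x, D x -> H x = G x].
Proof.
exists Gl; first exact: L1_subset GlL.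
split.
- by apply: filterS GlE => x -> Dx; rewrite ifT //; exact: mem_set.
- exact: cint_Gl.
- move=> m1 x /mem_set xD; rewrite /Gl convolutionE; apply: eq_cint => y _.
  by rewrite KE // m1 mulr1.
Qed.

End double_integral.

Lemma convolution_L1 : L1 D G.
Proof.
have [H HL [_ _ HG]] := convolution_mode_L1 (fun=> 0).
have e x : D x -> H x = G x by apply: HG => z; exact: mode0.
have [h1 h2] := HL; split.
  by apply: eq_integrable h1 => // x /set_mem Dx; rewrite e.
by apply: eq_integrable h2 => // x /set_mem Dx; rewrite e.
Qed.

Lemma cint_convolution l : cintegral D (fun x => G x * mode l x) =
  cintegral setT (fun y => Psi y * mode l y) * cintegral D (fun x => f x * mode l x).
Proof.
have [H HL [HG <- _]] := convolution_mode_L1 l.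
apply: cint_ae => //; first by apply: L1_mul_mode => //; exact: convolution_L1.
by apply: filterS HG => x h Dx; rewrite h.
Qed.

(** The frequency of the mode l in the normalization of [fourier], since
    pi l x = 2 pi (l/2) x. *)
Definition half_freq (l : 'I_d -> int) : Rd d R :=
  [tuple (2^-1 * (l i)%:~R : measurableTypeR R) | i < d].

Lemma fcoef_convolution l : fcoef G l = fourier Psi (half_freq l) * fcoef f l.
Proof.
rewrite /fcoef cint_convolution; congr (_ * _); rewrite /fourier.
apply: eq_cint => y _; congr (_ * _); rewrite mode_phase phase_opp /phase; congr expi.
congr (- _); rewrite !mulr_sumr; apply: eq_bigr => i _.
by rewrite /half_freq xcoord_mk; field.
Qed.

(** Both sides are integrable and periodic, and have the same Fourier
    coefficients. *)
Theorem convolution_trig (N : nat) (b : ('I_d -> int) -> R[i]) :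
  (forall l, fourier Psi (half_freq l) = b l) ->
  (forall l, b l != 0 -> forall i, `|l i| <= N%:Z) ->
  ae_eq_on D G (trig_sum N (fun l => b l * ((2 ^- d)%:C * fcoef f l))).
Proof.
move=> Pb bN.
pose TS := @trig_sum R d N (fun l => b l * ((2 ^- d)%:C * fcoef f l)).
have LG := convolution_L1.
have LT : L1 D TS by exact: L1_trig_sum.
have p2 : (2 ^+ d)%:C * (2 ^- d)%:C = 1 :> R[i].
  by rewrite -rmorphM /= mulfV ?rmorph1 // expf_neq0 // pnatr_eq0.
have Ldiff : L1 D (fun x => G x + -1 * TS x) by apply: L1D => //; exact: L1Z.
have per x : G (wrapd x) + -1 * TS (wrapd x) = G x + -1 * TS x.
  rewrite convolution_wrapd; congr (_ + _ * _); apply: eq_bigr => c _.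
  by rewrite mode_wrapd.
have := fourier_uniqueness Ldiff per; move=> h.
have {}h := h _.
have : {ae mu, forall x, D x -> G x + -1 * TS x = 0}.
  apply: h => l; rewrite /fcoef.
  rewrite (@eq_cint _ _ _ _ (fun x => G x * mode (negfreq l) x +
     -1 * (TS x * mode (negfreq l) x))); last by move=> x _; rewrite mulrDl mulrA.
  rewrite cintD ?cintZ //; try (apply: L1_mul_mode => //); last first.
    by apply: L1Z => //; exact: L1_mul_mode.
  have := fcoef_convolution l; rewrite /fcoef => ->.
  have := @fcoef_trig_sum R d N (fun l => b l * ((2 ^- d)%:C * fcoef f l)) l.
  rewrite /fcoef -/TS => ->; last first.
    by move=> k hk; apply: bN; apply: contraNneq hk => ->; rewrite mul0r.
  rewrite Pb; set A := cintegral _ _.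
  transitivity (b l * A - (2 ^+ d)%:C * (2 ^- d)%:C * (b l * A)); first by ring.
  by rewrite p2 mul1r subrr.
apply: filterS => x hx Dx; apply/eqP; rewrite -subr_eq0 -mulN1r; apply/eqP.
exact: hx.
Qed.

End convolution.

(** * Integrability of Schwartz functions *)
Section tensor_integral.
Variable R : realType.

Lemma integral_tensor (d : nat) (h : R -> R) : measurable_fun setT h ->
  (forall t, 0 <= h t) ->
  (\int[lebesgue_Rd R d]_x (\prod_(i < d) h (xcoord x i))%:E =
   (\int[lebesgue_measure]_t (h t)%:E) ^+ d)%E.
Proof.
move=> mh h0; elim: d => [|d IH].
  rewrite expe0; under eq_integral do rewrite big_ord0.
  by rewrite integral_cst //= diracT mul1e.
set mu1 := lebesgue_Rd R d in IH *.
have mprod (n : nat) : measurable_fun setT (fun x : Rd n R => (\prod_(i < n) h (xcoord x i))%:E).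
  apply/measurable_EFinP; apply: measurable_prod => i _.
  by apply: (measurableT_comp mh); exact: measurable_xcoord.
have prod0 (n : nat) (x : Rd n R) : (0 <= (\prod_(i < n) h (xcoord x i))%:E)%E.
  by rewrite lee_fin; apply: prodr_ge0.
transitivity (\int[pushforward (@lebesgue_measure R \x mu1)%E (@consRd R d)]_x
   (\prod_(i < d.+1) h (xcoord x i))%:E)%E; first by [].
rewrite (ge0_integral_pushforward (@measurable_consRd R d)); last 3 first.
- exact: measurableT.
- exact: mprod.
- by move=> x _; exact: prod0.
rewrite preimage_setT.
have E (z : measurableTypeR R * Rd d R) :
    (\prod_(i < d.+1) h (xcoord (consRd z) i))%:E =
    ((h z.1)%:E * (\prod_(i < d) h (xcoord z.2 i))%:E)%E.
  rewrite big_ord_recl -EFinM; congr EFin; congr (_ * _).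
  by apply: eq_bigr => i _; rewrite /xcoord tnthS.
under eq_integral => z _ do rewrite /comp E.
have mz : measurable_fun setT (fun z : measurableTypeR R * Rd d R =>
    ((h z.1)%:E * (\prod_(i < d) h (xcoord z.2 i))%:E)%E).
  apply: emeasurable_funM.
    by apply/measurable_EFinP; exact: (measurableT_comp mh measurable_fst).
  exact: (measurableT_comp (mprod d) measurable_snd).
rewrite fubini_tonelli1 //; last first.
  by move=> z; rewrite mule_ge0 ?lee_fin ?h0 // prodr_ge0.
have inner (x : R) : (\int[mu1]_y ((h x)%:E * (\prod_(i < d) h (xcoord y i))%:E) =
    (h x)%:E * (\int[lebesgue_measure]_t (h t)%:E) ^+ d)%E.
  by rewrite ge0_integralZl ?IH ?lee_fin //; exact: mprod.
transitivity (\int[@lebesgue_measure R]_x ((h x)%:E *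
    (\int[lebesgue_measure]_t (h t)%:E) ^+ d))%E.
  by apply: eq_integral => x _; exact: inner.
rewrite ge0_integralZr //.
- by rewrite expeS.
- by apply/measurable_EFinP.
- by move=> x _; rewrite lee_fin.
by apply: expe_ge0; apply: integral_ge0 => x _; rewrite lee_fin.
Qed.

Lemma integral_oneDsqr_lty :
  (\int[@lebesgue_measure R]_t ((oneDsqr t)^-1)%:E < +oo)%E.
Proof.
rewrite (@ge0_symfun_integralT R (fun t => (oneDsqr t)^-1)).
- have -> : [set x : R | 0 <= x] = `[0, +oo[%classic.
    by apply/seteqP; split => x /=; rewrite in_itv /= andbT.
  by rewrite integral0y_oneDsqr -EFinM ltry.
- by move=> x; rewrite invr_ge0.
- exact: continuous_oneDsqrV.
- by move=> x /=; rewrite /oneDsqr sqrrN.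
Qed.

End tensor_integral.

Section schwartz_functions.
Variables (R : realType) (d : nat).
Notation mu := (lebesgue_Rd R d).
Implicit Types (x y : Rd d R).
Variable f : Rd d R -> R.
Hypothesis fS : rschwartz f.

Lemma xcoord_update x i t j : xcoord (update_coord x i t) j = if j == i then t else xcoord x j.
Proof. by rewrite /update_coord xcoord_mk. Qed.

Lemma update_update x i t s : update_coord (update_coord x i t) i s = update_coord x i s.
Proof.
by apply: eq_xcoord => j; rewrite !xcoord_update; case: eqP.
Qed.

Lemma update_id x i : update_coord x i (xcoord x i) = x.
Proof. by apply: eq_xcoord => j; rewrite xcoord_update; case: eqP => // ->. Qed.

Lemma schwartz_coord_lipschitz i : exists2 C : R, 0 <= C & forall x t,
  `|f (update_coord x i t) - f x| <= C * `|t - xcoord x i|.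
Proof.
have [der bnd] := fS.
have [C HC] := bnd [tuple of nseq d 0%N] [:: i].
have HC' x : `|partial i f x| <= C.
  have := HC x; rewrite /partials /= big1 ?mul1r //.
  by move=> j _; rewrite tnth_nseq expr0.
have C0 : 0 <= C by apply: le_trans (HC' [tuple (0 : measurableTypeR R) | _ < d]).
exists C => // x t.
pose g s := f (update_coord x i s).
have dg s : is_derive s (1 : R) g (partial i f (update_coord x i s)).
  have := der [::] i (update_coord x i s).
  rewrite /= xcoord_update eqxx.
  have -> : (fun t0 => f (update_coord (update_coord x i s) i t0)) = g.
    by apply/funext => s'; rewrite update_update.
  move=> dgs; rewrite /partial xcoord_update eqxx.
  have -> : (fun t0 => f (update_coord (update_coord x i s) i t0)) = g.
    by apply/funext => s'; rewrite update_update.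
  by rewrite derive1E; exact: DeriveDef.
have mvt a b : a <= b -> `|g b - g a| <= C * `|b - a|.
  move=> ab.
  have der' s : s \in `]a, b[ -> is_derive s (1 : R) g (partial i f (update_coord x i s)).
    by move=> _; exact: dg.
  have cont : {within `[a, b], continuous g}.
    apply: continuous_subspaceT => s.
    by apply: differentiable_continuous; apply/derivable1_diffP; have [] := dg s.
  have [c _ ->] := MVT_segment ab der' cont.
  by rewrite normrM ler_wpM2r.
have -> : f x = g (xcoord x i) by rewrite /g update_id.
rewrite -/(g t).
have [h|/ltW h] := leP (xcoord x i) t; first exact: mvt.
by rewrite distrC [`|t - _|]distrC; exact: mvt.
Qed.

(** The partial derivatives are bounded; move from y to x one coordinate at a
    time. *)
Lemma schwartz_lipschitz : exists2 C : R, 0 <= C & forall x y,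
  `|f x - f y| <= C * \sum_(i < d) `|xcoord x i - xcoord y i|.
Proof.
have /fin_all_exists2[Ci Ci0 HCi] := schwartz_coord_lipschitz.
pose C := \sum_i Ci i.
have CiC i : Ci i <= C by rewrite /C (bigD1 i) //= lerDl sumr_ge0.
exists C => [|x y]; first by rewrite sumr_ge0.
(* z n agrees with x on the first n coordinates and with y on the others *)
pose z n : Rd d R := [tuple (if (i < n)%N then xcoord x i else xcoord y i : measurableTypeR R) | i < d].
have zE n i : xcoord (z n) i = if (i < n)%N then xcoord x i else xcoord y i.
  by rewrite xcoord_mk.
have z0 : z 0%N = y by apply: eq_xcoord => i; rewrite zE.
have zd : z d = x by apply: eq_xcoord => i; rewrite zE ltn_ord.
have step n : (n <= d)%N -> `|f (z n) - f y| <=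
    C * \sum_(i < d | (i < n)%N) `|xcoord x i - xcoord y i|.
  elim: n => [|n IH] nd.
    by rewrite z0 subrr normr0 mulr_ge0 ?sumr_ge0.
  pose i := Ordinal nd.
  have -> : z n.+1 = update_coord (z n) i (xcoord x i).
    apply: eq_xcoord => j; rewrite xcoord_update !zE ltnS leq_eqVlt.
    have [->|ji] := eqVneq j i; first by rewrite /= eqxx.
    have -> : (nat_of_ord j == n) = false.
      by apply/negbTE; apply: contra ji => /eqP h; apply/eqP/val_inj.
    by [].
  have := HCi i (z n) (xcoord x i); rewrite [xcoord (z n) i]zE /= ltnn => h1.
  have h2 := IH (ltnW nd).
  rewrite (bigD1 i) //= (eq_bigl (fun j : 'I_d => (j < n)%N)); last first.
    move=> j; rewrite ltnS leq_eqVlt.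
    have [->|ji] := eqVneq j i; first by rewrite /= eqxx ltnn.
    rewrite andbT; case: (eqVneq (nat_of_ord j) n) => //= h.
    by case/eqP: ji; apply: val_inj.
  rewrite -(subrKA (f (z n))); apply: (le_trans (ler_normD _ _)).
  rewrite mulrDr; apply: lerD => //; apply: (le_trans h1).
  by apply: ler_wpM2r.
have := step d (leqnn d); rewrite zd => h; apply: (le_trans h).
apply: ler_wpM2l; first by rewrite sumr_ge0.
by rewrite (eq_bigl xpredT) // => i; rewrite ltn_ord.
Qed.

Definition round_to (n : nat) : R -> R := fun s => (Num.floor (s * n.+1%:R))%:~R / n.+1%:R.

Lemma round_to_near n s : `|s - round_to n s| <= n.+1%:R^-1.
Proof.
have n0 : (0 : R) < n.+1%:R by rewrite ltr0n.
have h1 := floor_le (s * n.+1%:R); have h2 := floorD1_gt (s * n.+1%:R).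
rewrite rmorphD /= in h2.
rewrite /round_to -[X in X - _](mulfK (lt0r_neq0 n0)) -mulrBl normrM.
rewrite [X in _ * X]ger0_norm ?invr_ge0 ?(ltW n0) //.
rewrite -[leRHS]mul1r; apply: ler_wpM2r; first by rewrite invr_ge0 ltW.
rewrite ler_norml; lra.
Qed.

Lemma measurable_floor_cell (n : nat) (c : {ffun 'I_d -> int}) :
  measurable [set x : Rd d R | forall i, Num.floor (xcoord x i * n.+1%:R) = c i].
Proof.
rewrite (_ : [set x | _] = box (fun i => [set s : R | Num.floor (s * n.+1%:R) = c i])) //.
apply: measurable_box => i.
have n0 : (0 : R) < n.+1%:R by rewrite ltr0n.
rewrite (_ : [set s | _] = `[(c i)%:~R / n.+1%:R, (c i + 1)%:~R / n.+1%:R[%classic).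
  exact: measurable_itv.
apply/seteqP; split => s /=; rewrite in_itv /= ler_pdivrMr // ltr_pdivlMr //.
  by move=> <-; rewrite floor_le floorD1_gt.
exact: floor_def.
Qed.

(** The composition with the rounding takes one value on each of countably many
    boxes. *)
Lemma measurable_round (n : nat) : measurable_fun setT (fun x => f (coord_map (fun=> round_to n) x)).
Proof.
move=> _ B mB; rewrite setTI.
pose v (c : {ffun 'I_d -> int}) : Rd d R :=
  [tuple ((c i)%:~R / n.+1%:R : measurableTypeR R) | i < d].
pose cell (k : nat) : set (Rd d R) := if unpickle k is Some c then
   (if `[< B (f (v c)) >] then
      [set x : Rd d R | forall i, Num.floor (xcoord x i * n.+1%:R) = c i] else set0)
   else set0.
rewrite (_ : _ @^-1` B = \bigcup_k cell k).
  apply: bigcupT_measurable => k; rewrite /cell; case: unpickle => // c.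
  by case: asboolP => // _; exact: measurable_floor_cell.
have vE x (c : {ffun 'I_d -> int}) : (forall i, Num.floor (xcoord x i * n.+1%:R) = c i) ->
    coord_map (fun=> round_to n) x = v c.
  by move=> h; apply: eq_xcoord => i; rewrite /coord_map /v !xcoord_mk /round_to h.
apply/seteqP; split => x /=.
  pose c : {ffun 'I_d -> int} := [ffun i => Num.floor (xcoord x i * n.+1%:R)].
  have hc i : Num.floor (xcoord x i * n.+1%:R) = c i by rewrite ffunE.
  rewrite (vE x c hc) => Bc; exists (pickle c) => //; rewrite /cell pickleK.
  by case: asboolP.
move=> [k _]; rewrite /cell; case: unpickle => // c; case: asboolP => // Bc hc.
by rewrite (vE x c hc).
Qed.

(** A Lipschitz function is the limit of its compositions with the rounding of
    the coordinates to multiples of 1/(n + 1). *)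
Lemma schwartz_measurable : measurable_fun setT f.
Proof.
have [C C0 HC] := schwartz_lipschitz.
apply: (measurable_fun_cvg measurable_round) => x _.
apply/cvgrPdist_le => e e0.
have cv : (C * d%:R * n.+1%:R^-1) @[n --> \oo] --> (0 : R).
  by rewrite -[X in _ --> X](mulr0 (C * d%:R)); apply: cvgMr; exact: cvg_harmonic.
have := cv => /cvgrPdist_le /(_ e e0); apply: filterS => n.
rewrite sub0r normrN => h; apply: le_trans (HC _ _) _.
apply: le_trans h; rewrite ger0_norm; last by rewrite !mulr_ge0.
rewrite -mulrA; apply: ler_wpM2l => //.
rewrite mulr_natl -[X in _ *+ X]card_ord -sumr_const; apply: ler_sum => i _.
by rewrite /coord_map xcoord_mk; exact: round_to_near.
Qed.

(** The product of the 1 + x_i^2 expands into 2^d monomials, each controlled by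
    one Schwartz seminorm. *)
Lemma schwartz_decay : exists2 C : R, 0 <= C & forall x,
  `|f x| <= C * \prod_(i < d) (oneDsqr (xcoord x i))^-1.
Proof.
have [_ bnd] := fS.
have /fin_all_exists[C HC] : forall b : {ffun 'I_d -> bool}, exists C : R,
    forall x, `|(\prod_(i < d) (xcoord x i ^+ 2) ^+ b i) * f x| <= C.
  move=> b; have [C HC] := bnd [tuple (2 * b i)%N | i < d] [::]; exists C => x.
  have := HC x; rewrite /partials /=.
  by under eq_bigr do rewrite tnth_mktuple exprM.
have C0 b : 0 <= C b by apply: le_trans (HC b [tuple (0 : measurableTypeR R) | _ < d]).
exists (\sum_b C b); first by rewrite sumr_ge0.
move=> x.
have P0 : 0 < \prod_(i < d) oneDsqr (xcoord x i).
  by apply: prodr_gt0 => i _; apply: lt_le_trans (oneDsqr_ge1 _).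
rewrite prodfV ler_pdivlMr //.
have -> : \prod_(i < d) oneDsqr (xcoord x i) =
    \sum_(b : {ffun 'I_d -> bool}) \prod_(i < d) (xcoord x i ^+ 2) ^+ b i.
  rewrite -(bigA_distr_bigA (fun i (b : bool) => (xcoord x i ^+ 2) ^+ b)) /=.
  by apply: eq_bigr => i _; rewrite big_bool /= expr1 expr0 /oneDsqr addrC.
rewrite mulr_sumr; apply: ler_sum => b _.
apply: le_trans (HC b x); rewrite normrM mulrC ler_wpM2r //.
exact: ler_norm.
Qed.

Lemma schwartz_integrable : mu.-integrable setT (EFin \o f).
Proof.
have [C C0 HC] := schwartz_decay.
have mo : measurable_fun [set: R] (fun t : R => (oneDsqr t)^-1).
  by apply: continuous_measurable_fun; exact: continuous_oneDsqrV.
have mP : measurable_fun setT (fun x : Rd d R => \prod_(i < d) (oneDsqr (xcoord x i))^-1).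
  apply: measurable_prod => i _; apply: (measurableT_comp mo).
  exact: measurable_xcoord.
have P0 x : 0 <= \prod_(i < d) (oneDsqr (xcoord x i))^-1.
  by apply: prodr_ge0 => i _; rewrite invr_ge0.
apply: (@le_integrable _ _ _ mu setT measurableT _
  (fun x => C%:E * (\prod_(i < d) (oneDsqr (xcoord x i))^-1)%:E)%E).
- by apply/measurable_EFinP; exact: schwartz_measurable.
- by move=> x _ /=; rewrite lee_fin; apply: (le_trans (HC x)); exact: ler_norm.
apply: integrableZl => //; apply/integrableP; split; first exact/measurable_EFinP.
rewrite (eq_integral (fun x => (\prod_(i < d) (oneDsqr (xcoord x i))^-1)%:E)); last first.
  by move=> x _ /=; rewrite ger0_norm.
rewrite (integral_tensor d mo); last by move=> t; rewrite invr_ge0.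
have := integral_oneDsqr_lty R.
have : (0 <= \int[@lebesgue_measure R]_t ((oneDsqr t)^-1)%:E)%E.
  by apply: integral_ge0 => t _; rewrite lee_fin invr_ge0.
by case: (integral _ _ _) => // r _ _; rewrite -EFin_expe ltry.
Qed.

End schwartz_functions.

Lemma schwartz_L1 (R : realType) (d : nat) (Psi : Rd d R -> R[i]) :
  schwartz Psi -> L1 setT Psi.
Proof. by move=> [h1 h2]; split; exact: schwartz_integrable. Qed.

(** * Comparison of the blocks of two families *)
Section norm_comparison.
Variables (R : realType) (d : nat).
Notation mu := (lebesgue_Rd R d).
Notation D := (torus_cube R d).
Variable p : \bar R.
Hypothesis p0 : (0 < p)%E.

Let mD : measurable D. Proof. exact: measurable_torus_cube. Qed.

Lemma Lpnorm0 (E : set (Rd d R)) : measurable E ->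
  Lpnorm p E (fun=> 0 : R[i]) = 0%E.
Proof.
move=> mE; rewrite (_ : (fun=> 0 : R[i]) = (fun x : Rd d R => 0 * 0 : R[i])).
  by rewrite (LpnormZ 0 p0 mE (cmeas_cst E 0)) Normc.normc0 mul0e.
by apply/funext => x; rewrite mul0r.
Qed.

Lemma Lpnorm_sum (E : set (Rd d R)) (I : Type) (s : seq I) (P : pred I)
    (F : I -> Rd d R -> R[i]) : measurable E -> (forall i, cmeas E (F i)) ->
  (Lpnorm p E (fun x => (\sum_(i <- s | P i) F i x)%R) `^ qexp p <=
     \sum_(i <- s | P i) Lpnorm p E (F i) `^ qexp p)%E.
Proof.
move=> mE mF; elim: s => [|i s IH].
  under eq_fun do rewrite big_nil.
  by rewrite big_nil Lpnorm0 // poweR0r // gt_eqF // qexp_gt0.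
under eq_fun do rewrite big_cons.
rewrite big_cons; case: ifP => // _.
apply: (le_trans (Lpnorm_quasi_triangle p0 mE (mF i) _)).
  exact: cmeas_sum.
by rewrite leeD2l.
Qed.

Lemma trig_sum_wrapd N b (x : Rd d R) : trig_sum N b (wrapd x) = trig_sum N b x.
Proof. by apply: eq_bigr => f _; rewrite mode_wrapd. Qed.

Lemma Lpnorm_trig_translate N b (t : 'I_d -> R) :
  (Lpnorm p D (fun x => trig_sum N b (translate t x)) <= Lpnorm p D (trig_sum N b))%E.
Proof.
rewrite torus_cubeE.
have [K K0 [K1 h]] := Lpnorm_change (coord_change_wrap t) p0.
have := h _ (cmeas_trig_sum _ N b); rewrite (K1 (erefl _)) mul1e; apply: le_trans.
rewrite le_eqVlt; apply/orP; left; apply/eqP; congr (Lpnorm _ _ _).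
by apply/funext => x /=; rewrite wrapd_translate trig_sum_wrapd.
Qed.

(** The box of frequencies must contain the support of the j-th symbol and so
    depends on j; all larger boxes give the same sum. *)
Definition eventual_norm (u : 'I_d -> nat -> int -> R) (a : ('I_d -> int) -> R[i])
    (nu : d.-tuple nat -> \bar R) : Prop :=
  forall j, exists N0, forall N, (N0 <= N)%N ->
    nu j = Lpnorm p D (trig_sum N (fun l => (tensor_mult u (tnth j) l)%:C * a l)).

(** Apply [reproducing] with s = min(1, p), bound each translate by the block it
    comes from, and keep the largest of the boundedly many blocks near j. *)
Lemma multiplier_comparison (u w : 'I_d -> nat -> int -> R) :
  (forall i, mult_family (u i)) -> (forall i, mult_family (w i)) ->
  exists (A : nat) (C : R), 0 <= C /\ forall a nu nw,
    eventual_norm u a nu -> eventual_norm w a nw ->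
    forall j, exists2 j', near_index A j j' & (nu j <= C%:E * nw j')%E.
Proof.
move=> mu_ mw; pose s := qexp p.
have s0 : 0 < s by exact: qexp_gt0.
have [A [C0 [C00 rep]]] := reproducing s0 mu_ mw.
pose C1 : R := C0 * (A.*2.+1 ^ d)%:R.
have C10 : 0 <= C1 by rewrite mulr_ge0.
exists A, (C1 `^ s^-1); split; first exact: powR_ge0.
move=> a nu nw Hu Hw j.
have [M [J [kap [t [kC jJ E]]]]] := rep (tnth j).
pose jt (f : {ffun 'I_d -> 'I_J}) : d.-tuple nat := [tuple (f i : nat) | i < d].
have [Nu HNu] := Hu j.
have /fin_all_exists[Nw HNw] := fun f => Hw (jt f).
pose N := (Nu + \sum_f Nw f)%N.
have NwN f : (Nw f <= N)%N by rewrite /N (bigD1 f) //= addnCA leq_addr.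
have nwE f : nw (jt f) = Lpnorm p D
    (trig_sum N (fun l => (tensor_mult w (fun i => f i) l)%:C * a l)).
  rewrite (HNw f N) //; congr (Lpnorm _ _ (trig_sum _ _)).
  apply/funext => l; congr (_%:C * _); apply: eq_bigr => i _.
  by rewrite tnth_mktuple.
have nw0 f : (0 <= nw (jt f))%E by rewrite nwE Lpnorm_ge0.
have [f0 cf0] : exists f0 : {ffun 'I_d -> 'I_J}, close_to (tnth j) A f0.
  exists [ffun i => Ordinal (jJ i)]; apply/forallP => i.
  by rewrite ffunE /= leq_addr.
case: (arg_maxP (fun f => nw (jt f)) cf0) => f1 cf1 max1.
exists (jt f1) => [i|].
  by rewrite tnth_mktuple; have /forallP/(_ i)/andP := cf1.
have main : (nu j `^ s <= C1%:E * nw (jt f1) `^ s)%E.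
  rewrite (HNu N); last exact: leq_addr.
  have mt f n : cmeas D (fun x => 
      trig_sum N (fun l => (tensor_mult w (fun i => (f : {ffun 'I_d -> 'I_J}) i) l)%:C * a l)
            (translate (t n) x)).
    apply: cmeas_sum => c; apply: cmeasM; first exact: cmeas_cst.
    under eq_fun do rewrite mode_translate.
    by apply: cmeasM; [exact: cmeas_cst|exact: cmeas_mode].
  have mk f n := cmeasM (cmeas_cst D (kap n)) (mt f n).
  rewrite (funext (E N a)).
  apply: (le_trans (Lpnorm_sum _ _ mD _)); first by move=> f; exact: cmeas_sum.
  apply: (@le_trans _ _ (\sum_(f : {ffun 'I_d -> 'I_J} | close_to (tnth j) A f)
      (C0%:E * nw (jt f1) `^ s)))%E.
    apply: lee_sum => f cf.
    apply: (le_trans (Lpnorm_sum _ _ mD _)) => //.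
    apply: (@le_trans _ _ (\sum_n ((Normc.normc (kap n) `^ s)%:E * nw (jt f1) `^ s)))%E.
      apply: lee_sum => n _; rewrite LpnormZ //.
      rewrite poweRM ?lee_fin ?normc_ge0 ?Lpnorm_ge0 // poweR_EFin.
      apply: lee_wpmul2l; first by rewrite lee_fin powR_ge0.
      apply: gt0_ler_poweR; rewrite ?(ltW s0) ?in_itv /= ?leey ?andbT ?Lpnorm_ge0 //.
      apply: (le_trans (Lpnorm_trig_translate _ _ _)).
      by rewrite -nwE; exact: max1.
    rewrite -ge0_sume_distrl; last by move=> n _; rewrite lee_fin powR_ge0.
    rewrite sumEFin; apply: lee_wpmul2r; first exact: poweR_ge0.
    by rewrite lee_fin.
  rewrite -(mul1e (C0%:E * _))%E -ge0_sume_distrl //.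
  rewrite muleA; apply: lee_wpmul2r; first exact: poweR_ge0.
  rewrite sumEFin -EFinM lee_fin mulrC; apply: ler_wpM2l => //.
  by rewrite (sumr_const [pred f | close_to (tnth j) A f]) ler_nat; exact: card_close_to.
have nu0 : (0 <= nu j)%E by rewrite (HNu _ (leqnn _)) Lpnorm_ge0.
have h : ((nu j `^ s) `^ s^-1 <= (C1%:E * nw (jt f1) `^ s) `^ s^-1)%E.
  apply: gt0_ler_poweR => //; rewrite ?invr_ge0 ?(ltW s0) //.
    by rewrite in_itv /= leey andbT poweR_ge0.
  by rewrite in_itv /= leey andbT mule_ge0 // ?lee_fin // poweR_ge0.
move: h; rewrite poweRM ?lee_fin ?poweR_ge0 // -!poweRrM mulfV ?gt_eqF //.
by rewrite !poweRe1.
Qed.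

End norm_comparison.

(** * Cosine blocks as trigonometric sums *)
Section cosine_side.
Variables (R : realType) (d : nat).
Notation mu := (lebesgue_Rd R d).
Notation D := (torus_cube R d).
Implicit Types (l : 'I_d -> int) (x : Rd d R) (f : Rd d R -> R[i]).

Let mD : measurable D. Proof. exact: measurable_torus_cube. Qed.

Definition abs_freq l : d.-tuple nat := [tuple `|l i|%N | i < d].

Definition cos_weight (k : nat) : R := if k is 0%N then 1 else (Num.sqrt 2)^-1.

Lemma cos_weightE (k : nat) (t : R) : cos_weight k * cos1 k t = cos (pi * k%:R * t).
Proof.
case: k => [|k] /=; first by rewrite mulr0 mul0r cos0 mulr1.
by rewrite mulrA mulVf ?mul1r // gt_eqF // sqrtr_gt0.
Qed.

Lemma cos_absz (l : int) (t : R) : cos (pi * l%:~R * t) = cos (pi * `|l|%N%:R * t).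
Proof.
rewrite pmulrn abszE; case: (ger0P l) => // _.
by rewrite rmorphN mulrN mulNr cosN.
Qed.

(** The frequencies k and -k combine into a cosine, while k = 0 occurs once; this
    is what [cos_weight] compensates. *)
Lemma cos_pair (N k : nat) (t : R) : (k <= N)%N ->
  \sum_(n < N.*2.+1 | `|n%:Z - N%:Z|%N == k)
     (cos_weight k)%:C * expi (pi * (n%:Z - N%:Z)%:~R * t) = (cos1 k t)%:C.
Proof.
move=> kN; have Np : (N + k < N.*2.+1)%N by lia.
have Nm : (N - k < N.*2.+1)%N by lia.
have Ep : (N + k)%:Z - N%:Z = k%:Z by lia.
have Em : (N - k)%:Z - N%:Z = - k%:Z by lia.
rewrite (bigD1 (Ordinal Np)) /=; last by rewrite Ep.
rewrite Ep; case: k => [|k] in kN Np Nm Ep Em *.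
  rewrite big1 ?addr0; last first.
    by move=> n /andP[/eqP h1 /eqP h2]; case: h2; apply/val_inj => /=; lia.
  by rewrite mulr0 mul0r expi0 mulr1.
rewrite (bigD1 (Ordinal Nm)) /=; last first.
  apply/andP; split; first by rewrite Em; lia.
  by apply/negP => /eqP/(congr1 val) /=; lia.
rewrite Em big1 ?addr0; last first.
  move=> n /andP[/andP[/eqP h1 /eqP h2] /eqP h3].
  have [h|h] : (n : nat) = (N + k.+1)%N \/ (n : nat) = (N - k.+1)%N by lia.
    by case: h2; exact/val_inj.
  by case: h3; exact/val_inj.
rewrite -mulrDr rmorphN mulrN mulNr expi_addN.
rewrite -(rmorph_nat (real_complex R)) -!rmorphM; congr (_%:C).
have s2 : Num.sqrt 2 * Num.sqrt 2 = 2 :> R by rewrite -expr2 sqr_sqrtr.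
have s0 : Num.sqrt 2 != 0 :> R by rewrite gt_eqF // sqrtr_gt0.
rewrite mulrA; congr (_ * _); apply: (mulfI s0).
by rewrite mulrA divff // mul1r s2.
Qed.

(** Group the frequencies l by |l|; within a group the sum over the signs factors
    over the coordinates. *)
Lemma trig_sum_cosine N (G : d.-tuple nat -> R[i]) x :
  trig_sum N (fun l => G (abs_freq l) * (\prod_(i < d) cos_weight `|l i|%N)%:C) x =
  \sum_(k : {ffun 'I_d -> 'I_N.+1}) G [tuple (k i : nat) | i < d] *
     (hpc [tuple (k i : nat) | i < d] x)%:C.
Proof.
pose kk (b : {ffun 'I_d -> 'I_(N.*2.+1)}) : {ffun 'I_d -> 'I_N.+1} :=
  [ffun i => inord `|box_idx b i|%N].
have bN (b : {ffun 'I_d -> 'I_(N.*2.+1)}) i : (`|box_idx b i| < N.+1)%N.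
  by rewrite /box_idx; have := ltn_ord (b i); lia.
rewrite /trig_sum (partition_big kk predT) //=; apply: eq_bigr => k _.
have kE b : kk b == k -> abs_freq (box_idx b) = [tuple (k i : nat) | i < d].
  move=> /eqP <-; apply: eq_from_tnth => i; rewrite !tnth_mktuple ffunE inordK //.
transitivity (G [tuple (k i : nat) | i < d] * \sum_(b | kk b == k)
   \prod_(i < d) ((cos_weight (k i))%:C * expi (pi * ((b i)%:Z - N%:Z)%:~R * xcoord x i))).
  rewrite mulr_sumr; apply: eq_bigr => b kb.
  rewrite kE // -mulrA big_split /=; congr (_ * (_ * _)).
  rewrite rmorph_prod; apply: eq_bigr => i _; congr ((cos_weight _)%:C).
  by have := congr1 (fun t => tnth t i) (kE _ kb); rewrite !tnth_mktuple.
congr (_ * _); rewrite /hpc rmorph_prod /=.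
under [RHS]eq_bigr => i _ do rewrite tnth_mktuple -(@cos_pair N) -1?ltnS //.
rewrite bigA_distr_big_dep /=; apply: eq_bigl => b; apply/eqP/familyP.
  by move=> <- i; rewrite unfold_in /= ffunE inordK // bN.
move=> h; apply/ffunP => i; rewrite ffunE; apply/val_inj.
by rewrite /= inordK ?bN //; have := h i; rewrite unfold_in => /eqP.
Qed.

Lemma hpc_block_finite (v : d.-tuple nat -> Rd d R -> R) f j N x :
  (forall k, v j (nat_point R k) != 0 -> forall i, (tnth k i <= N)%N) ->
  hpc_block v f j x = \sum_(k : {ffun 'I_d -> 'I_N.+1})
    (v j (nat_point R [tuple (k i : nat) | i < d]))%:C *
    hpc_coef f [tuple (k i : nat) | i < d] * (hpc [tuple (k i : nat) | i < d] x)%:C.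
Proof.
move=> vN; rewrite /hpc_block.
pose jt (k : {ffun 'I_d -> 'I_N.+1}) : d.-tuple nat := [tuple (k i : nat) | i < d].
have inj : injective jt.
  move=> k1 k2 e; apply/ffunP => i; apply/val_inj.
  by have := congr1 (fun t => tnth t i) e; rewrite !tnth_mktuple.
rewrite (@fsbigE _ _ _ _ _ (map jt (enum {: {ffun 'I_d -> 'I_N.+1}}))) //.
- rewrite big_map big_enum_cond /=; apply: eq_bigl => k; by rewrite in_setT.
- by rewrite map_inj_uniq // enum_uniq.
move=> k _ kr; rewrite (_ : v j (nat_point R k) = 0) ?rmorph0 ?mul0r //.
apply/eqP/negP => /negP /vN kN; move/negP: kr; apply; apply/mapP.
exists [ffun i => inord (tnth k i)]; first by rewrite mem_enum.
by apply: eq_from_tnth => i; rewrite tnth_mktuple ffunE inordK // ltnS.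
Qed.

Lemma periodizationE f x : periodization f x = f (coord_map (fun=> @Num.norm R R) x).
Proof. by []. Qed.

Lemma L1_periodization f : L1 (unit_cube R d) f -> L1 D (periodization f).
Proof.
rewrite unit_cubeE torus_cubeE => lf.
by have [] := cint_change (@coord_change_abs R d) lf.
Qed.

Lemma periodization_flip f (e : 'I_d -> bool) x :
  periodization f (coord_map (fun i s => (-1) ^+ e i * s) x) = periodization f x.
Proof.
rewrite !periodizationE; congr f; apply: eq_xcoord => i.
by rewrite /coord_map !xcoord_mk normrM normrX normrN1 expr1n mul1r.
Qed.

(** Against an even function, a mode may be replaced by its average over the sign
    flips, which is a product of cosines.  Folding the torus onto the cube then
    yields the factor 2^d. *)
Lemma fcoef_periodization f l : L1 (unit_cube R d) f ->
  fcoef (periodization f) l =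
    (2 ^+ d)%:C * (\prod_(i < d) cos_weight `|l i|%N)%:C * hpc_coef f (abs_freq l).
Proof.
move=> lf; have lP := L1_periodization lf.
pose cosp x : R := \prod_(i < d) cos (pi * (l i)%:~R * xcoord x i).
pose g x := periodization f x * mode (negfreq l) x.
have lg : L1 D g by exact: L1_mul_mode.
have flip (e : {ffun 'I_d -> bool}) :
    L1 D (g \o coord_map (fun i (s : R) => (-1) ^+ e i * s)) /\
    cintegral D (g \o coord_map (fun i (s : R) => (-1) ^+ e i * s)) = fcoef (periodization f) l.
  have ce : forall i, (-1 : R) ^+ e i = 1 \/ (-1 : R) ^+ e i = -1.
    by move=> i; case: (e i); rewrite ?expr0 ?expr1; [right|left].
  have := lg; rewrite torus_cubeE => lg'.
  have [h1 h2] := cint_change (coord_change_flip ce) lg'.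
  by split => //; rewrite h2 expr1n mul1r /fcoef torus_cubeE.
have avg : fcoef (periodization f) l =
    cintegral D (fun x => periodization f x * (cosp x)%:C).
  have n0 : ((2 ^+ d)%:C : R[i]) != 0.
    by rewrite (_ : 0 = 0%:C) // (inj_eq (@complexI _)) expf_neq0.
  apply: (mulfI n0).
  transitivity (\sum_(e : {ffun 'I_d -> bool}) fcoef (periodization f) l).
    rewrite sumr_const card_ffun card_bool card_ord -[RHS]mulr_natl; congr (_ * _).
    by rewrite natrX rmorphXn rmorph_nat.
  rewrite (eq_bigr _ (fun e _ => esym (flip e).2)) -cint_sum //; last first.
    by move=> e; have [] := flip e.
  rewrite -[RHS]cintZ //; last first.
    apply: (@L1_mulb _ _ _ _ _ 1) => //.
      apply: cmeas_real; apply: measurable_funTS.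
      apply: measurable_prod => i _.
      apply: (measurableT_comp (f := @cos R)).
        by apply: continuous_measurable_fun; exact: continuous_cos.
      by apply: measurable_funM => //; exact: measurable_xcoord.
    move=> x _; rewrite normc_real /cosp normr_prod.
    apply: prodr_ile1 => i; rewrite normr_ge0 /=.
    by rewrite ler_norml cos_geN1 cos_le1.
  apply: eq_cint => x _ /=.
  transitivity (\sum_(e : {ffun 'I_d -> bool}) periodization f x *
      \prod_(i < d) expi (- (pi * (l i)%:~R * xcoord x i) * (-1) ^+ e i)).
    apply: eq_bigr => e _; rewrite /g periodization_flip; congr (_ * _).
    apply: eq_bigr => i _; rewrite /coord_map xcoord_mk /negfreq rmorphN.
    by congr expi; ring.
  rewrite -mulr_sumr mulrCA; congr (_ * _).
  rewrite -(bigA_distr_bigA (fun i (b : bool) =>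
    expi (- (pi * (l i)%:~R * xcoord x i) * (-1) ^+ b))) /=.
  rewrite /cosp -rmorphM -[X in 2 ^+ X](card_ord d) -prodr_const -big_split rmorph_prod.
  apply: eq_bigr => i _; rewrite big_bool /= expr0 expr1 mulr1 mulrN1 opprK.
  by rewrite expi_addN rmorphM rmorph_nat.
rewrite avg; pose h x := f x * (\prod_(i < d) cos (pi * `|l i|%N%:R * xcoord x i))%:C.
have hE x : h x = (\prod_(i < d) cos_weight `|l i|%N)%:C * (f x * (hpc (abs_freq l) x)%:C).
  rewrite mulrCA /h; congr (_ * _); rewrite -rmorphM /hpc -big_split; congr (_%:C).
  by apply: eq_bigr => i _; rewrite tnth_mktuple /= cos_weightE.
have lfh : L1 (unit_cube R d) (fun x => f x * (hpc (abs_freq l) x)%:C).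
  apply: (@L1_mulb _ _ _ _ _ (2 ^+ d)) => //; first exact: measurable_unit_cube.
    apply: cmeas_real; apply: measurable_funTS; apply: measurable_prod => i _.
    rewrite /cos1; case: (tnth _ i) => [|k]; first exact: measurable_cst.
    apply: measurable_funM => //.
    apply: (measurableT_comp (f := @cos R)).
      by apply: continuous_measurable_fun; exact: continuous_cos.
    by apply: measurable_funM => //; exact: measurable_xcoord.
  move=> x _; rewrite normc_real /hpc normr_prod -[X in 2 ^+ X](card_ord d) -prodr_const.
  apply: ler_prod => i _; rewrite normr_ge0 /= /cos1; case: (tnth _ i) => [|k].
    by rewrite normr1; lra.
  rewrite normrM ger0_norm ?sqrtr_ge0 // -[X in _ <= X]mulr1 ler_pM ?sqrtr_ge0 //.
    by rewrite -(@ler_pXn2r _ 2) ?nnegrE ?sqrtr_ge0 // sqr_sqrtr //; lra.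
  by rewrite ler_norml cos_geN1 cos_le1.
have lh : L1 (unit_cube R d) h.
  by rewrite (funext hE); apply: L1Z => //; exact: measurable_unit_cube.
have := lh; rewrite unit_cubeE => lh'.
have [_ E] := cint_change (@coord_change_abs R d) lh'.
rewrite -torus_cubeE -unit_cubeE in E.
rewrite -mulrA -[X in _ = _ * X]cintZ //; last exact: measurable_unit_cube.
rewrite -(funext hE) -E; apply: eq_cint => x _ /=; rewrite /h periodizationE.
congr (_ * (_%:C)); apply: eq_bigr => i _; rewrite /coord_map xcoord_mk cos_absz.
rewrite /=; case: (ger0P (xcoord x i)) => // _.
by rewrite mulrN cosN.
Qed.

Lemma hpc_even (k : d.-tuple nat) x :
  hpc k (coord_map (fun=> @Num.norm R R) x) = hpc k x.
Proof.
apply: eq_bigr => i _; rewrite /coord_map xcoord_mk /cos1; case: (tnth k i) => // n.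
by case: (ger0P (xcoord x i)) => // _; rewrite mulrN cosN.
Qed.

Lemma hpc_block_trig (v : d.-tuple nat -> Rd d R -> R) f j N x :
  L1 (unit_cube R d) f ->
  (forall k, v j (nat_point R k) != 0 -> forall i, (tnth k i <= N)%N) ->
  hpc_block v f j x = trig_sum N (fun l => (v j (nat_point R (abs_freq l)))%:C *
     ((2 ^- d)%:C * fcoef (periodization f) l)) x.
Proof.
move=> lf vN; rewrite (hpc_block_finite _ _ vN).
rewrite -(trig_sum_cosine N (fun k => (v j (nat_point R k))%:C * hpc_coef f k)).
apply: eq_bigr => b _; congr (_ * _).
have e : (2 ^- d)%:C * (2 ^+ d)%:C = 1 :> R[i].
  by rewrite -rmorphM /= mulVf // expf_neq0.
rewrite fcoef_periodization // -mulrA; congr (_ * _).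
by rewrite -(mulrA (2 ^+ d)%:C) mulrA e mul1r mulrC.
Qed.

Lemma cmeas_hpc_block (E : set (Rd d R)) (v : d.-tuple nat -> Rd d R -> R) f j N :
  L1 (unit_cube R d) f ->
  (forall k, v j (nat_point R k) != 0 -> forall i, (tnth k i <= N)%N) ->
  cmeas E (hpc_block v f j).
Proof.
move=> lf vN; rewrite [hpc_block v f j](funext (fun x => hpc_block_trig x lf vN)).
exact: cmeas_trig_sum.
Qed.

Lemma hpc_block_even (v : d.-tuple nat -> Rd d R -> R) f j N x :
  (forall k, v j (nat_point R k) != 0 -> forall i, (tnth k i <= N)%N) ->
  hpc_block v f j (coord_map (fun=> @Num.norm R R) x) = hpc_block v f j x.
Proof.
move=> vN; rewrite !(hpc_block_finite _ _ vN).
by apply: eq_bigr => k _; rewrite hpc_even.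
Qed.

End cosine_side.

(** * The isomorphism *)
Section isomorphism.
Variables (R : realType) (d : nat) (p q : \bar R) (r : R).
Notation mu := (lebesgue_Rd R d).
Notation D := (torus_cube R d).
Notation U := (unit_cube R d).
Hypotheses (p0 : (0 < p)%E) (q0 : (0 < q)%E).

Let mD : measurable D. Proof. exact: measurable_torus_cube. Qed.
Let mU : measurable U. Proof. exact: measurable_unit_cube. Qed.

Lemma tensor_support (u : 'I_d -> nat -> int -> R) (j : 'I_d -> nat) :
  (forall i, mult_family (u i)) ->
  exists N : nat, forall l, tensor_mult u j l != 0 -> forall i, `|l i| <= N%:Z.
Proof.
move=> mf.
have /fin_all_exists[K HK] : forall i, exists K : nat, forall (l : int),
    u i (j i) l != 0 -> `|l| <= (K * 2 ^ j i)%:Z.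
  by move=> i; have [K _ [h _ _]] := mf i; exists K => l /h[].
exists (\sum_i K i * 2 ^ j i)%N => l ul i.
have ui : u i (j i) (l i) != 0.
  by apply: contraNneq ul => h; rewrite /tensor_mult (bigD1 i) //= h mul0r.
by apply: (le_trans (HK _ _ ui)); rewrite lez_nat (bigD1 i) //= leq_addr.
Qed.

Section torus_blocks.
Variables (psi : d.-tuple nat -> Rd d R -> R) (Psi : d.-tuple nat -> Rd d R -> R[i]).
Variable (u : 'I_d -> nat -> int -> R).
Hypotheses (mu_ : forall i, mult_family (u i)) (Psik : kernels_of psi Psi).
Hypothesis psiE : forall j l, psi j (half_freq R l) = tensor_mult u (tnth j) l.

Lemma torus_eventual g : L1 D g ->
  eventual_norm p u (fun l => (2 ^- d)%:C * fcoef g l)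
    (fun j => Lpnorm p D (convolution (Psi j) (torus_ext g))).
Proof.
move=> lg j; have [N0 hN0] := tensor_support (tnth j) mu_; exists N0 => N N0N.
have [sP fP] := Psik j; have lP := schwartz_L1 sP.
apply: Lpnorm_ae => //; first by apply: L1_cmeas; exact: convolution_L1.
  exact: cmeas_trig_sum.
apply: convolution_trig => //; first by move=> l; rewrite fP psiE.
move=> l ul i; apply: (@le_trans _ _ N0%:Z); last by rewrite lez_nat.
by apply: hN0; apply: contraNneq ul => ->.
Qed.

(** By [convolution_trig] the convolutions depend on g only through its Fourier
    coefficients. *)
Lemma besov_torus_norm_ae g1 g2 : L1 D g1 -> L1 D g2 -> ae_eq_on D g1 g2 ->
  besov_torus_norm r p q Psi g1 = besov_torus_norm r p q Psi g2.
Proof.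
move=> l1 l2 g12; congr (besov_lq r q _); apply/funext => j.
have [N1 h1] := torus_eventual l1 j; have [N2 h2] := torus_eventual l2 j.
rewrite (h1 (N1 + N2)%N) ?leq_addr // (h2 (N1 + N2)%N) ?leq_addl //.
congr (Lpnorm _ _ (trig_sum _ _)); apply/funext => l; congr (_ * (_ * _)).
apply: cint_ae => //; try exact: L1_mul_mode.
by apply: filterS g12 => x h Dx; rewrite h.
Qed.

End torus_blocks.

Section cosine_blocks.
Variables (phi : d.-tuple nat -> Rd d R -> R) (w : 'I_d -> nat -> int -> R).
Hypotheses (mw : forall i, mult_family (w i)).
Hypothesis phiE : forall j l, phi j (nat_point R (abs_freq l)) = tensor_mult w (tnth j) l.

Lemma cosine_support j : exists N, forall k, phi j (nat_point R k) != 0 ->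
  forall i, (tnth k i <= N)%N.
Proof.
have [N hN] := tensor_support (tnth j) mw; exists N => k.
have -> : nat_point R k = nat_point R (abs_freq (fun i => (tnth k i)%:Z)).
  by congr nat_point; apply: eq_from_tnth => i; rewrite tnth_mktuple.
by rewrite phiE => /hN h i; have := h i; rewrite lez_nat.
Qed.

Lemma cosine_eventual f : L1 U f ->
  eventual_norm p w (fun l => (2 ^- d)%:C * fcoef (periodization f) l)
    (fun j => Lpnorm p D (hpc_block phi f j)).
Proof.
move=> lf j; have [N0 hN0] := cosine_support j; exists N0 => N N0N.
congr (Lpnorm _ _ _); apply/funext => x.
rewrite (@hpc_block_trig _ _ _ _ _ N) //; last first.
  by move=> k /hN0 h i; exact: leq_trans (h i) N0N.
by congr (trig_sum _ _ _); apply/funext => l; rewrite phiE.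
Qed.

Lemma cosine_norms : exists2 K : R, 0 <= K & forall f j, L1 U f ->
  (Lpnorm p D (hpc_block phi f j) <= K%:E * Lpnorm p U (hpc_block phi f j))%E /\
  (Lpnorm p U (hpc_block phi f j) <= Lpnorm p D (hpc_block phi f j))%E.
Proof.
have [K K0 [_ hK]] := Lpnorm_change (@coord_change_abs R d) p0.
exists K => // f j lf; have [N hN] := cosine_support j.
split; last first.
  apply: Lpnorm_subset => //; first exact: sub_unit_torus.
  exact: cmeas_hpc_block hN.
have := hK (hpc_block phi f j) (cmeas_hpc_block _ lf hN).
rewrite -torus_cubeE -unit_cubeE; apply: le_trans.
rewrite le_eqVlt; apply/orP; left; apply/eqP; congr (Lpnorm _ _ _).
by apply/funext => x /=; rewrite (hpc_block_even _ _ hN).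
Qed.

End cosine_blocks.

(** The finitely many sign flips fix g simultaneously outside a null set, and the
    flip by the signs of the coordinates of x takes x to |x|. *)
Lemma even_periodization g : even_torus g -> ae_eq_on D (periodization g) g.
Proof.
move=> eg.
have H : {ae mu, forall x, forall e : d.-tuple bool, D x -> g (flip_signs e x) = g x}.
  apply: filter_forall => e; exact: (eg e).
apply: filterS H => x h Dx.
rewrite -(h [tuple xcoord x i < 0 | i < d] Dx) periodizationE; congr g.
apply: eq_xcoord => i; rewrite /coord_map /flip_signs !xcoord_mk tnth_mktuple.
by case: (ltrP (xcoord x i)) => h0; rewrite ?expr1 ?expr0; [rewrite ltr0_norm ?mulN1r|rewrite ger0_norm ?mul1r].
Qed.

Section families.
Variables (phi psi : d.-tuple nat -> Rd d R -> R) (Psi : d.-tuple nat -> Rd d R -> R[i]).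
Variables (u w : 'I_d -> nat -> int -> R).
Hypotheses (mu_ : forall i, mult_family (u i)) (mw : forall i, mult_family (w i)).
Hypothesis Psik : kernels_of psi Psi.
Hypothesis psiE : forall j l, psi j (half_freq R l) = tensor_mult u (tnth j) l.
Hypothesis phiE : forall j l, phi j (nat_point R (abs_freq l)) = tensor_mult w (tnth j) l.

Lemma periodization_bounded : exists2 C : R, 0 <= C & forall f, L1 U f ->
  (besov_torus_norm r p q Psi (periodization f) <= C%:E * besov_hpc_norm r p q phi f)%E.
Proof.
have [A [C [C0 cmp]]] := multiplier_comparison p0 mu_ mw.
have [K K0 hK] := cosine_norms mw phiE.
have [C' C'0 h] := besov_lq_le d r A q0 (mulr_ge0 C0 K0).
exists C' => // f lf; apply: h; try by move=> j; exact: Lpnorm_ge0.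
move=> j; have [j' jj' hj] := cmp _ _ _
  (torus_eventual mu_ Psik psiE (L1_periodization lf)) (cosine_eventual mw phiE lf) j.
exists j' => //; apply: (le_trans hj); rewrite EFinM -muleA.
by apply: lee_wpmul2l; rewrite ?lee_fin //; have [] := hK f j' lf.
Qed.

Lemma restriction_bounded : exists2 C : R, 0 <= C & forall f, L1 U f ->
  (besov_hpc_norm r p q phi f <= C%:E * besov_torus_norm r p q Psi (periodization f))%E.
Proof.
have [A [C [C0 cmp]]] := multiplier_comparison p0 mw mu_.
have [K K0 hK] := cosine_norms mw phiE.
have [C' C'0 h] := besov_lq_le d r A q0 C0.
exists C' => // f lf; apply: h; try by move=> j; exact: Lpnorm_ge0.
move=> j; have [j' jj' hj] := cmp _ _ _ (cosine_eventual mw phiE lf)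
  (torus_eventual mu_ Psik psiE (L1_periodization lf)) j.
exists j' => //; apply: le_trans hj; by have [] := hK f j lf.
Qed.

Lemma periodization_isomorphism :
  qn_isomorphism (besov_hpc r p q phi) (besov_torus_even r p q Psi) (@periodization R d).
Proof.
have [C1 C10 hC1] := periodization_bounded.
have [C2 C20 hC2] := restriction_bounded.
split.
- split=> [f [lf nf]|f g _ _ fg].
    split; last first.
      move=> e; apply: nearW => x _ /=.
      exact: (periodization_flip f (tnth e) x).
    split; first exact: L1_periodization.
    by apply: (le_lt_trans (hC1 f lf)); rewrite lte_mul_pinfty // lee_fin.
  have := fg; rewrite /= /ae_eq_on unit_cubeE torus_cubeE => fg'.
  have [c0 m1 m2 m3 [DT Doo DTE]] := @coord_change_abs R d.
  exact: (ae_change c0 m1 m2 m3 DT Doo DTE fg').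
- by move=> a f g _ _; apply: nearW => x _.
- split=> [f g _ _ fg|g [[lg ng] eg]].
    apply: filterS fg => x h Ux; have := h (sub_unit_torus Ux).
    suff -> : periodization f x = f x.
      suff -> : periodization g x = g x by [].
      rewrite periodizationE; congr g; apply: eq_xcoord => i.
      by rewrite /coord_map xcoord_mk ger0_norm //; have /andP[] := Ux i.
    rewrite periodizationE; congr f; apply: eq_xcoord => i.
    by rewrite /coord_map xcoord_mk ger0_norm //; have /andP[] := Ux i.
  have lU : L1 U g by apply: L1_subset lg => //; exact: sub_unit_torus.
  have Pg := even_periodization eg.
  exists g => //; split => //; apply: (le_lt_trans (hC2 g lU)).
  rewrite (besov_torus_norm_ae mu_ Psik psiE (L1_periodization lU) lg Pg).
  by rewrite lte_mul_pinfty // lee_fin.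
- by exists C1 => f [lf _]; exact: hC1.
- by exists C2 => f [lf _]; exact: hC2.
Qed.

End families.
End isomorphism.

Theorem theorem3p13 (R : realType) (d : nat) (p q : \bar R) (r : R)
    (phi psi : d.-tuple nat -> Rd d R -> R)
    (Psi : d.-tuple nat -> Rd d R -> R[i]) :
  (0 < d)%N -> (0 < p)%E -> (0 < q)%E -> (sigma_p p < r%:E)%E ->
  Phi_hyp phi -> Phi_hyp psi -> kernels_of psi Psi ->
  qn_isomorphism (besov_hpc r p q phi) (besov_torus_even r p q Psi)
    (@periodization R d).
Proof.
move=> _ p0 q0 _ [phi1 dphi phiE] [psi1 dpsi psiE] Psik.
apply: (periodization_isomorphism (psi := psi) r p0 q0
  (fun i => (dyadic_mult_family (dpsi i)).1)
  (fun i => (dyadic_mult_family (dphi i)).2)) => //.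
- by move=> j l; rewrite psiE; apply: eq_bigr => i _; rewrite /half_freq xcoord_mk.
move=> j l; rewrite phiE; apply: eq_bigr => i _.
by rewrite /nat_point xcoord_mk tnth_mktuple pmulrn abszE.
Qed.
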